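(* Let $A=kQ/I$ be a gentle algebra with fringed algebra $\hat A=k\hat Q/\hat I$, and let $X$ and $Y$ be strings in $Q$. Then $$\operatorname{kiss}(\operatorname{cohook}(X),\operatorname{cohook}(Y))=\dim_k\operatorname{Hom}_{\hat A}(X,\tau_{\hat A}Y)=\dim_k\operatorname{Hom}_A(X,\tau_AY).$$
   Context: **Gentle algebras.** $k$ is a field. Quivers $Q=(Q_0,Q_1,s,e)$ are finite and connected; $s(\gamma),e(\gamma)$ are the source and target of an arrow $\gamma$. Paths are written right to left: $\gamma_m\cdots\gamma_1$ is a path if $s(\gamma_{j+1})=e(\gamma_j)$. $A=kQ/I$ is gentle if $I$ is an admissible ideal generated by paths of length two, every vertex has at most two incoming and two outgoing arrows, and for every arrow $\alpha$ there is at most one arrow $\beta$ with $\alpha\beta$ a path not in $I$, at most one $\gamma$ with $\gamma\alpha$ a path not in $I$, at most one $\beta$ with $\alpha\beta$ a path in $I$, and at most one $\gamma$ with $\gamma\alpha$ a path in $I$. **Strings.** To each arrow $\delta$ associate a formal inverse $\delta^{-1}$ with $s(\delta^{-1})=e(\delta)$, $e(\delta^{-1})=s(\delta)$. A string in $Q$ is either a lazy path $e_x$ at a vertex $x$ (length zero, its own inverse) or a path $C=\gamma_n\cdots\gamma_1$ whose letters are arrows (''direct'') or formal inverses (''inverse''), such that no letter is followed by its inverse and neither $C$ nor $C^{-1}$ contains a subpath in $I$; $s(C)=s(\gamma_1)$, $e(C)=e(\gamma_n)$. A string is direct (inverse) if all its letters are. The string module $M(C)$ has basis $z_0,\dots,z_n$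 placed at the successive vertices of $C$; a direct $\gamma_i$ sends $z_{i-1}$ to $z_i$, and if $\gamma_i=\delta^{-1}$ then $\delta$ sends $z_i$ to $z_{i-1}$; all other actions of arrows are zero. $M(C)\cong M(C^{-1})$; strings $C$ and $C^{-1}$ are identified, and $C$ also denotes $M(C)$. $\tau_A$, $\tau_{\hat A}$ are the Auslander–Reiten translations. **Fringed algebra.** A vertex is defective if it does not have exactly two incoming and two outgoing arrows. $\hat Q$ is obtained from $Q$ by adding, for each defective vertex $v$ of $Q$, new vertices (fringe vertices), each joined to $v$ by one new arrow into or out of $v$, so that every vertex of $Q_0$ has exactly two incoming and two outgoing arrows in $\hat Q$. $\hat I\supseteq I$ is the ideal of $k\hat Q$ (well defined up to relabelling fringe vertices) obtained by adding to $I$ length-two paths involving new arrows, passing through vertices of $Q_0$, so that $\hat A=k\hat Q/\hat I$ is gentle. $A$ is the quotient of $\hat A$ by the ideal generated by the idempotents of the fringe vertices, so $A$-modules are $\hat A$-modules and strings in $Q$ are strings in $\hat Q$. **Cohook completion.** For a string $X$ in $Q$, $\operatorname{cohook}(X)=\mathcal I\,\beta\,X\,\alpha^{-1}\,\mathcal D$, a string in $\hat Q$, where $\alpha,\beta$ are the arrows of $\hat Q$ such that $\beta X\alpha^{-1}$ is a string in $\hat Q$ (for $X=e_x$ they are the two distinct arrows of $\hat Q$ starting at $x$), $\mathcal D$ is the longest direct string with $\alpha^{-1}\mathcal D$ a string in $\hat Q$, and $\mathcal I$ is the longest inverse string with $\mathcal I\beta$ a string in $\hat Q$. **Factorizations.**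 A factorization $C=FED$ of a string into strings, written $(F,E,D)$, is a quotient factorization if $D$ is lazy or its last (leftmost) letter is inverse, and $F$ is lazy or its first (rightmost) letter is direct. It is a submodule factorization if $D$ is lazy or its last letter is direct, and $F$ is lazy or its first letter is inverse. **Kisses.** A kiss from a string $C$ to a string $C'$ along $Z$ is a pair consisting of a quotient factorization $(C_2,Z,C_1)$ of $C$ and a submodule factorization $(C_2',Z,C_1')$ of $C'$ (the middle terms being required to agree up to inversion), such that $C_1,C_2,C_1',C_2'$ all have strictly positive length. $\operatorname{kiss}(C,C')$ is the number of kisses from $C$ to $C'$. *)

(* Defs.v *)
From HB Require Import structures.
From Stdlib Require Import ClassicalEpsilon.
From mathcomp Require Import all_boot all_order all_algebra.
Set Implicit Arguments.
Unset Strict Implicit.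
Unset Printing Implicit Defensive.
Import GRing.Theory.
Local Open Scope ring_scope.

(** * Gentle bound quivers *)

Record quiver := Quiver {
  vtx : finType;
  arr : finType;
  src : arr -> vtx;
  tgt : arr -> vtx }.

Definition indeg (Q : quiver) (v : vtx Q) : nat := #|[set a : arr Q | tgt a == v]|.
Definition outdeg (Q : quiver) (v : vtx Q) : nat := #|[set a : arr Q | src a == v]|.

Definition connected (Q : quiver) : Prop :=
  forall x y : vtx Q,
    connect [rel u v | [exists a : arr Q, ((src a == u) && (tgt a == v))
                                       || ((src a == v) && (tgt a == u))]] x y.

(* A quiver with an ideal generated by paths of length two: [zrel b a] means
   that the path [b a] (first [a], then [b]) is one of the generators. *)
Record bquiver := BQuiver {
  bq_quiver :> quiver;
  zrel : rel (arr bq_quiver) }.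

(* Paths are given as lists of arrows in the order in which they are traversed,
   i.e. the path $a_m\cdots a_1$ is [[:: a_1; ...; a_m]]. *)
Definition composable (Q : quiver) : rel (arr Q) := fun a b => src b == tgt a.

(* [a], then [b], with the path [b a] not in the ideal. *)
Definition nonzero_step (B : bquiver) : rel (arr B) :=
  fun a b => composable a b && ~~ zrel b a.

Record gentle (B : bquiver) : Prop := Gentle {
  gentle_path : forall b a : arr B, zrel b a -> composable a b;
  (* Admissibility: all paths of some length [m >= 2] lie in the ideal, i.e. one
     of their subpaths of length two is a generator. *)
  gentle_admissible : exists2 m : nat, (2 <= m)%N &
    forall p : seq (arr B), size p = m ->
      sorted (@composable B) p -> ~~ sorted (@nonzero_step B) p;
  gentle_in : forall v : vtx B, (indeg v <= 2)%N;
  gentle_out : forall v : vtx B, (outdeg v <= 2)%N;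
  gentle_left_nz : forall a b b' : arr B,
    nonzero_step b a -> nonzero_step b' a -> b = b';
  gentle_right_nz : forall a c c' : arr B,
    nonzero_step a c -> nonzero_step a c' -> c = c';
  gentle_left_z : forall a b b' : arr B, zrel a b -> zrel a b' -> b = b';
  gentle_right_z : forall a c c' : arr B, zrel c a -> zrel c' a -> c = c' }.

(** * The fringed algebra *)

(* [fringe_in Q] indexes the fringe vertices joined to [v] by an arrow into
   [v], and also these arrows; likewise [fringe_out Q] for arrows out of [v]. *)
Definition fringe_in (Q : quiver) : finType := {v : vtx Q & 'I_(2 - indeg v)}.
Definition fringe_out (Q : quiver) : finType := {v : vtx Q & 'I_(2 - outdeg v)}.

Definition fringe_src (Q : quiver) (a : arr Q + (fringe_in Q + fringe_out Q)) :
    vtx Q + (fringe_in Q + fringe_out Q) :=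
  match a with
  | inl a => inl (src a)
  | inr (inl f) => inr (inl f)
  | inr (inr f) => inl (tag f)
  end.

Definition fringe_tgt (Q : quiver) (a : arr Q + (fringe_in Q + fringe_out Q)) :
    vtx Q + (fringe_in Q + fringe_out Q) :=
  match a with
  | inl a => inl (tgt a)
  | inr (inl f) => inl (tag f)
  | inr (inr f) => inr (inr f)
  end.

Definition fringe_quiver (Q : quiver) : quiver :=
  Quiver (@fringe_src Q) (@fringe_tgt Q).

(* The ideal $\hat I$ is only determined up to relabelling the fringe vertices,
   so it is specified rather than chosen. *)
Record fringed (B : bquiver) (R : rel (arr (fringe_quiver B))) : Prop := Fringed {
  fringed_old : forall a b : arr B, R (inl b) (inl a) = zrel b a;
  fringed_through : forall a b : arr (fringe_quiver B),
    R b a -> exists v : vtx B, tgt a = inl v /\ src b = inl v;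
  fringed_gentle : gentle (BQuiver R) }.

(** * Strings *)

(* [(a, true)] is the arrow [a], [(a, false)] its formal inverse. *)
Definition letter (Q : quiver) : Type := (arr Q * bool)%type.
Definition lsrc (Q : quiver) (l : letter Q) : vtx Q := if l.2 then src l.1 else tgt l.1.
Definition ltgt (Q : quiver) (l : letter Q) : vtx Q := if l.2 then tgt l.1 else src l.1.
Definition linv (Q : quiver) (l : letter Q) : letter Q := (l.1, ~~ l.2).

(* A word is a starting vertex with the list of its letters in the order in which
   they are traversed: $\gamma_n\cdots\gamma_1$ starting at $x$ is
   [(x, [:: gamma_1; ...; gamma_n])], and [(x, [::])] is the lazy path at $x$. *)
Definition word (Q : quiver) : Type := (vtx Q * seq (letter Q))%type.
Definition wlen (Q : quiver) (C : word Q) : nat := size C.2.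
Definition wvtx (Q : quiver) (C : word Q) (i : nat) : vtx Q :=
  last C.1 (map (@ltgt Q) (take i C.2)).
Definition wsrc (Q : quiver) (C : word Q) : vtx Q := C.1.
Definition wtgt (Q : quiver) (C : word Q) : vtx Q := wvtx C (wlen C).
Definition winv (Q : quiver) (C : word Q) : word Q :=
  (wtgt C, rev (map (@linv Q) C.2)).
Definition wletter (Q : quiver) (l : letter Q) : word Q := (lsrc l, [:: l]).
(* [wcat C D] is $CD$, i.e. first [D], then [C]; it is only meaningful when
   [wtgt D = wsrc C]. *)
Definition wcat (Q : quiver) (C D : word Q) : word Q := (wsrc D, D.2 ++ C.2).

(* [m] may follow [l] in a string. *)
Definition string_step (B : bquiver) (l m : letter B) : bool :=
  [&& lsrc m == ltgt l, m != linv l &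
      match l.2, m.2 with
      | true, true => ~~ zrel m.1 l.1
      | false, false => ~~ zrel l.1 m.1
      | _, _ => true
      end].

Definition is_string (B : bquiver) (C : word B) : bool :=
  (if ohead C.2 is Some l then lsrc l == C.1 else true)
  && sorted (@string_step B) C.2.

Definition is_direct (Q : quiver) (C : word Q) : bool := all (fun l => l.2) C.2.
Definition is_inverse (Q : quiver) (C : word Q) : bool := all (fun l => ~~ l.2) C.2.

(* A string in [Q], seen as a string in the fringed quiver. *)
Definition fringe_word (Q : quiver) (C : word Q) : word (fringe_quiver Q) :=
  (inl C.1, [seq (inl l.1, l.2) | l <- C.2]).

(** * Cohook completion *)

Definition longest (Q : quiver) (P : word Q -> Prop) (C : word Q) : Prop :=
  P C /\ forall C', P C' -> (wlen C' <= wlen C)%N.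

(* For lazy [X] there are two choices, related by exchanging [a] and [b]; they
   give mutually inverse words. *)
Definition is_cohook (B : bquiver) (X C : word B) : Prop :=
  exists (a b : arr B) (D I : word B),
  let ainv := wletter (a, false) in
  let bdir := wletter (b, true) in
  [/\ [/\ src a = wsrc X, src b = wtgt X & is_string (wcat bdir (wcat X ainv))],
      longest (fun D' => [/\ is_string D', is_direct D', wtgt D' = tgt a &
                             is_string (wcat ainv D')]) D,
      longest (fun I' => [/\ is_string I', is_inverse I', wsrc I' = tgt b &
                             is_string (wcat I' bdir)]) I
    & C = wcat I (wcat bdir (wcat X (wcat ainv D)))].

Definition cohook (B : bquiver) (X : word B) : word B :=
  epsilon (inhabits X) (is_cohook X).

(** * Kisses *)

Definition subword (Q : quiver) (C : word Q) (i j : nat) : word Q :=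
  (wvtx C i, take (j - i) (drop i C.2)).

(* All triples $(F,E,D)$ with $C = FED$. *)
Definition factorizations (Q : quiver) (C : word Q) :
    seq (word Q * word Q * word Q) :=
  let n := wlen C in
  [seq (subword C j n, subword C i j, subword C 0 i)
  | i <- iota 0 n.+1, j <- iota i (n.+1 - i)].

Definition quotient_fact (Q : quiver) (t : word Q * word Q * word Q) : bool :=
  let: (F, _, D) := t in
  (if ohead (rev D.2) is Some l then ~~ l.2 else true)
  && (if ohead F.2 is Some l then l.2 else true).

Definition submodule_fact (Q : quiver) (t : word Q * word Q * word Q) : bool :=
  let: (F, _, D) := t in
  (if ohead (rev D.2) is Some l then l.2 else true)
  && (if ohead F.2 is Some l then ~~ l.2 else true).

Definition is_kiss (Q : quiver)
    (p : (word Q * word Q * word Q) * (word Q * word Q * word Q)) : bool :=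
  let: ((C2, Z, C1) as t, (C2', Z', C1') as t') := p in
  [&& quotient_fact t, submodule_fact t', (Z' == Z) || (Z' == winv Z),
      (0 < wlen C1)%N, (0 < wlen C2)%N, (0 < wlen C1')%N & (0 < wlen C2')%N].

Definition kiss (Q : quiver) (C C' : word Q) : nat :=
  count (@is_kiss Q) [seq (t, t') | t <- factorizations C, t' <- factorizations C'].

(** * Modules *)

(* Finite-dimensional left modules over [kQ/I], given by the actions of the
   generators of the algebra: the idempotents $e_x$ and the arrows. *)
Record rep (k : fieldType) (Q : quiver) := Rep {
  carrier :> vectType k;
  ract_v : vtx Q -> 'End(carrier);
  ract_a : arr Q -> 'End(carrier) }.

Record is_module (k : fieldType) (B : bquiver) (M : rep k B) : Prop := IsModule {
  module_1 : \sum_x ract_v M x = \1%VF;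
  module_e : forall x y : vtx B,
    (ract_v M x \o ract_v M y)%VF = if x == y then ract_v M x else 0;
  module_a : forall a : arr B,
    (ract_v M (tgt a) \o ract_a M a \o ract_v M (src a))%VF = ract_a M a;
  module_z : forall a b : arr B, zrel b a -> (ract_a M b \o ract_a M a)%VF = 0 }.

Definition HomA (k : fieldType) (Q : quiver) (M N : rep k Q) : {vspace 'Hom(M, N)} :=
  ((\bigcap_(x : vtx Q)
      lker (linfun (fun f : 'Hom(M, N) =>
                      (f \o ract_v M x)%VF - (ract_v N x \o f)%VF)))
   :&: (\bigcap_(a : arr Q)
      lker (linfun (fun f : 'Hom(M, N) =>
                      (f \o ract_a M a)%VF - (ract_a N a \o f)%VF))))%VS.

Lemma linfunE (k : fieldType) (U V : vectType k) (f : U -> V) :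
  linear f -> linfun f =1 f.
Proof.
move=> lin u; pose F := GRing.isLinear.Build _ _ _ _ _ lin.
pose FF : {linear U -> V} := HB.pack f F.
exact: (lfunE FF).
Qed.

Lemma mem_HomA (k : fieldType) (Q : quiver) (M N : rep k Q) (f : 'Hom(M, N)) :
  (f \in HomA M N) <->
  (forall x, f \o ract_v M x = ract_v N x \o f)%VF /\
  (forall a, f \o ract_a M a = ract_a N a \o f)%VF.
Proof.
have key (g : 'End(M)) (h : 'End(N)) :
    (f \in lker (linfun (fun f : 'Hom(M, N) => (f \o g)%VF - (h \o f)%VF)))
    = ((f \o g)%VF == (h \o f)%VF).
  rewrite memv_ker linfunE ?subr_eq0 // => c u v.
  rewrite comp_lfunDl comp_lfunDr -comp_lfunZl -comp_lfunZr.
  by rewrite scalerBr opprD addrACA.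
have cap (I : finType) (U : I -> {vspace 'Hom(M, N)}) :
    (f \in (\bigcap_i U i)%VS) <-> (forall i, f \in U i).
  rewrite memvE; split=> [/subv_bigcapP h i | h]; first by rewrite memvE h.
  by apply/subv_bigcapP => i _; rewrite -memvE.
rewrite memv_cap; split=> [/andP[/cap hv /cap ha] | [hv ha]].
  by split=> i; apply/eqP; rewrite -key.
by apply/andP; split; apply/cap => i; rewrite key ?hv ?ha.
Qed.

(* The linear map sending the basis vector [i] to the sum of the basis vectors
   [j] with [c i j]. *)
Definition basis_map (k : fieldType) (I J : finType) (c : I -> J -> bool) :
    'Hom({ffun I -> k^o}, {ffun J -> k^o}) :=
  linfun (fun f : {ffun I -> k^o} =>
            [ffun j => \sum_(i | c i j) f i] : {ffun J -> k^o}).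

Lemma basis_mapE (k : fieldType) (I J : finType) (c : I -> J -> bool)
    (f : {ffun I -> k^o}) (j : J) :
  basis_map k c f j = \sum_(i | c i j) f i.
Proof.
rewrite linfunE ?ffunE // => a u v; apply/ffunP => j'; rewrite !ffunE.
by rewrite scaler_sumr -big_split; apply: eq_bigr => i _; rewrite !ffunE.
Qed.

(* [M(C)], with basis $z_0,\dots,z_n$. *)
Definition string_module (k : fieldType) (B : bquiver) (C : word B) : rep k B :=
  @Rep k B {ffun 'I_(wlen C).+1 -> k^o}
    (fun x => basis_map k (fun i j : 'I_(wlen C).+1 => (j == i) && (wvtx C i == x)))
    (fun a => basis_map k (fun i j : 'I_(wlen C).+1 =>
        ((j == i.+1 :> nat) && (onth C.2 i == Some (a, true)))
     || ((i == j.+1 :> nat) && (onth C.2 j == Some (a, false))))).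

(** * The algebra [kQ/I] as a bimodule over itself *)

Definition is_nonzero_path (B : bquiver) (p : vtx B * seq (arr B)) : bool :=
  (if ohead p.2 is Some a then src a == p.1 else true)
  && sorted (@nonzero_step B) p.2.

Lemma size_nonzero_path (B : bquiver) (x : vtx B) (p : seq (arr B)) :
  gentle B -> is_nonzero_path (x, p) -> (size p <= #|arr B|)%N.
Proof.
move=> gB /andP[_ /= sp]; have [m _ zm] := gentle_admissible gB.
have [/card_uniqP <- | Up] := boolP (uniq p); first exact: max_card.
case: p sp Up => // a0 p' sp; set p := a0 :: p' in sp *.
case/(uniqPn a0) => i [j [lt_ij lt_j eq_ij]].
pose d := (j - i)%N; have d0 : (0 < d)%N by rewrite subn_gt0.
pose f n := nth a0 p (i + n %% d).
have step n : nonzero_step (f n) (f n.+1).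
  have ltn : (i + (n %% d).+1 <= j)%N.
    by rewrite -(subnKC (ltnW lt_ij)) leq_add2l ltn_pmod.
  have -> : f n.+1 = nth a0 p (i + n %% d).+1.
    rewrite /f -addn1 -modnDml addn1 -addnS.
    move: (ltn_pmod n d0); rewrite leq_eqVlt => /orP[/eqP -> | lt_d].
      by rewrite modnn addn0 eq_ij /d subnKC // ltnW.
    by rewrite modn_small.
  move/(sortedP a0): sp; apply; rewrite -addnS.
  exact: leq_ltn_trans ltn lt_j.
have sorted_f (e : rel (arr B)) :
    (forall n, e (f n) (f n.+1)) -> sorted e (mkseq f m).
  move=> ef; apply/(sortedP a0) => n; rewrite size_mkseq => lt_n.
  by rewrite !nth_mkseq ?(ltnW lt_n).
have /negP[] := zm _ (size_mkseq f m) (sorted_f _ (fun n => proj1 (andP (step n)))).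
exact: sorted_f.
Qed.

(* The paths not in [I], including the lazy ones, form a basis of [kQ/I]. They
   have at most [#|arr B|] arrows, by admissibility: see [size_nonzero_path]. *)
Definition npath (B : bquiver) : finType :=
  {p : vtx B * (#|arr B|.-bseq (arr B)) | is_nonzero_path (p.1, val p.2)}.
Definition pstart (B : bquiver) (p : npath B) : vtx B := (val p).1.
Definition parrows (B : bquiver) (p : npath B) : seq (arr B) := val (val p).2.
Definition pend (B : bquiver) (p : npath B) : vtx B :=
  last (pstart p) (map (@tgt B) (parrows p)).

(* $kQ/I$ as a left module over itself. *)
Definition regular (k : fieldType) (B : bquiver) : rep k B :=
  @Rep k B {ffun npath B -> k^o}
    (fun x => basis_map k (fun p q : npath B => (q == p) && (pend p == x)))
    (fun a => basis_map k (fun p q : npath B =>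
        (pstart q == pstart p) && (parrows q == rcons (parrows p) a))).

(* Right multiplication by $e_x$ and by an arrow. *)
Definition rmul_v (k : fieldType) (B : bquiver) (x : vtx B) : 'End(regular k B) :=
  basis_map k (fun p q : npath B => (q == p) && (pstart p == x)).
Definition rmul_a (k : fieldType) (B : bquiver) (a : arr B) : 'End(regular k B) :=
  basis_map k (fun p q : npath B =>
      [&& pstart p == tgt a, pstart q == src a & parrows q == a :: parrows p]).

(** * The Auslander-Reiten translation *)

Definition transpose_space (k : fieldType) (B : bquiver) (P : rep k B) : vectType k :=
  subvs_of (HomA P (regular k B)).

(* The right action on $P^t = \operatorname{Hom}_A(P,A)$ coming from the one on [A];
   [r] is one of the maps [rmul_v], [rmul_a]. *)
Definition transpose_act (k : fieldType) (B : bquiver) (P : rep k B)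
    (r : 'End(regular k B)) : 'End(transpose_space P) :=
  linfun (fun f : transpose_space P =>
            vsproj (HomA P (regular k B)) (r \o vsval f)%VF : transpose_space P).

(* $p^t : P_0^t \to P_1^t$ for $p : P_1 \to P_0$. *)
Definition transpose_map (k : fieldType) (B : bquiver) (P1 P0 : rep k B)
    (p : 'Hom(P1, P0)) : 'Hom(transpose_space P0, transpose_space P1) :=
  linfun (fun f : transpose_space P0 =>
            vsproj (HomA P1 (regular k B)) (vsval f \o p)%VF : transpose_space P1).

(* The linear dual of a linear map. *)
Definition dual_map (k : fieldType) (U V : vectType k) (g : 'Hom(U, V)) :
    'Hom('Hom(V, k^o), 'Hom(U, k^o)) :=
  linfun (fun phi : 'Hom(V, k^o) => (phi \o g)%VF : 'Hom(U, k^o)).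

(* The Nakayama functor $\nu = D\operatorname{Hom}_A(-,A)$. *)
Definition nakayama (k : fieldType) (B : bquiver) (P : rep k B) : rep k B :=
  @Rep k B 'Hom(transpose_space P, k^o)
    (fun x => dual_map (transpose_act P (rmul_v k x)))
    (fun a => dual_map (transpose_act P (rmul_a k a))).
Definition nakayama_map (k : fieldType) (B : bquiver) (P1 P0 : rep k B)
    (p : 'Hom(P1, P0)) : 'Hom(nakayama P1, nakayama P0) :=
  dual_map (transpose_map p).

Definition kernel_module (k : fieldType) (Q : quiver) (M N : rep k Q)
    (f : 'Hom(M, N)) : rep k Q :=
  @Rep k Q (subvs_of (lker f))
    (fun x => linfun (fun v : subvs_of (lker f) => vsproj (lker f) (ract_v M x (vsval v))))
    (fun a => linfun (fun v : subvs_of (lker f) => vsproj (lker f) (ract_a M a (vsval v)))).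

Definition submodule (k : fieldType) (Q : quiver) (M : rep k Q) (U : {vspace M}) : Prop :=
  (forall x, ract_v M x @: U <= U)%VS /\ (forall a, ract_a M a @: U <= U)%VS.

Definition superfluous (k : fieldType) (Q : quiver) (M : rep k Q) (U : {vspace M}) : Prop :=
  forall L : {vspace M}, submodule L -> (U + L = fullv)%VS -> L = fullv.

Definition projective (k : fieldType) (B : bquiver) (P : rep k B) : Prop :=
  forall (M N : rep k B) (g : 'Hom(M, N)) (f : 'Hom(P, N)),
    is_module M -> is_module N ->
    g \in HomA M N -> limg g = fullv -> f \in HomA P N ->
    exists2 h : 'Hom(P, M), h \in HomA P M & (g \o h)%VF = f.

(* $P_1 \xrightarrow{p_1} P_0 \xrightarrow{p_0} M$ *)
Record presentation (k : fieldType) (Q : quiver) (M : rep k Q) := Presentation {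
  pres1 : rep k Q;
  pres0 : rep k Q;
  pmap1 : 'Hom(pres1, pres0);
  pmap0 : 'Hom(pres0, M) }.

(* [pmap0] is a projective cover of [M] and [pmap1] induces a projective cover of
   [lker pmap0]. *)
Record minimal_projective (k : fieldType) (B : bquiver) (M : rep k B)
    (S : presentation M) : Prop := MinimalProjective {
  mp_module1 : is_module (pres1 S);
  mp_module0 : is_module (pres0 S);
  mp_projective1 : projective (pres1 S);
  mp_projective0 : projective (pres0 S);
  mp_hom1 : pmap1 S \in HomA (pres1 S) (pres0 S);
  mp_hom0 : pmap0 S \in HomA (pres0 S) M;
  mp_epi0 : limg (pmap0 S) = fullv;
  mp_superfluous0 : superfluous (lker (pmap0 S));
  mp_epi1 : limg (pmap1 S) = lker (pmap0 S);
  mp_superfluous1 : superfluous (lker (pmap1 S)) }.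

Definition minimal_presentation (k : fieldType) (B : bquiver) (M : rep k B) :
    presentation M :=
  epsilon (inhabits (@Presentation k B M M M 0 0)) (@minimal_projective k B M).

(* $\tau M = D\operatorname{Tr} M$ with
   $\operatorname{Tr} M = \operatorname{coker}(p_1^t : P_0^t \to P_1^t)$, and the dual
   of the cokernel of $p_1^t$ is the kernel of $\nu(p_1) = D(p_1^t)$. *)
Definition tau (k : fieldType) (B : bquiver) (M : rep k B) : rep k B :=
  kernel_module (nakayama_map (pmap1 (minimal_presentation M))).

(* Main.v *)
From HB Require Import structures.
From Stdlib Require Import ClassicalEpsilon Classical.
Require Import Defs.
From mathcomp Require Import all_boot all_order all_algebra zify.
Set Implicit Arguments.
Unset Strict Implicit.
Unset Printing Implicit Defensive.
Import GRing.Theory.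
Local Open Scope ring_scope.

(** The theorem is true because the string module of [cohook Y] plays the role of the
    translate of [Y]. If [X] is a module over the fringed algebra that vanishes at the
    two end vertices of [W = cohook Y], then [Hom(X, tau Y)] and [Hom(X, M(W))] have the
    same dimension, and homomorphisms between string modules can be counted.

    For any presentation [P1 -> P0 -> Y] by projectives in which [P1] is a projective
    cover of the syzygy, [Hom(X, tau Y)] has the dimension of the space of functionals
    on [Hom(P1, X)] that vanish on the maps factoring through [P1 -> P0]. For a minimal
    presentation this is the duality between [Hom(P, X)] and [Hom(X, nu P)]
    ([dim_HomA_kernel]), and Schanuel's lemma allows the others; the dimension formula is
    [dim_HomA_tau].

    A string module [M(Y)] has such a presentation with one generator for each position
    [i] of [Y] and one relation for each pair of a position [i] and an arrow [c] starting
    at its vertex whose product with no letter arriving at [i] lies in the ideal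
    ([string_syzygy_minimal]). In a gentle algebra these arrows are precisely the letters
    leaving position [i] in the completed string [W] ([relator_letter]). So a functional
    as above is a family of functionals on [X] indexed by the letters of [W] that leave a
    position of [Y], subject to one condition for each such position: the values coming
    from its two sides agree. These are the coordinates of a homomorphism from [X] to
    [M(W)]. On the two tails of [W], whose arrows lead back to [Y], the coordinates are
    determined by composition, and since [W] stops at its ends [X] has to vanish there
    ([dim_HomA_cohook]).

    For strings [X], the dimension of [Hom(M(X), M(W))] is the number of graph maps, pairs
    of a quotient factorization of [X] and a submodule factorization of [W] with the same
    middle term ([dim_HomA_graph_maps]). The positions [(i, j)] of the two strings are the
    matrix coefficients of a homomorphism, and coefficients are equal along simultaneous
    steps of the strings; a component of this graph that supports a nonzero homomorphism
    is a stretch of a diagonal, and the conditions at its ends are those in the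
    definition of quotient and submodule factorizations.

    Graph maps from [X] to [W] are the same as kisses from [cohook X] to [W]
    ([kiss_graph_maps]). A quotient factorization of [cohook X] with outer terms of
    positive length cuts inside [X], because the arrows next to [X] leave it and those of
    the tails lead back; and [W] is not cut at its ends, which are fringe vertices. That
    they are is the maximality of the tails of the completion ([cohook_spec]).

    Finally the dimension formula for [Hom(X, tau Y)] compares the fringed algebra with
    the original one: the relations added by the new arrows end at fringe vertices, where
    [X] vanishes ([dim_HomA_tau_hat]). *)

(** * Linear algebra *)

Section LinearAlgebra.
Variable k : fieldType.

Lemma dim_le_inj (U V : vectType k) (A : {vspace U}) (C : {vspace V}) (f : U -> V) :
  linear f -> (forall u, u \in A -> f u \in C) ->
  (forall u, u \in A -> f u = 0 -> u = 0) -> (\dim A <= \dim C)%N.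
Proof.
move=> lin_f fAC inj_f; have <- : \dim (linfun f @: A)%VS = \dim A.
  apply: limg_dim_eq; apply/eqP; rewrite -subv0; apply/subvP => u.
  rewrite memv_cap memv_ker memv0 linfunE // => /andP[Au /eqP fu0].
  by apply/eqP/inj_f.
by apply/dimvS/subvP => _ /memv_imgP[u Au ->]; rewrite linfunE ?fAC.
Qed.

Lemma dim_ffun (J : finType) : dim {ffun J -> k^o} = #|J|.
Proof. by rewrite /dim /= muln1. Qed.

Definition delta (J : finType) (j : J) : {ffun J -> k^o} := [ffun i => (i == j)%:R].

Lemma sum_deltal (J : finType) (j : J) (F : J -> k) : \sum_i delta j i * F i = F j.
Proof.
rewrite (bigD1 j) //= [X in _ + X]big1 => [|i ij].
  by rewrite addr0 ffunE eqxx mul1r.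
by rewrite ffunE (negPf ij) mul0r.
Qed.

Lemma ffun_delta (J : finType) (f : {ffun J -> k^o}) : f = \sum_j f j *: delta j.
Proof.
apply/ffunP => i; rewrite sum_ffunE (bigD1 i) //= big1 => [|j ji].
  by rewrite !ffunE eqxx /= addr0 [RHS]mulr1.
by rewrite !ffunE eq_sym (negPf ji) [LHS]mulr0.
Qed.

(** The kernel consists of the functionals vanishing on the image of [g], and
    restriction to this image is onto. *)
Lemma dim_lker_dual (U V : vectType k) (g : 'Hom(U, V)) :
  (\dim (lker (dual_map g)) + \dim (limg g) = dim V)%N.
Proof.
have linV (W : vectType k) (W' : vectType k) (h : 'Hom(W, W')) :
    linear (fun phi : 'Hom(W', k^o) => (phi \o h)%VF).
  by move=> c p q; rewrite comp_lfunDl comp_lfunZl.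
pose r := dual_map (linfun (@vsval _ _ (limg g))).
have rE phi w : r phi w = phi (vsval w).
    by rewrite (linfunE (linV _ _ _)) comp_lfunE lfunE.
have dE phi u : dual_map g phi u = phi (g u).
    by rewrite (linfunE (linV _ _ _)) comp_lfunE.
have -> : lker (dual_map g) = lker r.
  apply/vspaceP => phi; rewrite !memv_ker; apply/eqP/eqP => phi0.
    apply/lfunP => w; rewrite rE zero_lfunE.
    by have /memv_imgP[u _ ->] := subvsP w; rewrite -dE phi0 zero_lfunE.
  apply/lfunP => u; have gu : g u \in limg g by rewrite memv_img ?memvf.
  by rewrite dE -(vsprojK gu) -rE phi0 !zero_lfunE.
have full_r : limg r = fullv.
  apply/vspaceP => psi; rewrite memvf; apply/memv_imgP.
  exists (psi \o linfun (vsproj (limg g)))%VF; rewrite ?memvf //.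
  by apply/lfunP => w; rewrite rE comp_lfunE lfunE /= vsvalK.
have := limg_ker_dim r fullv; rewrite capfv full_r !dimvf.
have dimd (W : vectType k) : dim 'Hom(W, k^o) = dim W by exact: muln1.
by rewrite !dimd.
Qed.

End LinearAlgebra.

(** * Representations and projective presentations *)

Section Representations.
Variables (k : fieldType) (B : bquiver).
Implicit Types M N P X : rep k B.

Lemma homP M N (f : 'Hom(M, N)) :
  f \in HomA M N <->
  (forall x m, f (ract_v M x m) = ract_v N x (f m)) /\
  (forall a m, f (ract_a M a m) = ract_a N a (f m)).
Proof.
split=> [/mem_HomA[fv fa]|[fv fa]].
  by split=> i m; rewrite -comp_lfunE (fv, fa) comp_lfunE.
by apply/mem_HomA; split=> i; apply/lfunP => m; rewrite !comp_lfunE (fv, fa).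
Qed.

Lemma hom_v M N (f : 'Hom(M, N)) x m :
  f \in HomA M N -> f (ract_v M x m) = ract_v N x (f m).
Proof. by case/homP. Qed.

Lemma hom_a M N (f : 'Hom(M, N)) a m :
  f \in HomA M N -> f (ract_a M a m) = ract_a N a (f m).
Proof. by case/homP. Qed.

Lemma HomA_comp M N P (f : 'Hom(M, N)) (g : 'Hom(N, P)) :
  f \in HomA M N -> g \in HomA N P -> (g \o f)%VF \in HomA M P.
Proof.
move=> hf hg; apply/homP; split=> i m; rewrite !comp_lfunE.
  by rewrite (hom_v _ _ hf) (hom_v _ _ hg).
by rewrite (hom_a _ _ hf) (hom_a _ _ hg).
Qed.

Lemma HomA_id M : \1%VF \in HomA M M.
Proof. by apply/homP; split=> i m; rewrite !id_lfunE. Qed.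

Lemma limg_fullP (V W : vectType k) (f : 'Hom(V, W)) :
  limg f = fullv <-> (forall w, exists v, w = f v).
Proof.
split=> [full w | surj].
  have : w \in limg f by rewrite full memvf.
  by case/memv_imgP => v _ ->; exists v.
apply/vspaceP => w; rewrite memvf; apply/memv_imgP.
by have [v ->] := surj w; exists v; rewrite ?memvf.
Qed.

(** ** Module axioms on elements *)

Lemma moduleP M :
  (forall m, \sum_x ract_v M x m = m) ->
  (forall x y m, ract_v M x (ract_v M y m) = if x == y then ract_v M x m else 0) ->
  (forall a m, ract_v M (tgt a) (ract_a M a (ract_v M (src a) m)) = ract_a M a m) ->
  (forall a b m, zrel b a -> ract_a M b (ract_a M a m) = 0) -> is_module M.
Proof.
move=> h1 he ha hz; split.
- by apply/lfunP => m; rewrite sum_lfunE h1 id_lfunE.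
- move=> x y; apply/lfunP => m; rewrite comp_lfunE he.
  by case: ifP => // _; rewrite zero_lfunE.
- by move=> a; apply/lfunP => m; rewrite !comp_lfunE ha.
- by move=> a b /hz hab; apply/lfunP => m; rewrite comp_lfunE hab zero_lfunE.
Qed.

Section ModuleElements.
Variable M : rep k B.
Hypothesis modM : is_module M.

Lemma mod_sum m : \sum_x ract_v M x m = m.
Proof. by rewrite -sum_lfunE (module_1 modM) id_lfunE. Qed.

Lemma mod_e x y m : ract_v M x (ract_v M y m) = if x == y then ract_v M x m else 0.
Proof.
rewrite -comp_lfunE (module_e modM); case: ifP => // _.
by rewrite zero_lfunE.
Qed.

Lemma mod_act a m : ract_v M (tgt a) (ract_a M a (ract_v M (src a) m)) = ract_a M a m.
Proof. by rewrite -!comp_lfunE (module_a modM). Qed.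

Lemma mod_tgt x a m :
  ract_v M x (ract_a M a m) = if x == tgt a then ract_a M a m else 0.
Proof. by rewrite -(mod_act a) mod_e; case: eqP => // ->. Qed.

Lemma mod_src x a m :
  ract_a M a (ract_v M x m) = if x == src a then ract_a M a m else 0.
Proof.
rewrite -(mod_act a) mod_e -(mod_act a m) eq_sym.
by case: eqP => // _; rewrite !linear0.
Qed.

Lemma mod_z a b m : zrel b a -> ract_a M b (ract_a M a m) = 0.
Proof. by move=> zba; rewrite -comp_lfunE (module_z modM zba) zero_lfunE. Qed.

End ModuleElements.

(** ** Subrepresentations *)

(** Unfolds to [kernel_module f] when [U] is [lker f]. *)
Definition subrep M (U : {vspace M}) : rep k B :=
  @Rep k B (subvs_of U)
    (fun x => linfun (fun v : subvs_of U => vsproj U (ract_v M x (vsval v))))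
    (fun a => linfun (fun v : subvs_of U => vsproj U (ract_a M a (vsval v)))).

Lemma submoduleP M (U : {vspace M}) :
  submodule U <-> (forall x m, m \in U -> ract_v M x m \in U) /\
                  (forall a m, m \in U -> ract_a M a m \in U).
Proof.
split=> [[hv ha]|[hv ha]]; split=> [x|a].
- by move=> m Um; apply: (subvP (hv x)); apply: memv_img.
- by move=> m Um; apply: (subvP (ha a)); apply: memv_img.
- by apply/subvP => _ /memv_imgP[m Um ->]; apply: hv.
- by apply/subvP => _ /memv_imgP[m Um ->]; apply: ha.
Qed.

Section SubRep.
Variables (M : rep k B) (U : {vspace M}).
Hypothesis subU : submodule U.

Let linact (g : 'End(M)) : linear (fun v : subvs_of U => vsproj U (g (vsval v))).
Proof. by move=> c u v; rewrite !linearP. Qed.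

Lemma subrep_v x (u : subrep U) : vsval (ract_v (subrep U) x u) = ract_v M x (vsval u).
Proof.
rewrite (linfunE (linact _)) vsprojK //.
by have /submoduleP[hv _] := subU; apply/hv/subvsP.
Qed.

Lemma subrep_a a (u : subrep U) : vsval (ract_a (subrep U) a u) = ract_a M a (vsval u).
Proof.
rewrite (linfunE (linact _)) vsprojK //.
by have /submoduleP[_ ha] := subU; apply/ha/subvsP.
Qed.

Lemma subrep_module : is_module M -> is_module (subrep U).
Proof.
move=> modM; apply: moduleP => [m|x y m|a m|a b m zba]; apply: subvs_inj.
- rewrite linear_sum /= -[RHS](mod_sum modM).
  by apply: eq_bigr => x _; apply: subrep_v.
- rewrite !subrep_v (mod_e modM); case: ifP => // _; by rewrite subrep_v.
- by rewrite subrep_v !subrep_a subrep_v (mod_act modM).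
- by rewrite !subrep_a (mod_z modM).
Qed.

End SubRep.

Lemma submodule_ker M N (f : 'Hom(M, N)) : f \in HomA M N -> submodule (lker f).
Proof.
move=> hf; apply/submoduleP; split=> i m; rewrite !memv_ker => /eqP fm.
  by rewrite (hom_v _ _ hf) fm linear0.
by rewrite (hom_a _ _ hf) fm linear0.
Qed.

Lemma submodule_img M N (f : 'Hom(M, N)) (L : {vspace M}) :
  f \in HomA M N -> submodule L -> submodule (f @: L)%VS.
Proof.
move=> hf /submoduleP[hv ha]; apply/submoduleP.
split=> i _ /memv_imgP[m Lm ->].
  by rewrite -(hom_v _ _ hf) memv_img ?hv.
by rewrite -(hom_a _ _ hf) memv_img ?ha.
Qed.

Lemma submodule_full M : submodule (fullv : {vspace M}).
Proof. by split=> i; apply: subvf. Qed.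

(** ** Projective covers *)

(** A map into a module lifts along any map with larger image: corestrict both
    to the image. *)
Lemma projective_lift P M N (q : 'Hom(P, N)) (g : 'Hom(M, N)) :
  projective P -> is_module M -> is_module N ->
  q \in HomA P N -> g \in HomA M N -> (limg q <= limg g)%VS ->
  exists2 h : 'Hom(P, M), h \in HomA P M & (g \o h)%VF = q.
Proof.
move=> projP modM modN hq hg sub_qg.
have subU := submodule_img hg (submodule_full M).
pose N' := subrep (limg g); have modN' : is_module N' by apply: subrep_module.
pose co (V : rep k B) (f : 'Hom(V, N)) : 'Hom(V, N') :=
  linfun (fun v => vsproj (limg g) (f v)).
have coE (V : rep k B) (f : 'Hom(V, N)) v :
    (limg f <= limg g)%VS -> vsval (co V f v) = f v.
  move=> sub_f; rewrite linfunE; last by move=> c u w; rewrite !linearP.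
  by rewrite vsprojK // (subvP sub_f) // memv_img ?memvf.
have co_hom (V : rep k B) (f : 'Hom(V, N)) :
    (limg f <= limg g)%VS -> f \in HomA V N -> co V f \in HomA V N'.
  move=> sub_f hf; apply/homP; split=> i m; apply: subvs_inj.
    by rewrite subrep_v // !coE // (hom_v _ _ hf).
  by rewrite subrep_a // !coE // (hom_a _ _ hf).
have full_g : limg (co M g) = fullv.
  apply/limg_fullP => w; have /memv_imgP[m _ def_w] := subvsP w.
  by exists m; apply: subvs_inj; rewrite coE.
have [h hh eq_h] := projP M N' (co M g) (co P q) modM modN'
  (co_hom _ _ (subvv _) hg) full_g (co_hom _ _ sub_qg hq).
exists h => //; apply/lfunP => v; rewrite comp_lfunE.
have := congr1 (fun f : 'Hom(P, N') => vsval (f v)) eq_h.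
by rewrite comp_lfunE !coE.
Qed.

(** Half of the uniqueness of projective covers: a lift [P -> P'] of two maps
    with the same image is onto when the kernel on [P'] is superfluous, and
    precomposing with it embeds [Hom(P', X)] into [Hom(P, X)]. *)
Lemma cover_dim_le P P' N X (q : 'Hom(P, N)) (q' : 'Hom(P', N)) :
  projective P -> is_module P' -> is_module N ->
  q \in HomA P N -> q' \in HomA P' N -> limg q = limg q' ->
  superfluous (lker q') -> (\dim (HomA P' X) <= \dim (HomA P X))%N.
Proof.
move=> projP modP' modN hq hq' eq_img sup.
have [|h hh eq_h] := projective_lift projP modP' modN hq hq'.
  by rewrite eq_img subvv.
have full_h : limg h = fullv.
  apply: sup; first exact: submodule_img hh (submodule_full P).
  apply/vspaceP => y; rewrite memvf; apply/memv_addP.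
  have /memv_imgP[x _ qx] : q' y \in limg q by rewrite eq_img memv_img ?memvf.
  exists (y - h x); last by exists (h x); rewrite ?subrK // memv_img ?memvf.
  by rewrite memv_ker linearB /= qx -eq_h comp_lfunE subrr.
apply: (@dim_le_inj _ _ _ _ _ (fun f => (f \o h)%VF)) => [c u v|f hf|f _ fh0].
- by rewrite comp_lfunDl comp_lfunZl.
- exact: HomA_comp hh hf.
apply/lfunP => y; have /limg_fullP/(_ y)[x ->] := full_h.
by rewrite -comp_lfunE fh0 !zero_lfunE.
Qed.

(** ** Direct sums *)

Definition sumrep M N : rep k B :=
  @Rep k B (M * N)%type
    (fun x => linfun (fun p : M * N => (ract_v M x p.1, ract_v N x p.2)))
    (fun a => linfun (fun p : M * N => (ract_a M a p.1, ract_a N a p.2))).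

Section DirectSum.
Variables M N : rep k B.

Let linact (f : 'End(M)) (g : 'End(N)) : linear (fun p : M * N => (f p.1, g p.2)).
Proof. by move=> c u v; rewrite /= !linearP. Qed.

Lemma sumrep_v x p : ract_v (sumrep M N) x p = (ract_v M x p.1, ract_v N x p.2).
Proof. exact: (linfunE (linact _ _)). Qed.

Lemma sumrep_a a p : ract_a (sumrep M N) a p = (ract_a M a p.1, ract_a N a p.2).
Proof. exact: (linfunE (linact _ _)). Qed.

Lemma sumrep_module : is_module M -> is_module N -> is_module (sumrep M N).
Proof.
move=> modM modN; apply: moduleP => [[m n]|x y [m n]|a [m n]|a b [m n] zba].
- under eq_bigr => x _ do rewrite sumrep_v /=.
  rewrite -[in RHS](mod_sum modM m) -[in RHS](mod_sum modN n).
  apply: (big_ind3 (fun (p : M * N) u v => p = (u, v))) => // p u v p' u' v' -> ->.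
  by [].
- rewrite !sumrep_v /= (mod_e modM) (mod_e modN).
  by case: ifP.
- by rewrite sumrep_v !sumrep_a !sumrep_v /= (mod_act modM) (mod_act modN).
- by rewrite !sumrep_a /= (mod_z modM) // (mod_z modN).
Qed.

Definition sum_inl : 'Hom(M, sumrep M N) := linfun (fun m => (m, 0) : M * N).
Definition sum_inr : 'Hom(N, sumrep M N) := linfun (fun n => (0, n) : M * N).
Definition sum_case X (f : 'Hom(M, X)) (g : 'Hom(N, X)) : 'Hom(sumrep M N, X) :=
  linfun (fun p : M * N => f p.1 + g p.2).

Lemma sum_addE (p q : sumrep M N) : p + q = (p.1 + q.1, p.2 + q.2).
Proof. by []. Qed.

Lemma sum_inlE m : sum_inl m = (m, 0).
Proof. by rewrite linfunE // => c u v; apply: congr2; rewrite /= ?scaler0 ?addr0. Qed.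

Lemma sum_inrE n : sum_inr n = (0, n).
Proof. by rewrite linfunE // => c u v; apply: congr2; rewrite /= ?scaler0 ?addr0. Qed.

Lemma sum_caseE X (f : 'Hom(M, X)) (g : 'Hom(N, X)) p : sum_case f g p = f p.1 + g p.2.
Proof. by rewrite linfunE // => c u v; rewrite /= !linearP scalerDr addrACA. Qed.

Lemma sum_inl_hom : sum_inl \in HomA M (sumrep M N).
Proof.
by apply/homP; split=> i m; rewrite !sum_inlE (sumrep_v, sumrep_a) /= linear0.
Qed.

Lemma sum_inr_hom : sum_inr \in HomA N (sumrep M N).
Proof.
by apply/homP; split=> i m; rewrite !sum_inrE (sumrep_v, sumrep_a) /= linear0.
Qed.

Lemma sum_case_hom X (f : 'Hom(M, X)) (g : 'Hom(N, X)) :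
  f \in HomA M X -> g \in HomA N X -> sum_case f g \in HomA (sumrep M N) X.
Proof.
move=> hf hg; apply/homP; split=> i p; rewrite !sum_caseE linearD /=.
  by rewrite sumrep_v -(hom_v _ _ hf) -(hom_v _ _ hg).
by rewrite sumrep_a -(hom_a _ _ hf) -(hom_a _ _ hg).
Qed.

Lemma sum_projective : projective M -> projective N -> projective (sumrep M N).
Proof.
move=> projM projN L K g f modL modK hg full_g hf.
have [h1 hh1 e1] := projM L K g (f \o sum_inl)%VF modL modK hg full_g
  (HomA_comp sum_inl_hom hf).
have [h2 hh2 e2] := projN L K g (f \o sum_inr)%VF modL modK hg full_g
  (HomA_comp sum_inr_hom hf).
exists (sum_case h1 h2); first exact: sum_case_hom.
apply/lfunP => p; rewrite comp_lfunE sum_caseE linearD /= -!comp_lfunE e1 e2.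
rewrite !comp_lfunE -linearD sum_inlE sum_inrE /=; congr (f _).
by case: p => m n; rewrite sum_addE /= addr0 add0r.
Qed.

Lemma dim_HomA_sum X :
  \dim (HomA (sumrep M N) X) = (\dim (HomA M X) + \dim (HomA N X))%N.
Proof.
pose T := (subvs_of (HomA M X) * subvs_of (HomA N X))%type.
have dimT : \dim {:T} = (\dim (HomA M X) + \dim (HomA N X))%N by rewrite dimvf.
rewrite -dimT; apply/eqP; rewrite eqn_leq; apply/andP; split.
  pose F (f : 'Hom(sumrep M N, X)) : T :=
    (vsproj (HomA M X) (f \o sum_inl)%VF, vsproj (HomA N X) (f \o sum_inr)%VF).
  apply: (@dim_le_inj _ _ _ _ _ F) => [c u v|f _|f hf]; rewrite ?memvf //.
    by rewrite /F !comp_lfunDl -!comp_lfunZl !linearP.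
  move=> F0.
  have f1 : (f \o sum_inl)%VF = 0.
    have := congr1 (fun t : T => vsval t.1) F0.
    by rewrite /= vsprojK ?(HomA_comp sum_inl_hom).
  have f2 : (f \o sum_inr)%VF = 0.
    have := congr1 (fun t : T => vsval t.2) F0.
    by rewrite /= vsprojK ?(HomA_comp sum_inr_hom).
  apply/lfunP => p; have -> : p = sum_inl p.1 + sum_inr p.2.
    by rewrite sum_inlE sum_inrE; case: p => m n; rewrite sum_addE /= addr0 add0r.
  by rewrite linearD /= -!comp_lfunE f1 f2 !zero_lfunE addr0.
pose G (t : T) := sum_case (vsval t.1) (vsval t.2).
apply: (@dim_le_inj _ _ _ _ _ G) => [c u v|t _|t _ t0].
- apply/lfunP => p; rewrite add_lfunE scale_lfunE !sum_caseE /=.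
  by rewrite !add_lfunE !scale_lfunE scalerDr addrACA.
- by apply: sum_case_hom; apply: subvsP.
case: t t0 => t1 t2 /= t0; congr (_, _); apply: subvs_inj; apply/lfunP => m.
  have := congr1 (fun h : 'Hom(_, _) => h (sum_inl m)) t0.
  by rewrite sum_caseE sum_inlE /= linear0 addr0 !zero_lfunE.
have := congr1 (fun h : 'Hom(_, _) => h (sum_inr m)) t0.
by rewrite sum_caseE sum_inrE /= linear0 add0r !zero_lfunE.
Qed.

End DirectSum.

(** ** Comparison of presentations *)

(** A presentation by projectives in which only the second map is required to be
    minimal: it is a minimal presentation up to a common projective summand of
    both terms. *)
Record syzygy_minimal (Y : rep k B) (S : presentation Y) : Prop := SyzygyMinimal {
  sm_module1 : is_module (pres1 S);
  sm_module0 : is_module (pres0 S);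
  sm_projective1 : projective (pres1 S);
  sm_projective0 : projective (pres0 S);
  sm_hom1 : pmap1 S \in HomA (pres1 S) (pres0 S);
  sm_hom0 : pmap0 S \in HomA (pres0 S) Y;
  sm_epi0 : limg (pmap0 S) = fullv;
  sm_epi1 : limg (pmap1 S) = lker (pmap0 S);
  sm_superfluous1 : superfluous (lker (pmap1 S)) }.

Lemma minimal_syzygy Y (S : presentation Y) : minimal_projective S -> syzygy_minimal S.
Proof. by case=> *; split. Qed.

Lemma schanuel_le Y (S S' : presentation Y) X :
  is_module Y -> syzygy_minimal S -> syzygy_minimal S' ->
  (\dim (HomA (pres1 S') X) + \dim (HomA (pres0 S) X) <=
   \dim (HomA (pres1 S) X) + \dim (HomA (pres0 S') X))%N.
Proof.
case: S S' => [P1 P0 p1 p0] [P1' P0' p1' p0'] modY.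
case=> /= mod1 mod0 proj1 proj0 h1 h0 epi0 epi1 _.
case=> /= mod1' mod0' proj1' proj0' h1' h0' epi0' epi1' sup'.
have [|s hs ps] := projective_lift proj0' mod0 modY h0' h0.
  by rewrite epi0 subvf.
have [|s' hs' ps'] := projective_lift proj0 mod0' modY h0 h0'.
  by rewrite epi0' subvf.
pose N := sumrep P0 P0'; have modN : is_module N by apply: sumrep_module.
have psE b : p0 (s b) = p0' b by rewrite -ps comp_lfunE.
have psE' a : p0' (s' a) = p0 a by rewrite -ps' comp_lfunE.
have p01 x : p0 (p1 x) = 0.
  by apply/eqP; rewrite -memv_ker -epi1 memv_img ?memvf.
have p01' x : p0' (p1' x) = 0.
  by apply/eqP; rewrite -memv_ker -epi1' memv_img ?memvf.
(* Both [P1 + P0'] and [P1' + P0] map onto the pullback of [p0] and [p0']. *)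
pose q : 'Hom(sumrep P1 P0', N) :=
  sum_case (sum_inl P0 P0' \o p1)%VF ((sum_inl P0 P0' \o s)%VF + sum_inr P0 P0').
pose q' : 'Hom(sumrep P1' P0, N) :=
  sum_case (sum_inr P0 P0' \o p1')%VF (sum_inl P0 P0' + (sum_inr P0 P0' \o s')%VF).
have qE x b : q (x, b) = (p1 x + s b, b).
  rewrite sum_caseE /= add_lfunE !comp_lfunE !sum_inlE sum_inrE.
  by rewrite !sum_addE /= !addr0 !add0r.
have qE' x a : q' (x, a) = (a, p1' x + s' a).
  rewrite sum_caseE /= add_lfunE !comp_lfunE !sum_inlE !sum_inrE.
  by rewrite !sum_addE /= !addr0 !add0r.
have hq : q \in HomA _ N.
  apply: sum_case_hom; first exact: HomA_comp h1 (sum_inl_hom _ _).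
  by apply: rpredD; [exact: HomA_comp hs (sum_inl_hom _ _) | exact: sum_inr_hom].
have hq' : q' \in HomA _ N.
  apply: sum_case_hom; first exact: HomA_comp h1' (sum_inr_hom _ _).
  by apply: rpredD; [exact: sum_inl_hom | exact: HomA_comp hs' (sum_inr_hom _ _)].
have eq_img : limg q = limg q'.
  apply/vspaceP => w; apply/memv_imgP/memv_imgP => -[[x b] _ ->].
    have /memv_imgP[x' _ def_x'] : b - s' (p1 x + s b) \in limg p1'.
      by rewrite epi1' memv_ker linearB /= psE' linearD /= p01 add0r psE subrr.
    by exists (x', p1 x + s b); rewrite ?memvf // qE qE' -def_x' subrK.
  have /memv_imgP[x' _ def_x'] : b - s (p1' x + s' b) \in limg p1.
    by rewrite epi1 memv_ker linearB /= psE linearD /= p01' add0r psE' subrr.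
  by exists (x', p1' x + s' b); rewrite ?memvf // qE qE' -def_x' subrK.
rewrite -!dim_HomA_sum; apply: (cover_dim_le _ _ _ modN hq hq' eq_img).
- exact: sum_projective.
- exact: sumrep_module.
move=> L subL full_L.
(* The kernel of [q'] is [lker p1' + 0], so that [L] contains the first summand. *)
have kerq' x a : ((x, a) \in lker q') = (a == 0) && (p1' x == 0).
  rewrite memv_ker qE' /=; apply/eqP/andP => [[-> e]|[/eqP-> /eqP->]].
    by move: e; rewrite linear0 addr0 => ->.
  by rewrite linear0 addr0.
have hi := sum_inl_hom P1' P0.
pose L1 := (sum_inl P1' P0 @^-1: L)%VS.
have L1E x : (x \in L1) = ((x, 0) \in L) by rewrite -memv_preim sum_inlE.
have full1 : L1 = fullv.
  apply: sup'.
    case/submoduleP: subL => hv ha; apply/submoduleP.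
    split=> i m; rewrite !L1E => Lm.
      by have := hv i _ Lm; rewrite sumrep_v /= linear0.
    by have := ha i _ Lm; rewrite sumrep_a /= linear0.
  apply/vspaceP => x; rewrite memvf; apply/memv_addP.
  have : ((x, 0) : sumrep P1' P0) \in (lker q' + L)%VS by rewrite full_L memvf.
  case/memv_addP => -[y a]; rewrite kerq' => /andP[/eqP-> y0] [[z c] Lz].
  rewrite sum_addE /= add0r => -[-> c0].
  exists y; rewrite ?memv_ker //; exists z => //.
  by rewrite L1E; rewrite -c0 in Lz.
apply/vspaceP => w; rewrite memvf.
have : w \in (lker q' + L)%VS by rewrite full_L memvf.
case/memv_addP => -[y a]; rewrite kerq' => /andP[/eqP-> _] [z Lz ->].
by rewrite memvD // -L1E full1 memvf.
Qed.

(** Schanuel's lemma, with the uniqueness of projective covers in place of an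
    isomorphism: only the dimensions of [Hom(-, X)] are compared. *)
Lemma schanuel Y (S S' : presentation Y) X :
  is_module Y -> syzygy_minimal S -> syzygy_minimal S' ->
  (\dim (HomA (pres1 S') X) + \dim (HomA (pres0 S) X) =
   \dim (HomA (pres1 S) X) + \dim (HomA (pres0 S') X))%N.
Proof.
move=> modY okS okS'; apply/eqP; rewrite eqn_leq schanuel_le //=.
exact: schanuel_le.
Qed.

End Representations.

(** * Modules with a basis of paths *)

Section NonzeroPaths.
Variable B : bquiver.

Lemma nzp1 (x : vtx B) a : is_nonzero_path (x, [:: a]) = (src a == x).
Proof. by rewrite /is_nonzero_path /= andbT. Qed.

Lemma nzp_rcons2 (x : vtx B) s a b :
  is_nonzero_path (x, rcons (rcons s a) b)
    = is_nonzero_path (x, rcons s a) && nonzero_step a b.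
Proof.
rewrite /is_nonzero_path /=; case: s => [|c s] /=; first by rewrite !andbT.
by rewrite !rcons_path last_rcons !andbA.
Qed.

Lemma nzp_rcons (x : vtx B) s a : is_nonzero_path (x, rcons s a) -> is_nonzero_path (x, s).
Proof.
case: (lastP s) => [|s' b]; first by rewrite /is_nonzero_path.
by rewrite nzp_rcons2 => /andP[].
Qed.

Lemma nzp_last (x : vtx B) s a :
  is_nonzero_path (x, rcons s a) -> last x (map (@tgt B) s) = src a.
Proof.
case: (lastP s) => [|s' b]; first by rewrite nzp1 => /eqP.
by rewrite nzp_rcons2 map_rcons last_rcons => /andP[_ /andP[/eqP-> _]].
Qed.

Lemma nzp_cons (x : vtx B) a s :
  is_nonzero_path (x, a :: s) -> src a = x /\ is_nonzero_path (tgt a, s).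
Proof.
rewrite /is_nonzero_path /= => /andP[/eqP-> ps]; split=> //.
by case: s ps => //= b s /andP[/andP[ab _] ->]; rewrite andbT.
Qed.

End NonzeroPaths.

Section PathAction.
Variables (k : fieldType) (B : bquiver).

Definition pact (M : rep k B) (s : seq (arr B)) (m : M) : M :=
  foldl (fun m a => ract_a M a m) m s.

Lemma pact_cat (M : rep k B) s t (m : M) : pact (s ++ t) m = pact t (pact s m).
Proof. exact: foldl_cat. Qed.

Lemma pact_rcons (M : rep k B) s a (m : M) : pact (rcons s a) m = ract_a M a (pact s m).
Proof. by rewrite -cats1 pact_cat. Qed.

Lemma pact_linear (M : rep k B) s : linear (@pact M s).
Proof. by elim: s => [|a s IH] c u v //=; rewrite linearP -IH. Qed.

Lemma pact0 (M : rep k B) s : @pact M s 0 = 0.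
Proof. by elim: s => //= a s; rewrite linear0. Qed.

Lemma pactD (M : rep k B) s : {morph @pact M s : u v / u + v}.
Proof. by move=> u v; have := pact_linear s 1 u v; rewrite !scale1r. Qed.

Lemma pactZ (M : rep k B) s c (m : M) : pact s (c *: m) = c *: pact s m.
Proof. by have := pact_linear s c m 0; rewrite !addr0 pact0 addr0. Qed.

Lemma pact_sum (M : rep k B) s (I : finType) (F : I -> M) :
  pact s (\sum_i F i) = \sum_i pact s (F i).
Proof. exact: (big_morph _ (@pactD M s) (@pact0 M s)). Qed.

Lemma hom_pact (M N : rep k B) (f : 'Hom(M, N)) s m :
  f \in HomA M N -> f (pact s m) = pact s (f m).
Proof.
move=> hf; elim/last_ind: s => // s a IH.
by rewrite !pact_rcons (hom_a _ _ hf) IH.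
Qed.

Lemma submodule_pact (M : rep k B) (L : {vspace M}) s m :
  submodule L -> m \in L -> pact s m \in L.
Proof.
case/submoduleP=> _ ha Lm; elim/last_ind: s => // s a IH.
by rewrite pact_rcons ha.
Qed.

Lemma pact_bad (M : rep k B) x s (m : M) :
  is_module M -> ract_v M x m = m -> ~~ is_nonzero_path (x, s) -> pact s m = 0.
Proof.
move=> modM mx; elim/last_ind: s => [|s a IH]; first by rewrite /is_nonzero_path.
rewrite pact_rcons; case: (lastP s) IH => [|s' b] IH.
  by rewrite nzp1 /= -{1}mx (mod_src modM) eq_sym; case: eqP.
rewrite nzp_rcons2 negb_and => /orP[/IH->|]; first by rewrite linear0.
rewrite pact_rcons negb_and negbK => /orP[|zab]; last by rewrite (mod_z modM).
rewrite /composable eq_sym => /negPf nab.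
by rewrite -(mod_act modM b) (mod_src modM) nab.
Qed.

End PathAction.

(** [J] enumerates the nonzero paths out of the vertices [g i]. The enumeration is
    abstract, because the regular module and the free modules below come with
    different ones. *)
Record path_basis (B : bquiver) (I J : finType) (g : I -> vtx B) (lab : J -> I)
    (ars : J -> seq (arr B)) : Prop := PathBasis {
  pb_inj : forall p q, lab p = lab q -> ars p = ars q -> p = q;
  pb_ok : forall p, is_nonzero_path (g (lab p), ars p);
  pb_ex : forall i s, is_nonzero_path (g i, s) -> exists p, lab p = i /\ ars p = s }.

(** The direct sum of the projectives [A e_(g i)]. The regular module is the case
    of the identity of the vertices, up to conversion. *)
Definition pathmod (k : fieldType) (B : bquiver) (I J : finType) (g : I -> vtx B)
    (lab : J -> I) (ars : J -> seq (arr B)) : rep k B :=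
  @Rep k B {ffun J -> k^o}
    (fun x => basis_map k (fun p q : J =>
        (q == p) && (last (g (lab p)) (map (@tgt B) (ars p)) == x)))
    (fun a => basis_map k (fun p q : J =>
        (lab q == lab p) && (ars q == rcons (ars p) a))).

Section PathModule.
Variables (k : fieldType) (B : bquiver) (I J : finType) (g : I -> vtx B).
Variables (lab : J -> I) (ars : J -> seq (arr B)).
Hypothesis basisJ : path_basis g lab ars.
Local Notation F := (pathmod k g lab ars).

(** The basis vector of a path. Since it is zero for lists of arrows that are not
    nonzero paths, arrows act by concatenation without side conditions. *)
Definition pv (i : I) (s : seq (arr B)) : F :=
  [ffun q => ((lab q == i) && (ars q == s))%:R] : {ffun J -> k^o}.

Lemma pv_delta q : pv (lab q) (ars q) = delta k q.
Proof.
apply/ffunP => p; rewrite !ffunE; congr (nat_of_bool _)%:R.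
by apply/andP/eqP => [[/eqP e1 /eqP e2]|->]; first exact: (pb_inj basisJ).
Qed.

Lemma pv_expand (f : F) : f = \sum_q (f : {ffun J -> k^o}) q *: pv (lab q) (ars q).
Proof.
rewrite [LHS](ffun_delta (f : {ffun J -> k^o})).
by apply: eq_bigr => q _; rewrite pv_delta.
Qed.

Lemma pv_lin_ext (V : vectType k) (f h : 'Hom(F, V)) :
  (forall q, f (pv (lab q) (ars q)) = h (pv (lab q) (ars q))) -> f = h.
Proof.
move=> eq_fh; apply/lfunP => u; rewrite [u]pv_expand !linear_sum /=.
by apply: eq_bigr => q _; rewrite !linearZ /= eq_fh.
Qed.

Lemma pv_bad i s : ~~ is_nonzero_path (g i, s) -> pv i s = 0.
Proof.
move=> bad; apply/ffunP => q; rewrite !ffunE; case: andP => // -[/eqP e1 /eqP e2].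
by rewrite -e1 -e2 (pb_ok basisJ) in bad.
Qed.

Lemma pv_v x i s :
  ract_v F x (pv i s) = if last (g i) (map (@tgt B) s) == x then pv i s else 0.
Proof.
apply/ffunP => q; rewrite basis_mapE.
rewrite (eq_bigl (fun p => (p == q) && (last (g (lab q)) (map (@tgt B) (ars q)) == x)));
  last first.
  by move=> p; rewrite eq_sym; case: eqP => //= ->.
case: (boolP (last (g (lab q)) _ == x)) => endq.
  under eq_bigl => p do rewrite andbT; rewrite big_pred1_eq !ffunE.
  case: andP => [[/eqP<- /eqP<-]|nq]; first by rewrite endq ffunE !eqxx.
  case: ifP; rewrite !ffunE // => _.
  by case: andP nq.
rewrite big_pred0 => [|p]; last by rewrite andbF.
case: ifP; rewrite !ffunE // => endi.
by case: andP => // -[/eqP e1 /eqP e2]; rewrite e1 e2 endi in endq.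
Qed.

Lemma pv_v1 i : ract_v F (g i) (pv i [::]) = pv i [::].
Proof. by rewrite pv_v eqxx. Qed.

Lemma pv_a a i s : ract_a F a (pv i s) = pv i (rcons s a).
Proof.
apply/ffunP => q; rewrite basis_mapE !ffunE.
have zero p : (lab q == lab p) && (ars q == rcons (ars p) a) ->
    pv i s p = ((lab q == i) && (ars q == rcons s a))%:R :> k.
  case/andP => /eqP e1 /eqP e2; rewrite ffunE e1 e2.
  by rewrite eqseq_rcons eqxx andbT.
rewrite (eq_bigr _ zero).
have [/andP[/eqP e1 /eqP e2]|_] := boolP ((_ == i) && _); last by rewrite big1.
have := pb_ok basisJ q; rewrite e1 e2 => /nzp_rcons/(pb_ex basisJ)[p [lp ap]].
rewrite (big_pred1 p) // => p'; rewrite /= eqseq_rcons eqxx andbT.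
apply/andP/eqP => [[/eqP el /eqP ea]|->]; last by rewrite lp ap !eqxx.
by apply: (pb_inj basisJ); rewrite ?lp ?ap.
Qed.

Lemma pact_pv i s t : pact t (pv i s) = pv i (s ++ t).
Proof.
elim/last_ind: t => [|t a IH]; first by rewrite cats0.
by rewrite pact_rcons IH pv_a rcons_cat.
Qed.

Lemma pathmod_module : is_module F.
Proof.
split=> [|x y|a|a b zba]; apply: pv_lin_ext => q.
- rewrite sum_lfunE id_lfunE; under eq_bigr => x _ do rewrite pv_v.
  rewrite -big_mkcond; under eq_bigl => x do rewrite eq_sym.
  by rewrite big_pred1_eq.
- rewrite comp_lfunE pv_v; have [->|xy] := eqVneq x y; rewrite ?pv_v.
    by case: ifP => e; rewrite ?linear0 // pv_v e.
  rewrite zero_lfunE; case: eqP => e; rewrite ?linear0 // pv_v e.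
  by rewrite eq_sym (negPf xy).
- rewrite !comp_lfunE pv_v; case: eqP => e.
    by rewrite pv_a pv_v map_rcons last_rcons eqxx.
  by rewrite !linear0 pv_a pv_bad //; apply/negP => /nzp_last.
- rewrite comp_lfunE zero_lfunE !pv_a pv_bad // nzp_rcons2 /nonzero_step zba.
  by rewrite !andbF.
Qed.

Section HomFromPaths.
Variables (M : rep k B) (modM : is_module M).

Definition hom_free (m : I -> M) : 'Hom(F, M) :=
  linfun (fun f : {ffun J -> k^o} => \sum_q f q *: pact (ars q) (m (lab q))).

Lemma hom_free_sum m f : hom_free m f = \sum_q (f : {ffun J -> k^o}) q *: pact (ars q) (m (lab q)).
Proof.
rewrite linfunE // => c u v; rewrite scaler_sumr -big_split; apply: eq_bigr => q _.
by rewrite !ffunE scalerDl scalerA.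
Qed.

Variable m : I -> M.
Hypothesis m_at : forall i, ract_v M (g i) (m i) = m i.

Lemma hom_free_pv i s : hom_free m (pv i s) = pact s (m i).
Proof.
have [|bad] := boolP (is_nonzero_path (g i, s)); last first.
  by rewrite pv_bad // linear0 (pact_bad modM (m_at i)).
case/(pb_ex basisJ) => q [<- <-]; rewrite hom_free_sum pv_delta.
rewrite (bigD1 q) //= big1 ?addr0 => [|p pq]; first by rewrite ffunE eqxx scale1r.
by rewrite ffunE (negPf pq) scale0r.
Qed.

Lemma hom_free_hom : hom_free m \in HomA F M.
Proof.
apply/mem_HomA; split=> [x|a]; apply: pv_lin_ext => q; rewrite !comp_lfunE.
  rewrite pv_v; set s := ars q; set i := lab q.
  have -> : ract_v M x (hom_free m (pv i s)) =
      if last (g i) (map (@tgt B) s) == x then pact s (m i) else 0.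
    rewrite hom_free_pv; case: (lastP s) => [|s' a] /=.
      rewrite -{1}(m_at i) (mod_e modM) eq_sym.
      by case: eqP => // <-; rewrite m_at.
    by rewrite pact_rcons (mod_tgt modM) map_rcons last_rcons eq_sym.
  by case: ifP => _; rewrite ?linear0 // hom_free_pv.
by rewrite pv_a !hom_free_pv pact_rcons.
Qed.

End HomFromPaths.

Lemma hom_free_ext (M : rep k B) (f h : 'Hom(F, M)) :
  f \in HomA F M -> h \in HomA F M ->
  (forall i, f (pv i [::]) = h (pv i [::])) -> f = h.
Proof.
move=> hf hh eq_fh; apply: pv_lin_ext => q.
by rewrite -[ars q]cat0s -pact_pv (hom_pact _ _ hf) (hom_pact _ _ hh) eq_fh.
Qed.

Lemma hom_at (M : rep k B) (f : 'Hom(F, M)) i :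
  f \in HomA F M -> ract_v M (g i) (f (pv i [::])) = f (pv i [::]).
Proof. by move=> hf; rewrite -(hom_v _ _ hf) pv_v1. Qed.

Lemma pathmod_projective : projective F.
Proof.
move=> M N p f modM modN hp full_p hf.
have pre i : exists m : M, ract_v M (g i) m = m /\ p m = f (pv i [::]).
  have /limg_fullP/(_ (f (pv i [::])))[m def_m] := full_p.
  exists (ract_v M (g i) m); split; first by rewrite (mod_e modM) eqxx.
  by rewrite (hom_v _ _ hp) -def_m hom_at.
have /fin_all_exists[m /all_and2[m_at pm]] := pre.
exists (hom_free m); first exact: hom_free_hom.
apply: hom_free_ext => [||i] //; first exact: HomA_comp (hom_free_hom modM m_at) hp.
by rewrite comp_lfunE hom_free_pv //= pm.
Qed.

(** Nakayama's lemma for the radical, which is spanned by the paths of positive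
    length. *)
Lemma pathmod_superfluous (U : {vspace F}) : gentle B ->
  (forall f, f \in U -> forall q, ars q = [::] -> (f : {ffun J -> k^o}) q = 0) ->
  superfluous U.
Proof.
move=> gB radU L subL full_L.
suff pvL n i s : (#|arr B| < size s + n)%N -> pv i s \in L.
  apply/vspaceP => f; rewrite memvf [f]pv_expand memv_suml // => q _.
  by apply/memvZ/(pvL #|arr B|.+1); rewrite addnS ltnS leq_addl.
elim: n i s => [|n IH] i s; rewrite ?addn0 => long_s.
  rewrite pv_bad ?mem0v //; apply/negP => /(size_nonzero_path gB).
  by rewrite leqNgt long_s.
have : pv i [::] \in (U + L)%VS by rewrite full_L memvf.
case/memv_addP => u Uu [l Ll /(congr1 (@pact _ _ F s))].
rewrite pact_pv cat0s pactD => ->.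
apply: rpredD; last exact: submodule_pact.
have -> : @pact k B F s u = \sum_q @pact k B F s ((u : {ffun J -> k^o}) q *: pv (lab q) (ars q)).
  by rewrite -pact_sum; congr pact; apply: pv_expand.
apply: memv_suml => q _; rewrite pactZ.
have [q0|nq0] := eqVneq (ars q) [::]; first by rewrite (radU u Uu) // scale0r mem0v.
rewrite memvZ // pact_pv IH // size_cat; apply: leq_trans long_s _.
by rewrite addnS -addSn leq_add2r -add1n leq_add2r lt0n size_eq0.
Qed.

End PathModule.

(** * Existence of minimal projective presentations *)

Section FreeModules.
Variables (k : fieldType) (B : bquiver).
Hypothesis gB : gentle B.

Lemma npath_ex (x : vtx B) s :
  is_nonzero_path (x, s) -> exists p : npath B, pstart p = x /\ parrows p = s.
Proof.
move=> nz; have sz := size_nonzero_path gB nz.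
by exists (exist _ (x, Bseq sz) nz).
Qed.

Lemma npath_inj (p q : npath B) : pstart p = pstart q -> parrows p = parrows q -> p = q.
Proof.
case: p q => [[x s] p] [[y t] q] /= e1 e2; apply: val_inj => /=.
by congr (_, _) => //; apply: val_inj.
Qed.

Lemma regular_basis : path_basis id (@pstart B) (@parrows B).
Proof.
split=> [||x s]; [exact: npath_inj | by case=> [[x s] p] | exact: npath_ex].
Qed.

Section Basis.
Variables (I : finType) (g : I -> vtx B).

Definition free_basis : finType := {ip : I * npath B | pstart ip.2 == g ip.1}.
Definition free_lab (q : free_basis) : I := (val q).1.
Definition free_ars (q : free_basis) : seq (arr B) := parrows (val q).2.
Definition freemod : rep k B := pathmod k g free_lab free_ars.

Lemma free_path_basis : path_basis g free_lab free_ars.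
Proof.
split=> [[[i p] /= ip] [[j q] /= jq] | [[i [[x s] p]] /= ip] | i s].
- rewrite /free_lab /free_ars /= => eij epq; apply: val_inj => /=.
  by congr (_, _) => //; apply: npath_inj => //; rewrite (eqP ip) (eqP jq) eij.
- by rewrite /free_lab /free_ars /= -(eqP ip).
- case/npath_ex => p [/eqP px ps].
  by exists (exist (fun ip : I * npath B => pstart ip.2 == g ip.1) (i, p) px).
Qed.

Lemma freemod_module : is_module freemod.
Proof. exact: pathmod_module free_path_basis. Qed.

Lemma freemod_projective : projective freemod.
Proof. exact: pathmod_projective free_path_basis. Qed.

End Basis.

(** Stated as surjectivity of the induced map, which becomes the projective cover once
    the family is minimal. *)
Definition generating (M : rep k B) (I : finType) (g : I -> vtx B) (m : I -> M) : Prop :=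
  (forall i, ract_v M (g i) (m i) = m i) /\
  limg (hom_free g (@free_lab I g) (@free_ars I g) m) = fullv.

Lemma generating_exists (M : rep k B) : is_module M ->
  exists (I : finType) (g : I -> vtx B) (m : I -> M), generating g m.
Proof.
move=> modM; pose I : finType := ('I_(\dim (fullv : {vspace M})) * vtx B)%type.
pose m (ix : I) : M := ract_v M ix.2 (vbasis fullv)`_(ix.1).
exists I, snd, m; have m_at i : ract_v M i.2 (m i) = m i.
  by rewrite (mod_e modM) eqxx.
split=> //; apply/limg_fullP => w; have basisI := @free_path_basis I snd.
pose c := coord (vbasis (fullv : {vspace M})).
exists (\sum_(i : I) c i.1 w *: pv k snd (@free_lab I snd) (@free_ars I snd) i [::]).
rewrite linear_sum /= [LHS](coord_vbasis (memvf w)).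
rewrite (eq_bigr (fun i : I => c i.1 w *: m i)); last first.
  by move=> i _; rewrite linearZ /= hom_free_pv.
rewrite -(pair_bigA _ (fun i x => c i w *: m (i, x))) /=.
by apply: eq_bigr => i _; rewrite -scaler_sumr (mod_sum modM).
Qed.

(** A kernel that is not contained in the radical expresses one of the generators
    through the others and through its own images under paths of positive length;
    these act nilpotently, so that this generator can be removed. *)
Lemma remove_generator (M : rep k B) (I : finType) (g : I -> vtx B) (m : I -> M)
    (f : freemod g) q :
  is_module M -> generating g m ->
  hom_free g (@free_lab I g) (@free_ars I g) m f = 0 -> free_ars q = [::] ->
  (f : {ffun _ -> k^o}) q != 0 ->
  @generating M {j : I | j != free_lab q} (fun j => g (val j)) (fun j => m (val j)).
Proof.
move=> modM [m_at full_m] f0 q0 fq0; have basisI := free_path_basis g.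
set i0 := free_lab q; pose I' : finType := {j : I | j != i0}.
pose g' (j : I') := g (val j); pose m' (j : I') := m (val j).
have m'_at j : ract_v M (g' j) (m' j) = m' j by apply: m_at.
split=> //; set L := limg _.
have subL : submodule L.
  apply: submodule_img (submodule_full _).
  exact: (hom_free_hom (free_path_basis g') modM m'_at).
have L1 j s : j != i0 -> pact s (m j) \in L.
  move=> ji0; rewrite -[m j]/(m' (exist _ j ji0)).
  by rewrite -(hom_free_pv (free_path_basis g') modM m'_at) memv_img ?memvf.
have L2 n s : (#|arr B| < size s + n)%N -> pact s (m i0) \in L.
  elim: n s => [|n IH] s; rewrite ?addn0 => long_s.
    rewrite (pact_bad modM (m_at i0)) ?mem0v //.
    by apply/negP => /(size_nonzero_path gB); rewrite leqNgt long_s.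
  have fq p : pact s ((f : {ffun _ -> k^o}) p *: pact (free_ars p) (m (free_lab p)))
      = (f : {ffun _ -> k^o}) p *: pact (free_ars p ++ s) (m (free_lab p)).
    by rewrite pactZ pact_cat.
  have := congr1 (pact s) f0; rewrite hom_free_sum pact_sum pact0.
  rewrite (bigD1 q) //= fq q0 /= => /eqP; rewrite addr_eq0 => /eqP e.
  have -> : pact s (m i0) =
      ((f : {ffun _ -> k^o}) q)^-1 *: ((f : {ffun _ -> k^o}) q *: pact s (m i0)).
    by rewrite scalerA mulVf // scale1r.
  rewrite e memvZ // memvN memv_suml // => p pq; rewrite fq memvZ //.
  have [p0|] := eqVneq (free_lab p) i0; last exact: L1.
  rewrite p0 IH // size_cat; apply: leq_trans long_s _.
  rewrite addnS -addSn leq_add2r -add1n leq_add2r lt0n size_eq0.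
  by apply: contra pq => /eqP ap; apply/eqP/(pb_inj basisI); rewrite // q0.
apply/vspaceP => w; rewrite memvf.
have /limg_fullP/(_ w)[h ->] := full_m.
rewrite hom_free_sum memv_suml // => p _; rewrite memvZ //.
have [->|] := eqVneq (free_lab p) i0; last exact: L1.
by apply: (L2 #|arr B|.+1); rewrite addnS ltnS leq_addl.
Qed.

Lemma cover_exists (M : rep k B) : is_module M ->
  exists (P : rep k B) (p : 'Hom(P, M)),
    [/\ is_module P, projective P, p \in HomA P M, limg p = fullv & superfluous (lker p)].
Proof.
move=> modM; have [I [g [m gen]]] := generating_exists modM.
have [n leIn] := ubnP #|I|; elim: n => // n IH in I g m gen leIn *.
pose p := hom_free g (@free_lab I g) (@free_ars I g) m.
have basisI := free_path_basis g; have [m_at full_m] := gen.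
have [rad|nrad] := excluded_middle_informative (forall f : freemod g, f \in lker p ->
    forall q, free_ars q = [::] -> (f : {ffun _ -> k^o}) q = 0).
  exists (freemod g), p; split=> //.
  - exact: freemod_module.
  - exact: freemod_projective.
  - exact: hom_free_hom.
  exact: (pathmod_superfluous basisI gB).
have [f [fker [q [q0 fq]]]] : exists f : freemod g, p f = 0 /\
    exists q, free_ars q = [::] /\ (f : {ffun _ -> k^o}) q != 0.
  apply: NNPP => none; apply: nrad => f; rewrite memv_ker => /eqP f0 q q0.
  by apply/eqP/negPn/negP => fq; apply: none; exists f; split=> //; exists q.
apply: (IH _ _ _ (remove_generator modM gen fker q0 fq)).
rewrite -ltnS; apply: leq_trans leIn; rewrite card_sig (eq_card (B := predC1 (free_lab q))) //.
by rewrite cardC1 prednK //; apply/card_gt0P; exists (free_lab q).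
Qed.

Lemma minimal_presentation_exists (M : rep k B) : is_module M ->
  exists S : presentation M, minimal_projective S.
Proof.
move=> modM; have [P0 [p0 [mod0 proj0 h0 epi0 sup0]]] := cover_exists modM.
have subK := submodule_ker h0; pose K := subrep (lker p0).
have [P1 [p1 [mod1 proj1 h1 epi1 sup1]]] := cover_exists (subrep_module subK mod0).
pose j : 'Hom(K, P0) := linfun vsval.
have jE u : j u = vsval u by rewrite linfunE.
have hj : j \in HomA K P0.
  by apply/homP; split=> i u; rewrite !jE ?subrep_v ?subrep_a.
exists (Presentation (j \o p1)%VF p0); split=> //=.
- exact: HomA_comp h1 hj.
- apply/vspaceP => u; apply/memv_imgP/idP => [[v _ ->]|u0].
    by rewrite comp_lfunE jE subvsP.
  have /limg_fullP/(_ (vsproj (lker p0) u))[v def_v] := epi1.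
  by exists v; rewrite ?memvf // comp_lfunE -def_v jE vsprojK.
- have -> : lker (j \o p1)%VF = lker p1; last by [].
  apply/vspaceP => u; rewrite !memv_ker comp_lfunE jE.
  by rewrite -[RHS](inj_eq (@subvs_inj _ _ _)) linear0.
Qed.

Lemma minimal_presentationP (M : rep k B) :
  is_module M -> minimal_projective (minimal_presentation M).
Proof. by move/minimal_presentation_exists/epsilon_spec; apply. Qed.

End FreeModules.

(** [F] is free on generators [e i [::]] at the vertices [g i], and [coef i s] is the
    coordinate along [e i s]. Working from these properties keeps the coordinates
    of [freemod] out of later proofs. *)
Record free_on (k : fieldType) (B : bquiver) (I : finType) (g : I -> vtx B) (F : rep k B)
    (e : I -> seq (arr B) -> F) (coef : I -> seq (arr B) -> 'Hom(F, k^o)) : Prop := FreeOn {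
  fo_module : is_module F;
  fo_projective : projective F;
  fo_v : forall x i s,
    ract_v F x (e i s) = if last (g i) (map (@tgt B) s) == x then e i s else 0;
  fo_a : forall a i s, ract_a F a (e i s) = e i (rcons s a);
  fo_bad : forall i s, ~~ is_nonzero_path (g i, s) -> e i s = 0;
  fo_hom : forall (M : rep k B) (m : I -> M), is_module M ->
    (forall i, ract_v M (g i) (m i) = m i) ->
    exists2 f : 'Hom(F, M), f \in HomA F M & forall i s, f (e i s) = pact s (m i);
  fo_ext : forall (V : vectType k) (f h : 'Hom(F, V)),
    (forall i s, f (e i s) = h (e i s)) -> f = h;
  fo_coef : forall i s j t,
    coef i s (e j t) = [&& i == j, s == t & is_nonzero_path (g i, s)]%:R;
  fo_superfluous : forall U : {vspace F},
    (forall f, f \in U -> forall i, coef i [::] f = 0) -> superfluous U }.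

Section FreeOn.
Variables (k : fieldType) (B : bquiver).
Hypothesis gB : gentle B.
Variables (I : finType) (g : I -> vtx B).
Local Notation lab := (@free_lab B I g).
Local Notation ars := (@free_ars B I g).

Definition free_vec (i : I) (s : seq (arr B)) : freemod k g := pv k g lab ars i s.

Definition free_coef (i : I) (s : seq (arr B)) : 'Hom(freemod k g, k^o) :=
  linfun (fun f : {ffun free_basis g -> k^o} =>
            \sum_(q | (lab q == i) && (ars q == s)) f q : k^o).

Lemma free_coefE i s (f : {ffun free_basis g -> k^o}) :
  free_coef i s f = \sum_(q | (lab q == i) && (ars q == s)) f q.
Proof.
rewrite linfunE // => c u v; rewrite scaler_sumr -big_split.
by apply: eq_bigr => q _; rewrite !ffunE.
Qed.

Lemma free_coef_sum1 i s (f : {ffun free_basis g -> k^o}) q :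
  lab q = i -> ars q = s -> free_coef i s f = f q.
Proof.
move=> lq aq; rewrite free_coefE (big_pred1 q) // => p.
apply/andP/eqP => [[/eqP lp /eqP ap]|->]; last by rewrite lq aq !eqxx.
by apply: (pb_inj (free_path_basis gB g)); rewrite ?lp ?ap.
Qed.

Lemma freemod_free_on : free_on g free_vec free_coef.
Proof.
have basisI := free_path_basis gB g; split.
- exact: freemod_module.
- exact: freemod_projective.
- exact: (pv_v k g lab ars).
- exact: (pv_a k basisI).
- exact: (pv_bad k basisI).
- move=> M m modM m_at; exists (hom_free g lab ars m).
    exact: (hom_free_hom basisI modM m_at).
  exact: (hom_free_pv basisI modM m_at).
- by move=> V f h eq_fh; apply: (pv_lin_ext basisI) => q; apply: eq_fh.
- move=> i s j t; have [|bad] := boolP (is_nonzero_path (g i, s)).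
    case/(pb_ex basisI) => q [lq aq]; rewrite (free_coef_sum1 _ lq aq) ffunE lq aq.
    by rewrite !andbT.
  rewrite !andbF free_coefE big_pred0 // => q; apply: contraNF bad.
  by case/andP => /eqP <- /eqP <-; apply: (pb_ok basisI).
move=> U radU; apply: (pathmod_superfluous basisI gB) => f Uf q q0.
by rewrite -(free_coef_sum1 f (erefl (lab q)) q0) radU.
Qed.

End FreeOn.

(** * The Auslander-Reiten formula *)

Section Evaluation.
Variables (k : fieldType) (B : bquiver).
Hypothesis gB : gentle B.
Local Notation Reg := (regular k B).

Definition rv (y : vtx B) (s : seq (arr B)) : Reg :=
  pv k id (@pstart B) (@parrows B) y s.

Lemma rv_lin_ext (V : vectType k) (f h : 'Hom(Reg, V)) :
  (forall q : npath B, f (rv (pstart q) (parrows q)) = h (rv (pstart q) (parrows q))) ->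
  f = h.
Proof. exact: (pv_lin_ext (regular_basis gB)). Qed.

Lemma rv_bad y s : ~~ is_nonzero_path (y, s) -> rv y s = 0.
Proof. exact: (pv_bad k (regular_basis gB)). Qed.

Lemma rv_v x y s :
  ract_v Reg x (rv y s) = if last y (map (@tgt B) s) == x then rv y s else 0.
Proof. exact: (@pv_v k B _ _ id (@pstart B) (@parrows B)). Qed.

Lemma rv_a a y s : ract_a Reg a (rv y s) = rv y (rcons s a).
Proof. exact: (pv_a k (regular_basis gB)). Qed.

Lemma pact_rv y s t : pact t (rv y s) = rv y (s ++ t).
Proof. exact: (pact_pv k (regular_basis gB)). Qed.

Lemma rmul_vE y (q : npath B) :
  rmul_v k y (rv (pstart q) (parrows q))
    = if pstart q == y then rv (pstart q) (parrows q) else 0.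
Proof.
rewrite /rv (pv_delta k (regular_basis gB)); apply/ffunP => p.
rewrite basis_mapE (eq_bigl (fun p' => (p' == p) && (pstart p == y))); last first.
  by move=> p'; rewrite eq_sym; case: eqP => //= ->.
case: (boolP (pstart p == y)) => py.
  under eq_bigl => p' do rewrite andbT; rewrite big_pred1_eq.
  by case: ifP => // qy; rewrite !ffunE; case: eqP => // e; rewrite e qy in py.
rewrite big_pred0 => [|p']; last by rewrite andbF.
by case: ifP => qy; rewrite !ffunE //; case: eqP => // e; rewrite e qy in py.
Qed.

Lemma rmul_aE a (q : npath B) :
  rmul_a k a (rv (pstart q) (parrows q))
    = if pstart q == tgt a then rv (src a) (a :: parrows q) else 0.
Proof.
rewrite /rv (pv_delta k (regular_basis gB)); apply/ffunP => p; rewrite basis_mapE.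
have -> : \sum_(i | [&& pstart i == tgt a, pstart p == src a
                      & parrows p == a :: parrows i]) delta k q i
        = [&& pstart q == tgt a, pstart p == src a
                      & parrows p == a :: parrows q]%:R :> k.
  rewrite big_mkcond (bigD1 q) //= [X in _ + X]big1 => [|i iq].
    by rewrite addr0 ffunE eqxx; case: ifP.
  by rewrite ffunE (negPf iq) if_same.
by case: eqP => //= _; rewrite !ffunE.
Qed.

Lemma rmul_v_hom y : rmul_v k y \in HomA Reg Reg.
Proof.
apply/mem_HomA; split=> [x|a]; apply: rv_lin_ext => q; rewrite !comp_lfunE rmul_vE.
  rewrite rv_v /=.
  by case: ifP => e1; case: ifP => e2; rewrite ?linear0 ?rmul_vE ?e1 ?e2 //;
    rewrite rv_v /= e1.
have [|bad] := boolP (is_nonzero_path (pstart q, rcons (parrows q) a)).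
  case/(npath_ex gB) => q' [e1 e2].
  rewrite rv_a -e1 -e2 rmul_vE e1 e2.
  by case: ifP => _; rewrite ?linear0 ?rv_a.
case: ifP => _; rewrite ?linear0 !rv_a.
  by rewrite rv_bad ?linear0.
by rewrite rv_bad ?linear0.
Qed.

Lemma rmul_a_hom b : rmul_a k b \in HomA Reg Reg.
Proof.
apply/mem_HomA; split=> [x|a]; apply: rv_lin_ext => q; rewrite !comp_lfunE rmul_aE.
  rewrite rv_v /=; case: ifP => e1; case: ifP => e2.
  - rewrite rmul_aE e2 rv_v /=.
    by rewrite -(eqP e2) e1.
  - by rewrite rmul_aE e2 linear0.
  - rewrite linear0 rv_v /=.
    by rewrite -(eqP e2) e1.
  by rewrite !linear0.
have [|bad] := boolP (is_nonzero_path (pstart q, rcons (parrows q) a)).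
  case/(npath_ex gB) => q' [e1 e2].
  rewrite rv_a -e1 -e2 rmul_aE e1 e2.
  by case: ifP => _; rewrite ?linear0 ?rv_a.
rewrite rv_a rv_bad // linear0.
case: ifP => e; rewrite ?linear0 // rv_a.
rewrite rv_bad //; apply: contra bad => /= /nzp_cons[_].
by rewrite (eqP e).
Qed.

Variable X : rep k B.
Hypothesis modX : is_module X.

(** The map [r |-> r x] from the regular module. *)
Definition act (x : X) : 'Hom(Reg, X) :=
  hom_free id (@pstart B) (@parrows B) (fun y => ract_v X y x).

Lemma act_rv x y s : act x (rv y s) = pact s (ract_v X y x).
Proof.
apply: (hom_free_pv (regular_basis gB) modX) => z.
by rewrite (mod_e modX) eqxx.
Qed.

Lemma act_hom x : act x \in HomA Reg X.
Proof.
apply: (hom_free_hom (regular_basis gB) modX) => z.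
by rewrite (mod_e modX) eqxx.
Qed.

Lemma act_linear : linear act.
Proof.
move=> c u v; apply: rv_lin_ext => q; rewrite add_lfunE scale_lfunE !act_rv.
by rewrite linearP pact_linear.
Qed.

Lemma act_rmul_v x y : (act x \o rmul_v k y)%VF = act (ract_v X y x).
Proof.
apply: rv_lin_ext => q; rewrite comp_lfunE rmul_vE act_rv (mod_e modX).
by case: ifP => _; rewrite ?act_rv ?linear0 ?pact0.
Qed.

Lemma act_rmul_a x a : (act x \o rmul_a k a)%VF = act (ract_a X a x).
Proof.
apply: rv_lin_ext => q; rewrite comp_lfunE rmul_aE act_rv (mod_tgt modX).
case: ifP => _; last by rewrite linear0 pact0.
by rewrite act_rv /= (mod_src modX) eqxx.
Qed.

End Evaluation.

Section DualBasis.
Variables (k : fieldType) (B : bquiver).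
Hypothesis gB : gentle B.

(** The dual basis lemma: the [f i] are the coordinates of a splitting of a map from
    a free module onto [P]. *)
Lemma dual_basis (P : rep k B) : is_module P -> projective P ->
  exists (I : finType) (b : I -> P) (f : I -> 'Hom(P, regular k B)),
    (forall i, f i \in HomA P (regular k B)) /\
    (forall p, p = \sum_i act (b i) (f i p)).
Proof.
move=> modP projP; have [I [g [b [b_at full]]]] := generating_exists gB modP.
have basisI := free_path_basis gB g; have modF := freemod_module k gB g.
have hpi := hom_free_hom basisI modP b_at.
have [s hs es] := projP _ _ _ _ modF modP hpi full (HomA_id P).
have modR : is_module (regular k B) by apply: pathmod_module (regular_basis gB).
pose m i (j : I) : regular k B := if j == i then rv k (g i) [::] else 0.
have m_at i j : ract_v (regular k B) (g j) (m i j) = m i j.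
  rewrite /m; case: eqP => [->|_]; last by rewrite linear0.
  by rewrite rv_v eqxx.
pose c i := hom_free g (@free_lab B I g) (@free_ars B I g) (m i).
have hc i : c i \in HomA (freemod k g) (regular k B).
  exact: (hom_free_hom basisI modR (m_at i)).
exists I, b, (fun i => c i \o s)%VF; split=> [i|p]; first exact: HomA_comp hs (hc i).
have {1}-> : p = hom_free g (@free_lab B I g) (@free_ars B I g) b (s p).
  by rewrite -comp_lfunE es id_lfunE.
pose d := \sum_i (act (b i) \o c i)%VF.
have -> : hom_free g (@free_lab B I g) (@free_ars B I g) b = d.
  apply: (pv_lin_ext basisI) => q; rewrite sum_lfunE (bigD1 (free_lab q)) //=.
  rewrite (hom_free_pv basisI modP b_at) comp_lfunE (hom_free_pv basisI modR (m_at _)).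
  rewrite /m eqxx (pact_rv k gB) act_rv // b_at big1 ?addr0 //.
  move=> i iq; rewrite comp_lfunE (hom_free_pv basisI modR (m_at _)).
  by rewrite /m eq_sym (negPf iq) pact0 linear0.
by rewrite sum_lfunE; apply: eq_bigr => i _; rewrite !comp_lfunE.
Qed.

End DualBasis.

(** The evaluation map from the tensor product of [Hom(P, A)] and [M] to [Hom(P, M)]
    is onto; this is what inverts [curry] below. *)
Lemma hom_dual_basis (k : fieldType) (B : bquiver) (M P : rep k B) (I : finType)
    (b : I -> P) (f : I -> 'Hom(P, regular k B)) (u : 'Hom(P, M)) :
  gentle B -> is_module M -> is_module P ->
  (forall p, p = \sum_i act (b i) (f i p)) -> u \in HomA P M ->
  u = \sum_i (act (u (b i)) \o f i)%VF.
Proof.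
move=> gB modM modP bf hu; apply/lfunP => p; rewrite {1}[p]bf linear_sum sum_lfunE.
apply: eq_bigr => i _; rewrite [RHS]comp_lfunE -[LHS]comp_lfunE; congr (fun_of_lfun _ _).
apply: (rv_lin_ext gB) => q; rewrite comp_lfunE !act_rv //.
by rewrite (hom_pact _ _ hu) (hom_v _ _ hu).
Qed.

Section ARFormula.
Variables (k : fieldType) (B : bquiver).
Hypothesis gB : gentle B.
Variables (X Y : rep k B) (S : presentation Y).
Hypotheses (modX : is_module X) (okS : syzygy_minimal S).
Local Notation Reg := (regular k B).
Local Notation P1 := (pres1 S).
Local Notation P0 := (pres0 S).
Local Notation p1 := (pmap1 S).
Local Notation p0 := (pmap0 S).
Local Notation H1 := (HomA P1 X).
Local Notation H0 := (HomA P0 X).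
Local Notation nu := (nakayama_map p1).

Let h1 := sm_hom1 okS.
Let h0 := sm_hom0 okS.

Definition precomp : 'Hom(subvs_of H0, subvs_of H1) :=
  linfun (fun u : subvs_of H0 => vsproj H1 (vsval u \o p1)%VF).

Lemma precompE u : vsval (precomp u) = (vsval u \o p1)%VF.
Proof.
rewrite linfunE; last by move=> c v w; rewrite !linearP /= comp_lfunDl -comp_lfunZl linearP.
by rewrite vsprojK // (HomA_comp h1) // subvsP.
Qed.

Lemma transpose_mapE g : vsval (transpose_map p1 g) = (vsval g \o p1)%VF.
Proof.
rewrite linfunE; last by move=> c v w; rewrite !linearP /= comp_lfunDl -comp_lfunZl linearP.
by rewrite vsprojK // (HomA_comp h1) // subvsP.
Qed.

Lemma transpose_actE (P : rep k B) (r : 'End(Reg)) (f : transpose_space P) :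
  r \in HomA Reg Reg -> vsval (@transpose_act k B P r f) = (r \o vsval f)%VF.
Proof.
move=> hr; rewrite linfunE; last first.
  by move=> c v w; rewrite !linearP /= comp_lfunDr -comp_lfunZr linearP.
by rewrite vsprojK // (HomA_comp _ hr) // subvsP.
Qed.

Lemma dual_mapE (U V : vectType k) (g : 'Hom(U, V)) phi u : dual_map g phi u = phi (g u).
Proof.
rewrite linfunE ?comp_lfunE // => c v w.
by rewrite comp_lfunDl comp_lfunZl.
Qed.

Lemma nakayama_map_hom : nu \in HomA (nakayama P1) (nakayama P0).
Proof.
apply/homP; split=> i phi; apply/lfunP => f; rewrite !dual_mapE; congr (phi _);
  apply: subvs_inj; have hr := (rmul_v_hom k gB, rmul_a_hom k gB);
  by rewrite !(transpose_mapE, transpose_actE) ?hr // comp_lfunA.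
Qed.

Local Notation tauS := (kernel_module nu).

Let tau_v x (t : tauS) : vsval (ract_v tauS x t) = ract_v (nakayama P1) x (vsval t).
Proof. exact: (subrep_v (submodule_ker nakayama_map_hom)). Qed.

Let tau_a a (t : tauS) : vsval (ract_a tauS a t) = ract_a (nakayama P1) a (vsval t).
Proof. exact: (subrep_a (submodule_ker nakayama_map_hom)). Qed.

Let act_in (x : X) (f : transpose_space P1) : (act x \o vsval f)%VF \in H1.
Proof. by apply: HomA_comp (act_hom gB modX x); apply: subvsP. Qed.

(** The image of [x] under the map that corresponds to [theta] in the duality
    between [Hom(P1, X)] and [Hom(X, nu P1)]. *)
Definition curry0 (theta : 'Hom(subvs_of H1, k^o)) (x : X) : 'Hom(transpose_space P1, k^o) :=
  linfun (fun f : transpose_space P1 => theta (vsproj H1 (act x \o vsval f)%VF)).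

Lemma curry0E theta x f : curry0 theta x f = theta (vsproj H1 (act x \o vsval f)%VF).
Proof.
rewrite linfunE // => c u v.
by rewrite linearP /= comp_lfunDr -comp_lfunZr !linearP.
Qed.

Lemma curry0_linear theta : linear (curry0 theta).
Proof.
move=> c u v; apply/lfunP => f; rewrite add_lfunE scale_lfunE !curry0E.
by rewrite (act_linear gB modX) comp_lfunDl -comp_lfunZl !linearP.
Qed.

Definition curry (theta : 'Hom(subvs_of H1, k^o)) : 'Hom(X, tauS) :=
  linfun (fun x => vsproj (lker nu) (curry0 theta x)).

Lemma curryE theta x : theta \in lker (dual_map precomp) ->
  vsval (curry theta x) = curry0 theta x.
Proof.
rewrite memv_ker => /eqP theta0; rewrite linfunE; last first.
  by move=> c u v; rewrite curry0_linear linearP.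
rewrite vsprojK // memv_ker; apply/eqP/lfunP => g.
rewrite dual_mapE curry0E transpose_mapE zero_lfunE.
have hg : (act x \o vsval g)%VF \in H0.
  by apply: HomA_comp (act_hom gB modX x); apply: subvsP.
have := congr1 (fun h : 'Hom(_, _) => h (vsproj H0 (act x \o vsval g)%VF)) theta0.
rewrite dual_mapE zero_lfunE => e; rewrite -[RHS]e; congr (theta _).
by apply: subvs_inj; rewrite precompE !vsprojK ?comp_lfunA // (HomA_comp h1).
Qed.

Lemma curry_hom theta : theta \in lker (dual_map precomp) -> curry theta \in HomA X tauS.
Proof.
move=> theta0; apply/homP; split=> i x; apply: subvs_inj; apply/lfunP => f.
  rewrite tau_v !curryE // dual_mapE !curry0E; congr (theta (vsproj _ _)).
  by rewrite transpose_actE ?rmul_v_hom // comp_lfunA (act_rmul_v gB modX).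
rewrite tau_a !curryE // dual_mapE !curry0E; congr (theta (vsproj _ _)).
by rewrite transpose_actE ?rmul_a_hom // comp_lfunA (act_rmul_a gB modX).
Qed.

(** The inverse of [curry], by the dual basis lemma. *)
Definition uncurry (I : finType) (b : I -> P1) (f : I -> 'Hom(P1, Reg)) (h : 'Hom(X, tauS)) :
    'Hom(subvs_of H1, k^o) :=
  linfun (fun u : subvs_of H1 =>
    \sum_i vsval (h (vsval u (b i))) (vsproj (HomA P1 Reg) (f i)) : k^o).

Lemma uncurryE (I : finType) (b : I -> P1) (f : I -> 'Hom(P1, Reg)) h u :
  uncurry b f h u = \sum_i vsval (h (vsval u (b i))) (vsproj (HomA P1 Reg) (f i)).
Proof.
rewrite linfunE // => c v w; rewrite scaler_sumr -big_split; apply: eq_bigr => i _.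
by rewrite linearP /= add_lfunE scale_lfunE !linearP /= add_lfunE scale_lfunE.
Qed.

Section DualBases.
Variables (I : finType) (b : I -> P1) (f : I -> 'Hom(P1, Reg)).
Hypotheses (hf : forall i, f i \in HomA P1 Reg).
Hypothesis bf : forall p, p = \sum_i act (b i) (f i p).

(** Compatibility of [h] with multiplication by a ring element [r], which acts on
    the transpose of [P1] through the right multiplication [act r] of [A]. *)
Lemma uncurry_mul h x r (l : transpose_space P1) : h \in HomA X tauS ->
  vsval (h (act x r)) l = vsval (h x) (vsproj (HomA P1 Reg) (act r \o vsval l)%VF).
Proof.
move=> hh; have modR : is_module Reg by apply: pathmod_module (regular_basis gB).
have inT (l' : transpose_space P1) r' : (act r' \o vsval l')%VF \in HomA P1 Reg.
  by apply: HomA_comp (act_hom gB modR r'); apply: subvsP.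
pose F1 : 'Hom(Reg, k^o) := linfun (fun r => vsval (h (act x r)) l : k^o).
pose F2 : 'Hom(Reg, k^o) := linfun (fun r =>
  vsval (h x) (vsproj (HomA P1 Reg) (act r \o vsval l)%VF) : k^o).
have F1E r' : F1 r' = vsval (h (act x r')) l.
  by rewrite linfunE // => c u v; rewrite !linearP /= add_lfunE scale_lfunE.
have F2E r' : F2 r' = vsval (h x) (vsproj (HomA P1 Reg) (act r' \o vsval l)%VF).
  rewrite linfunE // => c u v.
  by rewrite (act_linear gB modR) comp_lfunDl -comp_lfunZl !linearP.
rewrite -F1E -F2E; congr (fun_of_lfun _ _); apply: (rv_lin_ext gB) => q.
rewrite F1E F2E {F1 F1E F2 F2E}; move: (pstart q) (parrows q) => y s.
elim/last_ind: s l => [|s a IH] l.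
  rewrite act_rv //= (hom_v _ _ hh) tau_v dual_mapE; congr (fun_of_lfun _ _).
  apply: subvs_inj; rewrite vsprojK ?inT // transpose_actE ?rmul_v_hom //.
  congr (_ \o _)%VF; apply: (rv_lin_ext gB) => q'.
  rewrite rmul_vE // act_rv // rv_v /= eq_sym.
  by case: eqP => [->|_]; rewrite ?pact0 // (pact_rv k gB).
rewrite -(rv_a k gB) (hom_a _ _ (act_hom gB modX x)) (hom_a _ _ hh) tau_a dual_mapE.
rewrite IH; congr (fun_of_lfun _ _); apply: subvs_inj.
rewrite !vsprojK ?inT // transpose_actE ?rmul_a_hom // comp_lfunA.
by rewrite (act_rmul_a gB modR).
Qed.

Lemma uncurry_act h x (g : transpose_space P1) : h \in HomA X tauS ->
  uncurry b f h (vsproj H1 (act x \o vsval g)%VF) = vsval (h x) g.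
Proof.
move=> hh; have modR : is_module Reg by apply: pathmod_module (regular_basis gB).
rewrite uncurryE vsprojK ?act_in //.
under eq_bigr => i _ do rewrite comp_lfunE uncurry_mul // vsprojK //.
rewrite -!linear_sum /=; congr (fun_of_lfun _ _); apply: subvs_inj.
by rewrite -(hom_dual_basis gB modR (sm_module1 okS) bf (subvsP g)) vsvalK.
Qed.

(** Dual bases of [P0] as well are needed to test the vanishing on maps that factor
    through [p1]. *)
Lemma uncurry_ann (J : finType) (c : J -> P0) (g : J -> 'Hom(P0, Reg)) h :
  (forall j, g j \in HomA P0 Reg) -> (forall p, p = \sum_j act (c j) (g j p)) ->
  h \in HomA X tauS -> uncurry b f h \in lker (dual_map precomp).
Proof.
move=> hg cg hh; rewrite memv_ker; apply/eqP/lfunP => u; rewrite dual_mapE zero_lfunE.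
have hu := subvsP u; have gp j : (g j \o p1)%VF \in HomA P1 Reg by apply: HomA_comp (hg j).
have -> : precomp u
    = \sum_j vsproj H1 (act (vsval u (c j)) \o vsval (vsproj (HomA P1 Reg) (g j \o p1)%VF))%VF.
  rewrite -linear_sum /=; apply: subvs_inj.
  rewrite precompE {1}(hom_dual_basis gB modX (sm_module0 okS) cg hu) vsprojK.
    apply/lfunP => p; rewrite comp_lfunE !sum_lfunE; apply: eq_bigr => j _.
    by rewrite vsprojK // !comp_lfunE.
  by apply: memv_suml => j _; apply: act_in.
rewrite linear_sum big1 //= => j _; rewrite uncurry_act //.
have /eqP hu0 : nu (vsval (h (vsval u (c j)))) == 0 by rewrite -memv_ker subvsP.
have := congr1 (fun t : 'Hom(_, _) => t (vsproj (HomA P0 Reg) (g j))) hu0.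
rewrite dual_mapE zero_lfunE => e; rewrite -[RHS]e; congr (fun_of_lfun _ _).
by apply: subvs_inj; rewrite transpose_mapE !vsprojK.
Qed.

End DualBases.

(** [curry] and [uncurry] are mutually inverse between the functionals on
    [Hom(P1, X)] vanishing on the maps that factor through [p1] and the maps from [X]
    into the kernel of [nu p1]. *)
Lemma dim_HomA_kernel : \dim (HomA X tauS) = \dim (lker (dual_map precomp)).
Proof.
have [I [b [f [hf bf]]]] := dual_basis gB (sm_module1 okS) (sm_projective1 okS).
have [J [c [g [hg cg]]]] := dual_basis gB (sm_module0 okS) (sm_projective0 okS).
apply/eqP; rewrite eqn_leq; apply/andP; split.
  apply: (@dim_le_inj _ _ _ _ _ (uncurry b f)) => [d u v|h hh|h hh h0'].
  - apply/lfunP => w; rewrite add_lfunE scale_lfunE !uncurryE scaler_sumr -big_split.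
    apply: eq_bigr => i _.
    by rewrite add_lfunE scale_lfunE linearP /= add_lfunE scale_lfunE.
  - exact: (uncurry_ann hf bf hg cg hh).
  apply/lfunP => x; rewrite zero_lfunE; apply: subvs_inj; apply/lfunP => l.
  rewrite -(uncurry_act hf bf) // h0' zero_lfunE.
  have -> : vsval (0 : tauS) = 0 by exact: linear0.
  by rewrite zero_lfunE.
pose K := lker (dual_map precomp).
have curry_lin : linear curry.
  move=> d u v; apply/lfunP => x; rewrite add_lfunE scale_lfunE.
  have lin t : linear (fun x => vsproj (lker nu) (curry0 t x)).
    by move=> e y z; rewrite curry0_linear linearP.
  rewrite !(linfunE (lin _)) -linearP; congr (vsproj _ _); apply/lfunP => l.
  by rewrite add_lfunE scale_lfunE !curry0E add_lfunE scale_lfunE.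
apply: (@dim_le_inj _ _ _ _ _ _ curry_lin) => [t|t Kt t0]; first exact: curry_hom.
apply/lfunP => u; rewrite zero_lfunE.
have -> : u = \sum_i vsproj H1 (act (vsval u (b i)) \o vsval (vsproj (HomA P1 Reg) (f i)))%VF.
  rewrite -linear_sum /=; apply: subvs_inj; rewrite vsprojK.
    rewrite {1}(hom_dual_basis gB modX (sm_module1 okS) bf (subvsP u)).
    by apply: eq_bigr => i _; rewrite vsprojK.
  by apply: memv_suml => i _; apply: act_in.
rewrite linear_sum big1 //= => i _; rewrite -curry0E -curryE // t0 zero_lfunE.
have -> : vsval (0 : tauS) = 0 by exact: linear0.
exact: zero_lfunE.
Qed.

(** Left exactness of [Hom(-, X)]. *)
Lemma dim_lker_precomp : \dim (lker precomp) = \dim (HomA Y X).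
Proof.
have p0_surj := (iffLR (limg_fullP p0)) (sm_epi0 okS).
have p0V y : p0 ((p0^-1)%VF y) = y by rewrite limg_lfunVK // (sm_epi0 okS) memvf.
apply/eqP; rewrite eqn_leq; apply/andP; split.
  have fact (u : subvs_of H0) w : u \in lker precomp ->
      vsval u ((p0^-1)%VF (p0 w)) = vsval u w.
    rewrite memv_ker => /eqP u0.
    have /memv_imgP[v _ def_v] : (p0^-1)%VF (p0 w) - w \in limg p1.
      by rewrite (sm_epi1 okS) memv_ker linearB /= p0V subrr.
    apply/eqP; rewrite -subr_eq0 -linearB /= def_v.
    by rewrite -comp_lfunE -precompE u0 linear0 zero_lfunE.
  apply: (@dim_le_inj _ _ _ _ _ (fun u : subvs_of H0 => (vsval u \o p0^-1)%VF))
    => [d u v|u ku|u ku u0].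
  - by rewrite linearP /= comp_lfunDl comp_lfunZl.
  - apply/homP; split=> i y; have [w ->] := p0_surj y; rewrite !comp_lfunE.
      by rewrite -(hom_v _ _ h0) !fact // (hom_v _ _ (subvsP u)).
    by rewrite -(hom_a _ _ h0) !fact // (hom_a _ _ (subvsP u)).
  apply: subvs_inj; apply/lfunP => w; rewrite -fact // -comp_lfunE u0.
  by rewrite linear0 !zero_lfunE.
apply: (@dim_le_inj _ _ _ _ _ (fun v : 'Hom(Y, X) => vsproj H0 (v \o p0)%VF))
  => [d u v|v hv|v hv v0].
- by rewrite comp_lfunDl -comp_lfunZl linearP.
- rewrite memv_ker; apply/eqP/subvs_inj; rewrite precompE linear0.
  rewrite vsprojK ?(HomA_comp h0) //; apply/lfunP => w; rewrite !comp_lfunE zero_lfunE.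
  have /eqP -> : p0 (p1 w) == 0 by rewrite -memv_ker -(sm_epi1 okS) memv_img ?memvf.
  exact: linear0.
apply/lfunP => y; have [w ->] := p0_surj y; rewrite -comp_lfunE.
by rewrite -(vsprojK (HomA_comp h0 hv)) v0 linear0 !zero_lfunE.
Qed.

(** Apply [Hom(X, -)] to the exact sequence defining the translation, identify
    [Hom(X, nu P)] with the dual of [Hom(P, X)], and count dimensions. *)
Lemma AR_formula :
  (\dim (HomA X tauS) + \dim (HomA P0 X) = \dim (HomA P1 X) + \dim (HomA Y X))%N.
Proof.
rewrite dim_HomA_kernel -dim_lker_precomp.
have := dim_lker_dual precomp; have := limg_ker_dim precomp fullv.
rewrite capfv dimvf => e0 e1.
have {}e0 : (\dim (lker precomp) + \dim (limg precomp) = \dim H0)%N by [].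
have {}e1 : (\dim (lker (dual_map precomp)) + \dim (limg precomp) = \dim H1)%N by [].
by rewrite -e0 -e1 addnA addnAC.
Qed.

End ARFormula.

(** Adding a common projective summand to both terms of the minimal presentation
    changes both sides equally. So the formula may be read off a presentation that is
    convenient rather than minimal. *)
Theorem dim_HomA_tau (k : fieldType) (B : bquiver) (X Y : rep k B) (S : presentation Y) :
  gentle B -> is_module X -> is_module Y -> syzygy_minimal S ->
  (\dim (HomA X (tau Y)) + \dim (HomA (pres0 S) X)
   = \dim (HomA (pres1 S) X) + \dim (HomA Y X))%N.
Proof.
move=> gB modX modY okS.
have okM := minimal_syzygy (minimal_presentationP gB modY).
have e1 := AR_formula gB modX okM; have e2 := schanuel X modY okM okS.
rewrite -/(tau Y) in e1; move: e1 e2.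
move: (\dim (HomA X (tau Y))) (\dim (HomA Y X)) => t h.
move: (\dim (HomA (pres0 _) X)) (\dim (HomA (pres1 _) X)) => a b.
move: (\dim (HomA (pres0 _) X)) (\dim (HomA (pres1 _) X)) => c d.
lia.
Qed.

(** * Strings by their positions *)

(** This is the condition in the definition of the string module: [a] sends [z_i] to
    [z_j]. Positions are natural numbers, to be free of the type of indices. *)
Definition go (Q : quiver) (C : word Q) (a : arr Q) (i j : nat) : bool :=
     ((j == i.+1) && (onth C.2 i == Some (a, true)))
  || ((i == j.+1) && (onth C.2 j == Some (a, false))).

Section StringPositions.
Variables (B : bquiver) (C : word B).
Hypothesis strC : is_string C.

Lemma onth_size (T : Type) (s : seq T) i l : onth s i = Some l -> (i < size s)%N.
Proof. by move=> e; rewrite -onthTE e. Qed.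

Lemma string_stepP i l m :
  onth C.2 i = Some l -> onth C.2 i.+1 = Some m -> string_step l m.
Proof.
case/andP: strC => _ sC hl hm; have lt_m := onth_size hm.
move/(sortedP l): sC => /(_ i lt_m).
by rewrite (onth_nth _ _ _ _ hl) (onth_nth _ _ _ _ hm).
Qed.

Lemma wvtxS i l : onth C.2 i = Some l -> wvtx C i.+1 = ltgt l.
Proof.
move=> hl; rewrite /wvtx (take_nth l) ?(onth_size hl) // map_rcons last_rcons.
by rewrite (onth_nth _ _ _ _ hl).
Qed.

Lemma wvtx_letter i l : onth C.2 i = Some l -> wvtx C i = lsrc l.
Proof.
case: i => [|i] hl.
  by case/andP: strC; rewrite /wvtx take0; case: C.2 hl => //= m s [->] /eqP.
have [m hm] : exists m, onth C.2 i = Some m.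
  have := onthTE C.2 i; rewrite (ltnW (onth_size hl)).
  by case: (onth _ i) => // m _; exists m.
by rewrite (wvtxS hm); case/and3P: (string_stepP hm hl) => /eqP.
Qed.

Variant go_spec a i j : Prop :=
  | GoUp of j = i.+1 & onth C.2 i = Some (a, true)
  | GoDown of i = j.+1 & onth C.2 j = Some (a, false).

Lemma goP a i j : reflect (go_spec a i j) (go C a i j).
Proof.
apply: (iffP orP) => [[]/andP[/eqP e1 /eqP e2]|[e1 e2|e1 e2]].
- exact: GoUp.
- exact: GoDown.
- by left; rewrite e1 e2 !eqxx.
by right; rewrite e1 e2 !eqxx.
Qed.

Lemma go_le a i j : go C a i j -> (i <= wlen C)%N /\ (j <= wlen C)%N.
Proof. by case/goP => -> h; have := onth_size h; rewrite /wlen; lia. Qed.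

Lemma go_adj a i j : go C a i j -> j = i.+1 \/ i = j.+1.
Proof. by case/goP => ->; [left | right]. Qed.

Lemma go_vtx a i j : go C a i j -> wvtx C i = src a /\ wvtx C j = tgt a.
Proof. by case/goP => -> h; rewrite (wvtxS h) (wvtx_letter h). Qed.

Lemma go_fun a i j j' : go C a i j -> go C a i j' -> j = j'.
Proof.
move=> /goP[->|e] h /goP[->|e'] h' //; try lia.
  by subst i; case/and3P: (string_stepP h' h) => _ /eqP.
by subst i; case/and3P: (string_stepP h h') => _ /eqP.
Qed.

Lemma go_inj a i i' j : go C a i j -> go C a i' j -> i = i'.
Proof.
move=> /goP[e|->] h /goP[e'|->] h' //; try lia.
  by subst j; case/and3P: (string_stepP h h') => _ /eqP.
by subst j; case/and3P: (string_stepP h' h) => _ /eqP.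
Qed.

Lemma go_arr a b i j : go C a i j -> go C b i j -> a = b.
Proof.
case/goP => [->|->] h /goP[e|e] h'; try lia.
  by move: h'; rewrite h => -[].
by move: h'; rewrite h => -[].
Qed.

Lemma go_anti a b i j : go C a i j -> ~~ go C b j i.
Proof.
case/goP => [->|->] h; apply/negP => /goP[e|e] h'; try lia.
  by move: h'; rewrite h.
by move: h'; rewrite h.
Qed.

Lemma go_nz a b i j l : go C b i j -> go C a j l -> ~~ zrel a b.
Proof.
move=> /goP[e0|e0] h /goP[e|e] h'.
- by rewrite e0 in h'; case/and3P: (string_stepP h h').
- have li : l = i by lia.
  by move: h'; rewrite li h.
- by move: h'; rewrite h.
by rewrite e in h; case/and3P: (string_stepP h' h).
Qed.

End StringPositions.

(** ** String modules *)

Section StringModule.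
Variable k : fieldType.

Lemma ffun_lin_ext (J : finType) (V : vectType k) (f h : 'Hom({ffun J -> k^o}, V)) :
  (forall j, f (delta k j) = h (delta k j)) -> f = h.
Proof.
move=> eq_fh; apply/lfunP => u; rewrite [u]ffun_delta !linear_sum /=.
by apply: eq_bigr => j _; rewrite !linearZ /= eq_fh.
Qed.

Lemma basis_map_delta (I J : finType) (c : I -> J -> bool) i :
  basis_map k c (delta k i) = \sum_(j | c i j) delta k j.
Proof.
apply/ffunP => j; rewrite basis_mapE sum_ffunE.
have -> : \sum_(i' | c i' j) delta k i i' = (c i j)%:R.
  rewrite big_mkcond (bigD1 i) //= [X in _ + X]big1 ?ffunE ?eqxx ?addr0.
    by case: ifP.
  by move=> i' ii'; case: ifP => // _; rewrite ffunE (negPf ii').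
rewrite big_mkcond (bigD1 j) //= [X in _ = _ + X]big1 ?ffunE ?eqxx ?addr0.
  by case: ifP => // _; rewrite ffunE eqxx.
by move=> j' jj'; case: ifP => // _; rewrite ffunE eq_sym (negPf jj').
Qed.

Variables (B : bquiver) (C : word B).
Local Notation M := (string_module k C).
Local Notation z i := (delta k (i : 'I_(wlen C).+1) : M).

Lemma string_v x i : ract_v M x (z i) = if wvtx C i == x then z i else 0.
Proof.
rewrite [LHS]basis_map_delta /=; case: ifP => e.
  by under eq_bigl => j do rewrite andbT; rewrite big_pred1_eq.
by rewrite big_pred0 // => j; rewrite andbF.
Qed.

Lemma string_a a i : ract_a M a (z i) = \sum_(j : 'I_(wlen C).+1 | go C a i j) z j.
Proof. exact: basis_map_delta. Qed.

Lemma string_module_module : is_string C -> is_module M.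
Proof.
move=> strC; split=> [|x y|a|a b zba]; apply: ffun_lin_ext => i.
- rewrite sum_lfunE id_lfunE; under eq_bigr => x _ do rewrite string_v.
  rewrite -big_mkcond; under eq_bigl => x do rewrite eq_sym.
  by rewrite big_pred1_eq.
- rewrite comp_lfunE string_v; have [->|xy] := eqVneq x y.
    by rewrite string_v; case: ifP => e; rewrite ?linear0 // string_v e.
  rewrite zero_lfunE; case: eqP => e; rewrite ?linear0 // string_v e.
  by rewrite eq_sym (negPf xy).
- rewrite !comp_lfunE string_v; case: eqP => e; rewrite string_a.
    rewrite linear_sum; apply: eq_bigr => j gj.
    by rewrite [LHS]string_v (go_vtx strC gj).2 eqxx.
  by rewrite !linear0 big_pred0 // => j; apply/negP => /(go_vtx strC)[].
rewrite comp_lfunE zero_lfunE string_a linear_sum big1 // => j gj.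
rewrite [LHS]string_a big_pred0 // => l; apply/negP => gl.
by have := go_nz strC gj gl; rewrite zba.
Qed.

End StringModule.

(** * The projective presentation of a string module *)

Lemma big_sig (R : Type) (idx : R) (op : Monoid.com_law idx) (I : finType) (P : pred I)
    (F : I -> R) :
  \big[op/idx]_(x : {x : I | P x}) F (val x) = \big[op/idx]_(i | P i) F i.
Proof.
symmetry; rewrite (reindex_omap (val : {x : I | P x} -> I) insub); last first.
  by move=> i Pi; rewrite insubT.
by apply: eq_bigl => -[i Pi] /=; rewrite insubT Pi /= eqxx.
Qed.

Section HomFreeString.
Variables (k : fieldType) (B : bquiver) (X : word B).
Hypotheses (gB : gentle B) (strX : is_string X).
Local Notation M := (string_module k X).
Local Notation J := 'I_(wlen X).+1.

Lemma string_vE x (w : M) (j : J) :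
  (ract_v M x w : {ffun J -> k^o}) j = if wvtx X j == x then (w : {ffun J -> k^o}) j else 0.
Proof.
rewrite basis_mapE (eq_bigl (fun i => (i == j) && (wvtx X j == x))); last first.
  by move=> i; rewrite eq_sym; case: eqP => //= ->.
case: ifP => e; last by rewrite big_pred0 // => i; rewrite andbF.
by under eq_bigl => i do rewrite andbT; rewrite big_pred1_eq.
Qed.

(** A map out of a free module is a free choice of images of the generators. *)
Lemma dim_HomA_free (I : finType) (g : I -> vtx B) :
  \dim (HomA (freemod k g) M) = (\sum_i #|[set j : J | wvtx X j == g i]|)%N.
Proof.
pose T : finType := {ij : I * J | wvtx X ij.2 == g ij.1}.
have -> : (\sum_i #|[set j : J | wvtx X j == g i]|)%N = #|T|.
  rewrite card_sig -sum1_card (eq_bigr (fun i => \sum_(j : J | wvtx X j == g i) 1)%N).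
    by rewrite pair_big_dep /=; apply: eq_bigl => -[i j].
  by move=> i _; rewrite -sum1_card; apply: eq_bigl => j; rewrite inE.
have basisI := free_path_basis gB g; have modM := string_module_module k strX.
pose e i : freemod k g := pv k g (@free_lab B I g) (@free_ars B I g) i [::].
rewrite -(dim_ffun k T) -dimvf; apply/eqP; rewrite eqn_leq; apply/andP; split.
  pose F (f : 'Hom(freemod k g, M)) : {ffun T -> k^o} :=
    [ffun t => (f (e (val t).1) : {ffun J -> k^o}) (val t).2].
  apply: (@dim_le_inj _ _ _ _ _ F) => [c u v|f _|f hf f0]; rewrite ?memvf //.
    by apply/ffunP => t; rewrite !ffunE add_lfunE scale_lfunE !ffunE.
  apply: (hom_free_ext basisI) => // [|i]; first exact: mem0v.
  rewrite zero_lfunE -(hom_at i hf); apply/ffunP => j; rewrite string_vE ffunE.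
  case: ifP => // ij; have := congr1 (fun h : {ffun T -> k^o} => h (exist _ (i, j) ij)) f0.
  by rewrite !ffunE.
pose m (u : {ffun T -> k^o}) i : M :=
  [ffun j => if insub (i, j) is Some t then u t else 0] : {ffun J -> k^o}.
have m_at u i : ract_v M (g i) (m u i) = m u i.
  apply/ffunP => j; rewrite string_vE ffunE; case: ifP => // ij.
  by rewrite insubF.
have m_lin i c u v : m (c *: u + v) i = c *: m u i + m v i.
  apply/ffunP => j; rewrite !ffunE; case: insub => [t|]; first by rewrite !ffunE.
  by rewrite scaler0 addr0.
apply: (@dim_le_inj _ _ _ _ _ (fun u => hom_free g (@free_lab B I g) (@free_ars B I g) (m u)))
  => [c u v|u _|u _ u0].
- apply: (pv_lin_ext basisI) => q; rewrite add_lfunE scale_lfunE.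
  by rewrite !(hom_free_pv basisI modM) // m_lin pact_linear.
- exact: hom_free_hom.
apply/ffunP => -[[i j] ij]; have := congr1 (fun h : 'Hom(_, M) => (h (e i) : {ffun J -> k^o}) j) u0.
by rewrite zero_lfunE (hom_free_pv basisI modM (m_at u)) !ffunE insubT.
Qed.

End HomFreeString.

Section FreeOnMaps.
Variables (k : fieldType) (B : bquiver) (I : finType) (g : I -> vtx B) (F : rep k B).
Variables (e : I -> seq (arr B) -> F) (coef : I -> seq (arr B) -> 'Hom(F, k^o)).
Hypothesis freeF : free_on g e coef.

Lemma pact_free i s t : pact t (e i s) = e i (s ++ t).
Proof.
elim/last_ind: t => [|t a IH]; first by rewrite cats0.
by rewrite pact_rcons IH (fo_a freeF) rcons_cat.
Qed.

Lemma free_hom_ext (M : rep k B) (f h : 'Hom(F, M)) :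
  f \in HomA F M -> h \in HomA F M -> (forall i, f (e i [::]) = h (e i [::])) -> f = h.
Proof.
move=> hf hh eq_fh; apply: (fo_ext freeF) => i s.
by rewrite -[s]cat0s -pact_free (hom_pact _ _ hf) (hom_pact _ _ hh) eq_fh.
Qed.

End FreeOnMaps.

Section StringPresentation.
Variables (B : bquiver) (Y : word B).
Hypotheses (gB : gentle B) (strY : is_string Y).
Local Notation n1 := (wlen Y).+1.

(** The relations [c e_i = e_j] (or [0]) that are not forced by a relation of the
    algebra at a letter arriving at the position [i]. *)
Definition relator (i : nat) (c : arr B) : bool :=
  (src c == wvtx Y i) && [forall b, forall i' : 'I_n1, go Y b i' i ==> ~~ zrel c b].

Lemma relatorP (i : nat) c :
  reflect (src c = wvtx Y i /\ forall b i', go Y b i' i -> ~~ zrel c b) (relator i c).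
Proof.
apply: (iffP andP) => [[/eqP e /forallP h]|[e h]].
  split=> // b i' g'; have lt_i' : (i' < n1)%N by have [] := go_le strY g'.
  by have /forallP/(_ (Ordinal lt_i'))/implyP := h b; apply.
split; first exact/eqP.
by apply/forallP => b; apply/forallP => i'; apply/implyP => /h.
Qed.

Lemma go_relator b i j : go Y b i j -> relator i b.
Proof.
move=> gij; apply/relatorP; split=> [|b' i' g']; first by rewrite (go_vtx strY gij).1.
exact: (go_nz strY g' gij).
Qed.

Definition relators : finType := {ic : 'I_n1 * arr B | relator ic.1 ic.2}.

Variable k : fieldType.
Local Notation M := (string_module k Y).
Local Notation z i := (delta k (i : 'I_n1) : M).

Definition gen_vtx (i : 'I_n1) : vtx B := wvtx Y i.
Definition rel_vtx (ic : relators) : vtx B := tgt (val ic).2.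

Variables (F0 F1 : rep k B).
Variables (e0 : 'I_n1 -> seq (arr B) -> F0) (coef0 : 'I_n1 -> seq (arr B) -> 'Hom(F0, k^o)).
Variables (e1 : relators -> seq (arr B) -> F1) (coef1 : relators -> seq (arr B) -> 'Hom(F1, k^o)).
Hypotheses (free0 : free_on gen_vtx e0 coef0) (free1 : free_on rel_vtx e1 coef1).

Definition relation (ic : relators) : F0 :=
  e0 (val ic).1 [:: (val ic).2] - \sum_(j : 'I_n1 | go Y (val ic).2 (val ic).1 j) e0 j [::].

Lemma relation_at ic : ract_v F0 (rel_vtx ic) (relation ic) = relation ic.
Proof.
rewrite /relation linearB /= (fo_v free0) /= eqxx; congr (_ - _).
rewrite linear_sum; apply: eq_bigr => j gj.
by rewrite [LHS](fo_v free0) /= /gen_vtx (go_vtx strY gj).2 eqxx.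
Qed.

Variables (p0 : 'Hom(F0, M)) (p1 : 'Hom(F1, F0)).
Hypotheses (hp0 : p0 \in HomA F0 M) (p0_e0 : forall i s, p0 (e0 i s) = pact s (z i)).
Hypotheses (hp1 : p1 \in HomA F1 F0) (p1_relation : forall ic s, p1 (e1 ic s) = pact s (relation ic)).

Lemma p1_e1 ic s :
  p1 (e1 ic s) = e0 (val ic).1 ((val ic).2 :: s)
    - \sum_(j : 'I_n1 | go Y (val ic).2 (val ic).1 j) e0 j s.
Proof.
rewrite p1_relation /relation -scaleN1r pactD pactZ (pact_free free0) scaleN1r.
rewrite (big_morph _ (@pactD k B F0 s) (@pact0 k B F0 s)).
by congr (_ - _); apply: eq_bigr => j _; rewrite (pact_free free0).
Qed.

Lemma p0_p1 u : p0 (p1 u) = 0.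
Proof.
rewrite -comp_lfunE; suff -> : (p0 \o p1)%VF = 0 by rewrite zero_lfunE.
apply: (fo_ext free1) => ic s; rewrite comp_lfunE zero_lfunE p1_e1 linearB linear_sum /=.
rewrite p0_e0 /= string_a.
rewrite (big_morph _ (@pactD k B M s) (@pact0 k B M s)).
by apply/eqP; rewrite subr_eq0; apply/eqP; apply: eq_bigr => j _; rewrite p0_e0.
Qed.

Lemma limg_p0 : limg p0 = fullv.
Proof.
apply/limg_fullP => w; exists (\sum_i (w : {ffun 'I_n1 -> k^o}) i *: e0 i [::]).
rewrite [LHS](ffun_delta (w : {ffun 'I_n1 -> k^o})) linear_sum.
by apply: eq_bigr => i _; rewrite linearZ /= p0_e0.
Qed.

Definition section0 : 'Hom(M, F0) :=
  linfun (fun w : {ffun 'I_n1 -> k^o} => \sum_j w j *: e0 j [::]).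

Lemma section0_z i : section0 (z i) = e0 i [::].
Proof.
rewrite linfunE; last first.
  move=> c u v; rewrite scaler_sumr -big_split; apply: eq_bigr => j _ /=.
  by rewrite !ffunE scalerDl scalerA.
rewrite (bigD1 i) //= big1 => [|j ji]; first by rewrite addr0 ffunE eqxx scale1r.
by rewrite ffunE (negPf ji) scale0r.
Qed.

(** Modulo the image of [p1], every path in [F0] is a sum of the generators
    [e0 i [::]]: a leading arrow [a] is either moved along the string or completed
    on the left to a product in the ideal. *)
Lemma e0_mod_p1 i s : e0 i s - section0 (p0 (e0 i s)) \in limg p1.
Proof.
have im u : p1 u \in limg p1 by rewrite memv_img ?memvf.
elim: s i => [|a s IH] i; first by rewrite p0_e0 section0_z subrr mem0v.
have [srca|nsrc] := eqVneq (src a) (wvtx Y i); last first.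
  rewrite (fo_bad free0); last by apply: contra nsrc => /nzp_cons[->].
  by rewrite !linear0 addr0 mem0v.
have [rel_ia|] := boolP (relator i a).
  pose ic : relators := exist (fun ic : 'I_n1 * arr B => relator ic.1 ic.2) (i, a) rel_ia.
  have -> : e0 i (a :: s) = p1 (e1 ic s) + \sum_(j : 'I_n1 | go Y a i j) e0 j s.
    by rewrite p1_e1 subrK.
  rewrite [p0 (_ + _)]linearD /= p0_p1 add0r !linear_sum -addrA rpredD //.
  by rewrite -big_split; apply: memv_suml => j _; apply: IH.
rewrite /relator srca eqxx /= => /forallPn[b /forallPn[i']].
rewrite negb_imply negbK => /andP[gi' zab].
pose ic : relators :=
  exist (fun ic : 'I_n1 * arr B => relator ic.1 ic.2) (i', b) (go_relator gi').
have -> : e0 i (a :: s) = p1 (- e1 ic (a :: s)).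
  rewrite linearN /= p1_e1 /= opprB [e0 _ [:: b, a & s]](fo_bad free0).
    rewrite subr0 (big_pred1 i) // => j; apply/idP/eqP => [gj|-> //].
    by apply/val_inj/(go_fun strY gj gi').
  by apply/negP; rewrite /is_nonzero_path /= /nonzero_step zab !andbF.
by rewrite p0_p1 linear0 subr0.
Qed.

Lemma limg_p1 : limg p1 = lker p0.
Proof.
apply/vspaceP => f; apply/idP/idP => [/memv_imgP[u _ ->]|].
  by rewrite memv_ker p0_p1.
rewrite memv_ker => /eqP f0; rewrite -[f]subr0 -(linear0 section0) -f0.
pose pr : 'End(F0) := projv (limg p1).
suff e : (\1 - (section0 \o p0) = pr \o (\1 - (section0 \o p0)))%VF.
  have := congr1 (fun h : 'End(F0) => h f) e.
  by rewrite /= comp_lfunE add_lfunE opp_lfunE id_lfunE comp_lfunE => ->; apply: memv_proj.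
apply: (fo_ext free0) => i s; rewrite comp_lfunE add_lfunE opp_lfunE id_lfunE comp_lfunE.
by rewrite [RHS]projv_id // e0_mod_p1.
Qed.

(** The coordinate of [p1 f] at the path [c :: s] from the position [i] relates the
    coordinate of [f] at [s] for the relator [(i, c)] to those at longer paths, for
    the relators arriving at [i]; it vanishes for all paths that are long enough. *)
Lemma lker_p1_rad (f : F1) ic : f \in lker p1 -> coef1 ic [::] f = 0.
Proof.
rewrite memv_ker => /eqP f0.
suff key n s (ic' : relators) : (#|arr B| < size s + n)%N ->
    is_nonzero_path (wvtx Y (val ic').1, (val ic').2 :: s) -> coef1 ic' s f = 0.
  apply: (key #|arr B|.+1); first by rewrite addnS ltnS leq_addl.
  by rewrite nzp1; case: ic => -[i c] /= /relatorP[-> _].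
elim: n s ic' => [|n IH] s [[i c] rel_ic]; rewrite ?addn0 => long_s /= nz.
  by have := size_nonzero_path gB nz; rewrite /= ltnNge ltnW.
set icx : relators := exist _ _ _; have [_ nz_s] := nzp_cons nz.
have e : (coef0 i (c :: s) \o p1 = coef1 icx s
    - \sum_(ic' : relators | go Y (val ic').2 (val ic').1 i) coef1 ic' (c :: s))%VF.
  apply: (fo_ext free1) => ic' t; rewrite comp_lfunE p1_e1 linearB linear_sum /=.
  rewrite !add_lfunE opp_lfunE sum_lfunE !(fo_coef free0) !(fo_coef free1) nz nz_s !andbT.
  congr (_%:R - _).
    have -> : (icx == ic') = (i == (val ic').1) && (c == (val ic').2).
      by rewrite -val_eqE /icx /=; case: (sval ic') => i' c'.
    by rewrite eqseq_cons andbA.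
  under eq_bigr => j _ do rewrite (fo_coef free0) nz andbT.
  under [RHS]eq_bigr => j _ do rewrite (fo_coef free1).
  rewrite big_mkcond (bigD1 i) //= [X in _ + X]big1 ?addr0 => [|j ji]; last first.
    by rewrite eq_sym (negPf ji) if_same.
  rewrite [RHS]big_mkcond (bigD1 ic') //= [X in _ = _ + X]big1 ?addr0 => [|j ji]; last first.
    by rewrite (negPf ji) if_same.
  rewrite !eqxx /=; case: ifP => // g'; congr (nat_of_bool _)%:R.
  case: eqP => //= et; symmetry.
  have [srcc nzc] := relatorP _ _ rel_ic.
  rewrite /is_nonzero_path /= /rel_vtx -(go_vtx strY g').2 srcc eqxx /=.
  by case/andP: nz.
have := congr1 (fun h : 'Hom(_, k^o) => h f) e; rewrite comp_lfunE f0 linear0.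
rewrite add_lfunE opp_lfunE sum_lfunE big1 ?subr0 => [|ic' g']; first by move->.
have [srcc nzc] := relatorP _ _ rel_ic; apply: IH.
  by apply: leq_trans long_s _; rewrite addnS.
move: nz; rewrite /is_nonzero_path /= => /andP[_ nz].
rewrite (go_vtx strY g').1 eqxx /= nz andbT /nonzero_step /composable srcc.
by rewrite (go_vtx strY g').2 eqxx /= (nzc _ _ g').
Qed.

(** The cover [p0] is not minimal in general: every basis vector of the string module
    is taken as a generator. This makes the relations uniform, and only the second map
    has to be minimal. *)
Lemma string_syzygy_minimal : syzygy_minimal (Presentation p1 p0).
Proof.
split; [exact: fo_module free1 | exact: fo_module free0 | exact: fo_projective free1
  | exact: fo_projective free0 | exact: hp1 | exact: hp0 | exact: limg_p0 | exact: limg_p1 |].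
by apply: (fo_superfluous free1) => f kf ic; apply: lker_p1_rad.
Qed.

End StringPresentation.

Lemma string_presentation_exists (k : fieldType) (B : bquiver) (Y : word B)
    (F0 F1 : rep k B) e0 coef0 e1 coef1 :
  gentle B -> is_string Y -> @free_on k B _ (@gen_vtx B Y) F0 e0 coef0 ->
  @free_on k B _ (@rel_vtx B Y) F1 e1 coef1 ->
  exists (p0 : 'Hom(F0, string_module k Y)) (p1 : 'Hom(F1, F0)),
    [/\ syzygy_minimal (Presentation p1 p0),
        forall i s, p0 (e0 i s) = pact s (delta k i : string_module k Y)
      & forall ic s, p1 (e1 ic s) = pact s (relation e0 ic)].
Proof.
move=> gB strY free0 free1; have modM := string_module_module k strY.
have [|p0 hp0 p0_e0] := fo_hom free0 (m := fun i => delta k i : string_module k Y) modM.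
  by move=> i; rewrite string_v eqxx.
have [|p1 hp1 p1_e1] := fo_hom free1 (m := relation e0) (fo_module free0).
  exact: (relation_at strY free0).
by exists p0, p1; split=> //; apply: (string_syzygy_minimal gB strY free0 free1).
Qed.

(** All terms but the first are read off the vertices and arrows met by the two
    strings, which lets the formula be compared over two algebras. *)
Lemma dim_HomA_tau_string (k : fieldType) (B : bquiver) (X Y : word B) :
  gentle B -> is_string X -> is_string Y ->
  (\dim (HomA (string_module k X) (tau (string_module k Y)))
    + \sum_(i < (wlen Y).+1) #|[set j : 'I_(wlen X).+1 | wvtx X j == wvtx Y i]|
  = \sum_(i < (wlen Y).+1) \sum_(c : arr B | relator Y i c)
        #|[set j : 'I_(wlen X).+1 | wvtx X j == tgt c]|
    + \dim (HomA (string_module k Y) (string_module k X)))%N.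
Proof.
move=> gB strX strY; have modX := string_module_module k strX.
have modY := string_module_module k strY.
have [p0 [p1 [okS _ _]]] := string_presentation_exists gB strY
  (freemod_free_on k gB (@gen_vtx B Y)) (freemod_free_on k gB (@rel_vtx B Y)).
have := dim_HomA_tau gB modX modY okS.
rewrite [pres0 _]/(freemod k (@gen_vtx B Y)) [pres1 _]/(freemod k (@rel_vtx B Y)).
rewrite !dim_HomA_free // => ->; congr (_ + _)%N.
rewrite pair_big_dep /=.
exact: (big_sig _ (fun ic : 'I_(wlen Y).+1 * arr B => relator Y ic.1 ic.2)
  (fun ic => #|[set j : 'I_(wlen X).+1 | wvtx X j == tgt ic.2]|)).
Qed.

(** * The cohook completion as the translate *)

Section GentleArrows.
Variable B : bquiver.
Hypothesis gB : gentle B.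

Lemma gentle_out2 (a b c : arr B) :
  src a = src c -> src b = src c -> a != b -> c = a \/ c = b.
Proof.
move=> ac bc ab; have := gentle_out gB (src c); rewrite /outdeg => le2.
have sub : [set a; b] \subset [set d | src d == src c].
  by apply/subsetP => d; rewrite !inE => /orP[]/eqP->; rewrite ?ac ?bc.
have /eqP e : [set a; b] == [set d | src d == src c].
  by rewrite eqEcard sub cards2 ab.
have : c \in [set a; b] by rewrite e inE.
by rewrite !inE => /orP[]/eqP; [left | right].
Qed.

Lemma gentle_in2 (a b c : arr B) :
  tgt a = tgt c -> tgt b = tgt c -> a != b -> c = a \/ c = b.
Proof.
move=> ac bc ab; have := gentle_in gB (tgt c); rewrite /indeg => le2.
have sub : [set a; b] \subset [set d | tgt d == tgt c].
  by apply/subsetP => d; rewrite !inE => /orP[]/eqP->; rewrite ?ac ?bc.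
have /eqP e : [set a; b] == [set d | tgt d == tgt c].
  by rewrite eqEcard sub cards2 ab.
have : c \in [set a; b] by rewrite e inE.
by rewrite !inE => /orP[]/eqP; [left | right].
Qed.

Lemma sum_letter (R : nmodType) (l : option (letter B)) (b : bool) (F : arr B -> R) :
  \sum_(c | l == Some (c, b)) F c
    = if l is Some (c, b') then (if b' == b then F c else 0) else 0.
Proof.
case: l => [[c b']|]; last by rewrite big_pred0.
have [->|nb] := eqVneq b' b.
  rewrite (eq_bigl (pred1 c)) ?big_pred1_eq // => d.
  by rewrite /= -[Some _ == _]/((c, b) == (d, b)) xpair_eqE eqxx andbT eq_sym.
rewrite big_pred0 // => d.
by rewrite -[Some _ == _]/((c, b') == (d, b)) xpair_eqE (negPf nb) andbF.
Qed.

End GentleArrows.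

(** What is used of a cohook completion [W] of [Y], in terms of positions: next to the
    copy of [Y] an arrow leaves it on each side, and the tails behind these two
    arrows lead back towards [Y]. *)
Record cohook_shape (B : bquiver) (Y W : word B) (o : nat) : Prop := CohookShape {
  cs_string : is_string W;
  cs_left_lt : (0 < o)%N;
  cs_right_lt : (o + wlen Y < wlen W)%N;
  cs_mid : forall i, (i < wlen Y)%N -> onth W.2 (o + i) = onth Y.2 i;
  cs_vtx : forall i, (i <= wlen Y)%N -> wvtx W (o + i) = wvtx Y i;
  cs_right : exists b, onth W.2 (o + wlen Y) = Some (b, true);
  cs_left : exists a, onth W.2 o.-1 = Some (a, false);
  cs_right_tail : forall w, (o + wlen Y < w < wlen W)%N ->
    exists d, onth W.2 w = Some (d, false);
  cs_left_tail : forall w, (w < o.-1)%N -> exists d, onth W.2 w = Some (d, true) }.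

Section CohookLetters.
Variables (B : bquiver) (Y W : word B) (o : nat).
Hypotheses (gB : gentle B) (strY : is_string Y) (shape : cohook_shape Y W o).
Local Notation n := (wlen Y).
Let strW := cs_string shape.

Lemma onth_Y_none : onth Y.2 n = None.
Proof. exact: onth_default. Qed.

Lemma cs_right_out i c : (i <= n)%N ->
  (onth W.2 (o + i) == Some (c, false)) = (onth Y.2 i == Some (c, false)).
Proof.
rewrite leq_eqVlt => /orP[/eqP->|lt_i]; last by rewrite (cs_mid shape).
by have [b ->] := cs_right shape; rewrite onth_Y_none; apply/eqP.
Qed.

Lemma cs_left_in i c : (i <= n)%N ->
  (onth W.2 (o + i).-1 == Some (c, true)) = (0 < i)%N && (onth Y.2 i.-1 == Some (c, true)).
Proof.
case: i => [|i] lt_i; last by rewrite addnS /= (cs_mid shape).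
by rewrite addn0; have [a ->] := cs_left shape; apply/eqP.
Qed.

Lemma go_W_up i c : onth W.2 i = Some (c, true) -> go W c i i.+1.
Proof. by move=> h; apply/goP; apply: GoUp. Qed.

Lemma go_W_down i c : onth W.2 i = Some (c, false) -> go W c i.+1 i.
Proof. by move=> h; apply/goP; apply: GoDown. Qed.

Lemma go_W_down1 w c : (0 < w)%N -> onth W.2 w.-1 = Some (c, false) -> go W c w w.-1.
Proof. by case: w => // w _; apply: go_W_down. Qed.

Lemma go_W_up1 w c : (0 < w)%N -> onth W.2 w.-1 = Some (c, true) -> go W c w.-1 w.
Proof. by case: w => // w _; apply: go_W_up. Qed.

Lemma go_mid a i j : (i <= n)%N -> (j <= n)%N -> go Y a i j -> go W a (o + i) (o + j).
Proof.
move=> le_i le_j /goP[e h|e h]; have lt_h := onth_size h; subst.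
  by rewrite addnS; apply: go_W_up; rewrite (cs_mid shape).
by rewrite addnS; apply: go_W_down; rewrite (cs_mid shape).
Qed.

(** At every position of [Y] the string [W] has a letter on both sides. If one of
    them arrives and the other leaves, then by gentleness the latter is the only arrow
    having a nonzero product with the former. If both leave, they are all the arrows
    out of the vertex. If both arrive, no arrow has a nonzero product with both. *)
Lemma relator_letter i c : (i <= n)%N ->
  relator Y i c = (onth W.2 (o + i) == Some (c, true))
               || (onth W.2 (o + i).-1 == Some (c, false)).
Proof.
move=> le_i; have o0 := cs_left_lt shape.
have w0 : (0 < o + i)%N by rewrite addn_gt0 o0.
apply/idP/idP => [/(relatorP strY)[srcc nzc]|out].
  have [[cR bR] hR] : exists l, onth W.2 (o + i) = Some l.
    have := onthTE W.2 (o + i); rewrite (leq_ltn_trans _ (cs_right_lt shape)) ?leq_add2l //.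
    by case: onth => // l _; exists l.
  have [[cL bL] hL] : exists l, onth W.2 (o + i).-1 = Some l.
    have := onthTE W.2 (o + i).-1.
    have -> : ((o + i).-1 < size W.2)%N.
      by have := cs_right_lt shape; rewrite /wlen in le_i *; lia.
    by case: onth => // l _; exists l.
  have nzR : bR = false -> ~~ zrel c cR.
    move=> bRf; have /eqP hY : onth Y.2 i == Some (cR, false).
      by rewrite -cs_right_out // hR bRf.
    by apply: (nzc _ i.+1); apply/goP; apply: GoDown.
  have nzL : bL = true -> ~~ zrel c cL.
    move=> bLt; have := cs_left_in cL le_i; rewrite hL bLt eqxx => /esym/andP[i0 /eqP hY].
    by apply: (nzc _ i.-1); apply/goP; apply: GoUp; rewrite ?prednK.
  have vW : wvtx W (o + i) = wvtx Y i by rewrite (cs_vtx shape).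
  rewrite hR hL; case: bR hR nzR => hR nzR; case: bL hL nzL => hL nzL.
  - have gR := go_W_up hR; have gL := go_W_up1 w0 hL.
    have -> : c = cR.
      apply: (gentle_right_nz gB (a := cL)); rewrite /nonzero_step /composable.
        by rewrite -(go_vtx strW gL).2 vW srcc eqxx (nzL erefl).
      by rewrite -(go_vtx strW gL).2 -(go_vtx strW gR).1 eqxx (go_nz strW gL gR).
    by rewrite eqxx.
  - have gR := go_W_up hR; have gL := go_W_down1 w0 hL.
    have [||| ->|->] := @gentle_out2 _ gB cR cL c; rewrite ?eqxx ?orbT //.
    + by rewrite -(go_vtx strW gR).1 vW.
    + by rewrite -(go_vtx strW gL).1 vW.
    by apply/eqP => e; rewrite -e in gL; have := go_fun strW gL gR; lia.
  - have gR := go_W_down hR; have gL := go_W_up1 w0 hL.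
    have e : cR = cL.
      apply: (gentle_left_nz gB (a := c)); rewrite /nonzero_step /composable.
        by rewrite -(go_vtx strW gR).2 vW srcc eqxx (nzR erefl).
      by rewrite -(go_vtx strW gL).2 vW srcc eqxx (nzL erefl).
    by rewrite e in gR; have := go_inj strW gL gR; lia.
  have gR := go_W_down hR; have gL := go_W_down1 w0 hL.
  have -> : c = cL.
    apply: (gentle_right_nz gB (a := cR)); rewrite /nonzero_step /composable.
      by rewrite -(go_vtx strW gR).2 vW srcc eqxx (nzR erefl).
    by rewrite -(go_vtx strW gR).2 -(go_vtx strW gL).1 eqxx (go_nz strW gR gL).
  by rewrite eqxx orbT.
have [w gw] : exists w, go W c (o + i) w.
  by case/orP: out => /eqP h; [exists (o + i).+1; apply: go_W_up | exists (o + i).-1; apply: go_W_down1].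
apply/(relatorP strY); split; first by rewrite -(go_vtx strW gw).1 (cs_vtx shape).
move=> b i' gb; have [le_i' _] := go_le strY gb.
exact: (go_nz strW (go_mid le_i' le_i gb) gw).
Qed.

Lemma onth_up_down w c : onth W.2 w = Some (c, false) -> onth W.2 w.+1 != Some (c, true).
Proof. by move=> h; apply/eqP => h'; case/and3P: (string_stepP strW h h') => _ /eqP. Qed.

End CohookLetters.

Section CohookTranslate.
Variables (k : fieldType) (B : bquiver) (Y W : word B) (o : nat).
Hypotheses (gB : gentle B) (strY : is_string Y) (shape : cohook_shape Y W o).
Local Notation n := (wlen Y).
Local Notation N := (wlen W).
Local Notation MW := (string_module k W).
Let strW := cs_string shape.
Let o0 := cs_left_lt shape.
Let oN := cs_right_lt shape.

Variable X : rep k B.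
Hypotheses (modX : is_module X).
Hypothesis X_ends : forall w, w = 0%N \/ w = N -> forall x : X, ract_v X (wvtx W w) x = 0.

(** ** The relation imposed at a position of [Y] *)

Section Contributions.
Variable phi : nat -> arr B -> 'Hom(X, k^o).

(** A functional on [Hom(P1, X)] is a family [phi i c] indexed by the relators. It
    vanishes on the maps factoring through [p1] if one relation holds at each position
    [i] of [Y]. Its terms come from the letters of [W] next to [i]: [KR] and [KL]
    collect those on the right and on the left. *)
Definition KR (i : nat) : 'Hom(X, k^o) :=
  if onth W.2 (o + i) is Some (c, b) then
    if b then (phi i c \o ract_a X c)%VF else - phi i.+1 c
  else 0.

Definition KL (i : nat) : 'Hom(X, k^o) :=
  if onth W.2 (o + i).-1 is Some (c, b) then
    if b then - phi i.-1 c else (phi i c \o ract_a X c)%VF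
  else 0.

Lemma sum_contributions (i : nat) (x : X) : (i <= n)%N ->
  \sum_(c | relator Y i c) phi i c (ract_a X c x)
    - \sum_(i' < n.+1) \sum_(c | go Y c i' i) phi i' c x = KR i x + KL i x.
Proof.
move=> le_i.
have -> : \sum_(c | relator Y i c) phi i c (ract_a X c x)
    = \sum_(c | onth W.2 (o + i) == Some (c, true)) phi i c (ract_a X c x)
    + \sum_(c | onth W.2 (o + i).-1 == Some (c, false)) phi i c (ract_a X c x).
  under eq_bigl => c do rewrite (relator_letter gB strY shape) //.
  rewrite (bigID (fun c => onth W.2 (o + i) == Some (c, true))) /=; congr (_ + _).
    by apply: eq_bigl => c; case: eqP => //=; rewrite ?andbT ?andbF.
  apply: eq_bigl => c; have [/= hu|//] := eqVneq; rewrite ?andbT //.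
  apply/esym/negbTE/eqP => hd.
  have w0 : (0 < o + i)%N by rewrite addn_gt0 o0.
  have := onth_up_down shape hd; rewrite prednK // hu.
  by rewrite eqxx.
have -> : \sum_(i' < n.+1) \sum_(c | go Y c i' i) phi i' c x
    = \sum_(c | onth W.2 (o + i) == Some (c, false)) phi i.+1 c x
    + \sum_(c | onth W.2 (o + i).-1 == Some (c, true)) phi i.-1 c x.
  under [X in _ = X + _]eq_bigl => c do rewrite (cs_right_out shape) //.
  under [X in _ = _ + X]eq_bigl => c do rewrite (cs_left_in shape) //.
  have split_go (i' : 'I_n.+1) : \sum_(c | go Y c i' i) phi i' c x
      = (if i' == i.+1 :> nat then \sum_(c | onth Y.2 i == Some (c, false)) phi i.+1 c x else 0)
      + (if i == i'.+1 :> nat then \sum_(c | onth Y.2 i.-1 == Some (c, true)) phi i.-1 c x else 0).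
    case: (i' == i.+1 :> nat) / eqP => e1.
      rewrite (_ : (i == i'.+1 :> nat) = false); last by apply/eqP; lia.
      rewrite addr0 -e1; apply: eq_bigl => c; rewrite /go e1 eqxx /=.
      by rewrite (_ : (i == i.+2) = false) //; apply/eqP; lia.
    case: (i == i'.+1 :> nat) / eqP => e2.
      rewrite add0r e2 /=; apply: eq_bigl => c; rewrite /go eqxx /=.
      by rewrite (_ : (i' == i'.+2 :> nat) = false) ?orbF //; apply/eqP; lia.
    rewrite addr0 big_pred0 // => c; rewrite /go.
    by move/eqP/negPf: e1 => ->; move/eqP/negPf: e2 => ->.
  rewrite (eq_bigr _ (fun i' _ => split_go i')) big_split /=; congr (_ + _).
    have [lt_i|ge_i] := ltnP i n.
      rewrite (bigD1 (Ordinal (lt_i : (i.+1 < n.+1)%N))) //= eqxx [X in _ + X]big1 ?addr0 // => j.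
      by rewrite -val_eqE /= => /negPf->.
    rewrite onth_default // [RHS]big_pred0 // big1 // => j _; case: eqP => // _.
    by rewrite big_pred0.
  case: i le_i {split_go} => [|i] le_i /=.
    by rewrite [RHS]big_pred0 // big1.
  rewrite (bigD1 (Ordinal (leqW le_i : (i < n.+1)%N))) //= eqxx [X in _ + X]big1 ?addr0 // => j.
  by rewrite -val_eqE /= eqSS eq_sym => /negPf->.
rewrite !sum_letter /KR /KL.
case: (onth W.2 (o + i)) => [[c []]|]; case: (onth W.2 (o + i).-1) => [[d []]|];
  rewrite /= ?zero_lfunE ?comp_lfunE ?opp_lfunE ?addr0 ?add0r ?subr0 ?sub0r ?oppr0 //.
- by rewrite opprD.
by rewrite addrC.
Qed.

End Contributions.

(** ** The functionals on the relators *)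

Variables (F0 F1 : rep k B).
Variables (e0 : 'I_n.+1 -> seq (arr B) -> F0) (coef0 : 'I_n.+1 -> seq (arr B) -> 'Hom(F0, k^o)).
Variables (e1 : relators Y -> seq (arr B) -> F1).
Variable (coef1 : relators Y -> seq (arr B) -> 'Hom(F1, k^o)).
Hypotheses (free0 : free_on (@gen_vtx B Y) e0 coef0) (free1 : free_on (@rel_vtx B Y) e1 coef1).
Variables (p0 : 'Hom(F0, string_module k Y)) (p1 : 'Hom(F1, F0)).
Let S : presentation (string_module k Y) := Presentation p1 p0.
Hypothesis okS : syzygy_minimal S.
Hypothesis p1_relation : forall ic s, p1 (e1 ic s) = pact s (relation e0 ic).

Local Notation H1 := (HomA F1 X).
Local Notation H0 := (HomA F0 X).

Definition theta_of (phi : nat -> arr B -> 'Hom(X, k^o)) : 'Hom(subvs_of H1, k^o) :=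
  linfun (fun u : subvs_of H1 =>
    \sum_(ic : relators Y) phi (val ic).1 (val ic).2 (vsval u (e1 ic [::])) : k^o).

Lemma theta_ofE phi u :
  theta_of phi u = \sum_(ic : relators Y) phi (val ic).1 (val ic).2 (vsval u (e1 ic [::])).
Proof.
rewrite linfunE // => c v w; rewrite scaler_sumr -big_split; apply: eq_bigr => ic _ /=.
by rewrite add_lfunE scale_lfunE !linearP.
Qed.

Lemma hom_single (i : 'I_n.+1) (x : X) : ract_v X (wvtx Y i) x = x ->
  exists2 v : 'Hom(F0, X), v \in H0 & forall j s, v (e0 j s) = if j == i then pact s x else 0.
Proof.
move=> x_at; have [|v hv ve] := fo_hom free0 (m := fun j => if j == i then x else 0) modX.
  by move=> j; case: eqP => [->|_]; rewrite ?linear0.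
by exists v => // j s; rewrite ve; case: eqP; rewrite ?pact0.
Qed.

Lemma relation_single (phi : nat -> arr B -> 'Hom(X, k^o)) (i : 'I_n.+1) (x : X) (v : 'Hom(F0, X)) :
  (forall j s, v (e0 j s) = if j == i then pact s x else 0) ->
  \sum_(ic : relators Y) phi (val ic).1 (val ic).2 (v (relation e0 ic))
    = KR phi i x + KL phi i x.
Proof.
move=> ve; rewrite -sum_contributions ?leq_ord //.
have vrel (ic : relators Y) : v (relation e0 ic)
    = (if (val ic).1 == i then ract_a X (val ic).2 x else 0)
      - (if go Y (val ic).2 (val ic).1 i then x else 0).
  rewrite /relation linearB /= ve linear_sum /=; congr (_ - _).
  rewrite (eq_bigr (fun j => if j == i then x else 0)) => [|j _]; last exact: ve.
  rewrite big_mkcond (bigD1 i) //= big1 ?addr0 => [|j ji]; first by rewrite eqxx.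
  by rewrite (negPf ji) if_same.
under eq_bigr => ic _ do rewrite vrel linearB /=.
rewrite sumrB.
rewrite (big_sig _ (fun ic : 'I_n.+1 * arr B => relator Y ic.1 ic.2)
  (fun ic => phi ic.1 ic.2 (if ic.1 == i then ract_a X ic.2 x else 0))).
rewrite (big_sig _ (fun ic : 'I_n.+1 * arr B => relator Y ic.1 ic.2)
  (fun ic => phi ic.1 ic.2 (if go Y ic.2 ic.1 i then x else 0))).
rewrite -(pair_big_dep xpredT (fun (i' : 'I_n.+1) c => relator Y i' c)
  (fun i' c => phi i' c (if i' == i then ract_a X c x else 0))) /=.
rewrite -(pair_big_dep xpredT (fun (i' : 'I_n.+1) c => relator Y i' c)
  (fun i' c => phi i' c (if go Y c i' i then x else 0))) /=.
congr (_ - _).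
  rewrite (bigD1 i) //= [X in _ + X]big1 ?addr0 => [|j ji]; last first.
    by rewrite big1 // => c _; rewrite (negPf ji) linear0.
  by apply: eq_bigr => c _; rewrite eqxx.
apply: eq_bigr => j _; rewrite big_mkcond [RHS]big_mkcond; apply: eq_bigr => c _.
case: ifP => [rel|nrel]; case: ifP => // gc; rewrite ?linear0 //.
by rewrite (go_relator strY gc) in nrel.
Qed.

(** It suffices to test on the maps out of [F0] that kill all generators but one. *)
Lemma theta_annP phi :
  reflect (forall (i : 'I_n.+1) x, ract_v X (wvtx Y i) x = x -> KR phi i x + KL phi i x = 0)
          (theta_of phi \in lker (dual_map (precomp X S))).
Proof.
have comp u : theta_of phi (precomp X S u)
    = \sum_(ic : relators Y) phi (val ic).1 (val ic).2 (vsval u (relation e0 ic)).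
  rewrite theta_ofE; apply: eq_bigr => ic _.
  by rewrite (precompE okS) comp_lfunE [p1 _]p1_relation.
rewrite memv_ker; apply: (iffP eqP) => [th0 i x x_at|K0].
  have [v hv ve] := hom_single x_at; rewrite -(relation_single _ ve).
  have := congr1 (fun h : 'Hom(_, k^o) => h (vsproj H0 v)) th0.
  by rewrite dual_mapE zero_lfunE comp vsprojK.
apply/lfunP => u; rewrite dual_mapE zero_lfunE comp; have hu := subvsP u.
have at_ (i : 'I_n.+1) : ract_v X (wvtx Y i) (vsval u (e0 i [::])) = vsval u (e0 i [::]).
  by rewrite -(hom_v _ _ hu) (fo_v free0) /= eqxx.
have /fin_all_exists2[v hv ve] := fun i => hom_single (at_ i).
have -> : vsval u = \sum_i v i.
  apply: (fo_ext free0) => i s; rewrite sum_lfunE (bigD1 i) //= big1 ?addr0 => [|j ji].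
    by rewrite ve eqxx -(hom_pact _ _ hu) (pact_free free0).
  by rewrite ve eq_sym (negPf ji).
under eq_bigr => ic _ do rewrite sum_lfunE linear_sum /=.
rewrite exchange_big big1 //= => i _.
by rewrite (relation_single _ (ve i)) K0.
Qed.

(** ** From maps into the completed string to functionals *)

Definition coord (w : nat) : 'Hom(MW, k^o) :=
  linfun (fun f : {ffun 'I_N.+1 -> k^o} => f (inord w)).

Lemma coordE w f : coord w f = (f : {ffun 'I_N.+1 -> k^o}) (inord w).
Proof. by rewrite linfunE // => c u v; rewrite !ffunE. Qed.

(** The coordinate at the end of the letter of [W] belonging to a relator, with a
    sign for the direction in which this letter is read. *)
Definition phi_of (psi : 'Hom(X, MW)) (i : nat) (c : arr B) : 'Hom(X, k^o) :=
  if onth W.2 (o + i) == Some (c, true) then (coord (o + i).+1 \o psi)%VF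
  else - (coord (o + i).-1 \o psi)%VF.

Lemma coord_letter (psi : 'Hom(X, MW)) c s t x :
  psi \in HomA X MW -> go W c s t -> coord t (psi (ract_a X c x)) = coord s (psi x).
Proof.
move=> hpsi g; have [le_s le_t] := go_le strW g.
rewrite (hom_a _ _ hpsi) !coordE basis_mapE (big_pred1 (inord s)) // => s'.
have -> : pred1 (inord s) s' = (s' == s :> nat) by rewrite -[s in RHS](@inordK N).
rewrite -[_ || _]/(go W c s' (inord t : 'I_N.+1)) inordK //.
by apply/idP/eqP => [g'|-> //]; apply: (go_inj strW g' g).
Qed.

Lemma coord_vtx (psi : 'Hom(X, MW)) w x : (w <= N)%N ->
  psi \in HomA X MW -> coord w (psi x) = coord w (psi (ract_v X (wvtx W w) x)).
Proof.
by move=> le_w hpsi; rewrite (hom_v _ _ hpsi) !coordE string_vE // inordK // eqxx.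
Qed.

Lemma KR_phi_of psi i x : (i <= n)%N -> psi \in HomA X MW ->
  KR (phi_of psi) i x = coord (o + i) (psi x).
Proof.
move=> le_i hpsi; have : onth W.2 (o + i).
  by rewrite onthTE; apply: leq_ltn_trans oN; rewrite leq_add2l.
rewrite /KR; case h: (onth W.2 (o + i)) => [[c []]|] // _.
  by rewrite comp_lfunE /phi_of h eqxx comp_lfunE (coord_letter _ hpsi (go_W_up h)).
have /negPf h' := onth_up_down shape h.
by rewrite /phi_of addnS h' opprK comp_lfunE.
Qed.

Lemma KL_phi_of psi i x : (i <= n)%N -> psi \in HomA X MW ->
  KL (phi_of psi) i x = - coord (o + i) (psi x).
Proof.
move=> le_i hpsi; have w0 : (0 < o + i)%N by rewrite addn_gt0 o0.
have : onth W.2 (o + i).-1.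
  by rewrite onthTE prednK //; apply: ltnW; apply: leq_ltn_trans oN; rewrite leq_add2l.
rewrite /KL; case h: (onth W.2 (o + i).-1) => [[c []]|] // _.
  have /eqP := h; rewrite (cs_left_in shape) // => /andP[i0 _].
  have e : (o + i.-1 = (o + i).-1)%N by lia.
  by rewrite opp_lfunE /phi_of e h eqxx comp_lfunE prednK.
have /negPf h' : onth W.2 (o + i) != Some (c, true).
  by have := onth_up_down shape h; rewrite prednK.
rewrite comp_lfunE /phi_of h' opp_lfunE comp_lfunE.
by rewrite (coord_letter _ hpsi (go_W_down1 w0 h)).
Qed.

(** For a family coming from a homomorphism, the contributions at a position are the
    coordinate there and its opposite. *)
Lemma theta_phi_of_ann psi : psi \in HomA X MW ->
  theta_of (phi_of psi) \in lker (dual_map (precomp X S)).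
Proof.
move=> hpsi; apply/theta_annP => i x _.
by rewrite KR_phi_of ?leq_ord // KL_phi_of ?leq_ord // subrr.
Qed.

Lemma hom_single1 (ic : relators Y) (x : X) : exists2 u : 'Hom(F1, X), u \in H1 &
  forall ic', u (e1 ic' [::]) = if ic' == ic then ract_v X (tgt (val ic).2) x else 0.
Proof.
have [|u hu ue] := fo_hom free1
  (m := fun ic' => if ic' == ic then ract_v X (tgt (val ic).2) x else 0) modX.
  by move=> ic'; case: eqP => [->|_]; rewrite ?linear0 // (mod_e modX) eqxx.
by exists u => // ic'; rewrite ue.
Qed.

Lemma theta_single phi ic x (u : 'Hom(F1, X)) : u \in H1 ->
  (forall ic', u (e1 ic' [::]) = if ic' == ic then ract_v X (tgt (val ic).2) x else 0) ->
  theta_of phi (vsproj H1 u) = phi (val ic).1 (val ic).2 (ract_v X (tgt (val ic).2) x).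
Proof.
move=> hu ue; rewrite theta_ofE vsprojK // (bigD1 ic) //= big1 => [|ic' nic].
  by rewrite addr0 ue eqxx.
by rewrite ue (negPf nic) linear0.
Qed.

(** The functionals contain the coordinates at the letters leaving a position of
    [Y]. As every arrow of the tails leads towards [Y], the coordinates further out
    are determined by these, and so are those at the positions of [Y] by the letters
    leaving them. *)
Lemma phi_of_inj psi : psi \in HomA X MW -> theta_of (phi_of psi) = 0 -> psi = 0.
Proof.
move=> hpsi th0.
have phi0 (i : 'I_n.+1) c x : relator Y i c -> phi_of psi i c (ract_v X (tgt c) x) = 0.
  move=> rel; pose ic : relators Y :=
    exist (fun ic : 'I_n.+1 * arr B => relator Y ic.1 ic.2) (i, c) rel.
  have [u hu ue] := hom_single1 ic x.
  by have := theta_single (phi_of psi) hu ue; rewrite th0 zero_lfunE => <-.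
have up i c x : (i <= n)%N -> onth W.2 (o + i) = Some (c, true) -> coord (o + i).+1 (psi x) = 0.
  move=> le_i h; have rel : relator Y i c by rewrite (relator_letter gB strY shape) // h eqxx.
  have lt_i : (i < n.+1)%N by [].
  have := phi0 (Ordinal lt_i) c x rel; rewrite /phi_of /= h eqxx comp_lfunE => e.
  have g := go_W_up h; have [_ le_w] := go_le strW g.
  by rewrite coord_vtx // (go_vtx strW g).2.
have down i c x : (i <= n)%N -> onth W.2 (o + i).-1 = Some (c, false) ->
    coord (o + i).-1 (psi x) = 0.
  move=> le_i h; have rel : relator Y i c.
    by rewrite (relator_letter gB strY shape) // h eqxx orbT.
  have lt_i : (i < n.+1)%N by [].
  have w0 : (0 < o + i)%N by rewrite addn_gt0 o0.
  have /negPf h' : onth W.2 (o + i) != Some (c, true).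
    by have := onth_up_down shape h; rewrite prednK.
  have := phi0 (Ordinal lt_i) c x rel; rewrite /phi_of /= h' opp_lfunE comp_lfunE.
  have g := go_W_down1 w0 h; have [_ le_w] := go_le strW g.
  move/eqP; rewrite oppr_eq0 => /eqP e.
  by rewrite coord_vtx // (go_vtx strW g).2.
have right r x : coord (o + n + r).+1 (psi x) = 0 \/ (N < (o + n + r).+1)%N.
  elim: r x => [|r IH] x.
    by left; rewrite addn0; have [b h] := cs_right shape; apply: up h.
  have [le_w|lt_w] := leqP (o + n + r.+1).+1 N; last by right.
  left; have [|d h] := cs_right_tail shape (w := o + n + r.+1); first by lia.
  have g := go_W_down h; rewrite -(coord_letter _ hpsi g) addnS.
  by have [] := IH (ract_a X d x) => //; lia.
have left_ r x : (r < o)%N -> coord (o.-1 - r) (psi x) = 0.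
  elim: r x => [|r IH] x lt_r.
    have [a h] := cs_left shape; rewrite subn0.
    by have := @down 0%N a x (leq0n _); rewrite addn0; apply.
  have [|d h] := cs_left_tail shape (w := o.-1 - r.+1); first by lia.
  have g := go_W_up h; rewrite -(coord_letter _ hpsi g).
  have -> : (o.-1 - r.+1).+1 = (o.-1 - r)%N by lia.
  by apply: IH; apply: ltnW.
apply/lfunP => x; rewrite zero_lfunE; apply/ffunP => w; rewrite [RHS]ffunE.
rewrite -[w]inord_val -coordE; have := leq_ord w; move: (val w) => {}w le_w.
have [lt_w|ge_w] := ltnP w o.
  have -> : w = (o.-1 - (o.-1 - w))%N by lia.
  by apply: left_; lia.
have [le_wn|lt_wn] := leqP w (o + n); last first.
  have [|//] := right (w - (o + n)).-1 x; first by congr (coord _ _ = _); lia.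
  by lia.
have -> : w = (o + (w - o))%N by lia.
set i := (w - o)%N; have le_i : (i <= n)%N by rewrite /i; lia.
have : onth W.2 (o + i) by rewrite onthTE; apply: leq_ltn_trans oN; rewrite leq_add2l.
case h: (onth W.2 (o + i)) => [[c []]|] // _.
  by rewrite -(coord_letter _ hpsi (go_W_up h)); apply: up h.
have lt_i : (i < n)%N.
  have hY : onth Y.2 i = Some (c, false) by apply/eqP; rewrite -(cs_right_out shape) // h.
  exact: onth_size hY.
by have := @down i.+1 c x lt_i; rewrite addnS /=; apply.
Qed.

(** ** From functionals to maps into the completed string *)

(** Every map out of [F1] is a sum of maps supported on one relator. The normalization
    of [phi] by the idempotents is what makes the map assembled from it below respect
    the vertices. *)
Lemma theta_ofP (theta : 'Hom(subvs_of H1, k^o)) :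
  exists2 phi, theta = theta_of phi &
    forall i c x, phi i c (ract_v X (tgt c) x) = phi i c x.
Proof.
pose vb := vbasis (fullv : {vspace X}); pose D := 'I_(\dim (fullv : {vspace X})).
have /fin_all_exists2[u hu ue] := fun ib : relators Y * D => hom_single1 ib.1 vb`_(ib.2).
pose psi0 ic : 'Hom(X, k^o) :=
  linfun (fun x : X => \sum_b vector.coord vb b x *: theta (vsproj H1 (u (ic, b))) : k^o).
have psi0E ic x : psi0 ic x = \sum_b vector.coord vb b x *: theta (vsproj H1 (u (ic, b))).
  rewrite linfunE // => c v w; rewrite scaler_sumr -big_split; apply: eq_bigr => b _ /=.
  by rewrite linearP scalerDl scalerA.
pose phi (i : nat) (c : arr B) : 'Hom(X, k^o) :=
  if insub i is Some i' then
    if insub (i', c) is Some ic then (psi0 ic \o ract_v X (tgt c))%VF else 0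
  else 0.
exists phi => [|i c x]; last first.
  rewrite /phi; case: insub => [i'|]; last by rewrite !zero_lfunE.
  case: insub => [ic|]; last by rewrite !zero_lfunE.
  by rewrite !comp_lfunE (mod_e modX) eqxx.
have phiE (ic : relators Y) : phi (val ic).1 (val ic).2 = (psi0 ic \o ract_v X (rel_vtx ic))%VF.
  by rewrite /phi valK -surjective_pairing valK.
apply/lfunP => v; rewrite theta_ofE; have hv := subvsP v.
have v_at ic : ract_v X (rel_vtx ic) (vsval v (e1 ic [::])) = vsval v (e1 ic [::]).
  by rewrite -(hom_v _ _ hv) (fo_v free1) /= eqxx.
have def_v : vsval v
    = \sum_ic \sum_b vector.coord vb b (vsval v (e1 ic [::])) *: u (ic, b).
  apply: (free_hom_ext free1 hv) => [|ic].
    by apply: memv_suml => ic _; apply: memv_suml => b _; apply/memvZ/hu.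
  have sumE ic' : (\sum_b vector.coord vb b (vsval v (e1 ic' [::])) *: u (ic', b)) (e1 ic [::])
      = if ic == ic' then vsval v (e1 ic' [::]) else 0.
    rewrite sum_lfunE (eq_bigr (fun b => if ic == ic' then
      ract_v X (rel_vtx ic') (vector.coord vb b (vsval v (e1 ic' [::])) *: vb`_b) else 0)).
      case: ifP => _; last by rewrite big1.
      by rewrite -linear_sum -coord_vbasis ?memvf //; apply: v_at.
    move=> b _; rewrite scale_lfunE ue; case: ifP => _; last by rewrite scaler0.
    by rewrite linearZ.
  rewrite sum_lfunE; under eq_bigr => ic' _ do rewrite sumE.
  rewrite (bigD1 ic) //= eqxx [X in _ + X]big1 ?addr0 // => ic' nic.
  by rewrite eq_sym (negPf nic).
have def_v' : v = \sum_ic \sum_b vector.coord vb b (vsval v (e1 ic [::])) *: vsproj H1 (u (ic, b)).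
  apply: subvs_inj; rewrite {1}def_v linear_sum; apply: eq_bigr => ic _.
  by rewrite linear_sum; apply: eq_bigr => b _; rewrite linearZ /= vsprojK.
rewrite [in LHS]def_v' linear_sum; apply: eq_bigr => ic _; rewrite phiE comp_lfunE psi0E linear_sum /=.
have coordE' b : vector.coord vb b (vsval v (e1 ic [::]))
    = vector.coord vb b (ract_v X (rel_vtx ic) (vsval v (e1 ic [::]))) by rewrite v_at.
apply: eq_bigr => b _; rewrite linearZ /= coordE'; congr (_ *: _).
Qed.

Section Assemble.
Variable phi : nat -> arr B -> 'Hom(X, k^o).
Hypothesis phi_at : forall i c x, phi i c (ract_v X (tgt c) x) = phi i c x.
Hypothesis K0 : forall i x, (i <= n)%N -> ract_v X (wvtx Y i) x = x ->
  KR phi i x + KL phi i x = 0.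

(** The values on the two tails are obtained by composition with the arrows that
    point back to [Y]. *)
Fixpoint right_tail (r : nat) : 'Hom(X, k^o) :=
  if onth W.2 (o + n + r) is Some (c, _) then
    if r is r'.+1 then (right_tail r' \o ract_a X c)%VF else phi n c
  else 0.

Fixpoint left_tail (r : nat) : 'Hom(X, k^o) :=
  if onth W.2 (o.-1 - r) is Some (c, _) then
    if r is r'.+1 then (left_tail r' \o ract_a X c)%VF else - phi 0%N c
  else 0.

Lemma right_tail0 c b : onth W.2 (o + n) = Some (c, b) -> right_tail 0 = phi n c.
Proof. by move=> h; rewrite /right_tail addn0 h. Qed.

Lemma right_tailS r c b : onth W.2 (o + n + r.+1) = Some (c, b) ->
  right_tail r.+1 = (right_tail r \o ract_a X c)%VF.
Proof. by rewrite /right_tail => ->. Qed.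

Lemma left_tail0 c b : onth W.2 o.-1 = Some (c, b) -> left_tail 0 = - phi 0%N c.
Proof. by move=> h; rewrite /left_tail subn0 h. Qed.

Lemma left_tailS r c b : onth W.2 (o.-1 - r.+1) = Some (c, b) ->
  left_tail r.+1 = (left_tail r \o ract_a X c)%VF.
Proof. by rewrite /left_tail => ->. Qed.

Definition psi_at (w : nat) : 'Hom(X, k^o) :=
  if (w < o)%N then left_tail (o.-1 - w)
  else if (w <= o + n)%N then KR phi (w - o) else right_tail (w - (o + n).+1).

Lemma psi_at_mid i : (i <= n)%N -> psi_at (o + i) = KR phi i.
Proof. by move=> le_i; rewrite /psi_at ltnNge leq_addr /= leq_add2l le_i addKn. Qed.

Lemma psi_at_right r : psi_at (o + n + r).+1 = right_tail r.
Proof.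
rewrite /psi_at; have -> : ((o + n + r).+1 < o)%N = false by lia.
have -> : ((o + n + r).+1 <= o + n)%N = false by lia.
by congr right_tail; lia.
Qed.

Lemma psi_at_left r : (r < o)%N -> psi_at (o.-1 - r) = left_tail r.
Proof.
move=> lt_r; rewrite /psi_at; case: ltnP => [_|h]; last by exfalso; lia.
by congr left_tail; lia.
Qed.

Let strW_next w : (w < N)%N -> exists c b, onth W.2 w = Some (c, b).
Proof. by rewrite -onthTE; case: (onth _ _) => // -[c b] _; exists c, b. Qed.

Lemma KR_vtx i x : (i <= n)%N -> KR phi i (ract_v X (wvtx Y i) x) = KR phi i x.
Proof.
move=> le_i; rewrite /KR; case h: (onth W.2 (o + i)) => [[c []]|]; last by rewrite !zero_lfunE.
  have g := go_W_up h; rewrite !comp_lfunE -[phi i c (ract_a _ _ x)]phi_at.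
  by rewrite (mod_src modX) -(cs_vtx shape) // (go_vtx strW g).1 eqxx phi_at.
have g := go_W_down h; rewrite !opp_lfunE -(cs_vtx shape) // (go_vtx strW g).2.
by rewrite phi_at.
Qed.

Lemma psi_at_vtx w x : (w <= N)%N -> psi_at w (ract_v X (wvtx W w) x) = psi_at w x.
Proof.
move=> le_w; have [lt_w|ge_w] := ltnP w o.
  have [r [e lt_r]] : exists r, w = (o.-1 - r)%N /\ (r < o)%N by exists (o.-1 - w)%N; lia.
  rewrite {}e {lt_w} in le_w *; rewrite psi_at_left //.
  case: r lt_r {le_w} => [|r] lt_r.
    have [a h] := cs_left shape; rewrite subn0 (left_tail0 h) !opp_lfunE.
    by rewrite (go_vtx strW (go_W_down h)).2 phi_at.
  have [|d h] := cs_left_tail shape (w := o.-1 - r.+1); first by lia.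
  have g := go_W_up h; rewrite (left_tailS h) !comp_lfunE (mod_src modX).
  by rewrite (go_vtx strW g).1 eqxx.
have [le_wn|lt_wn] := leqP w (o + n).
  have -> : w = (o + (w - o))%N by lia.
  by rewrite psi_at_mid ?(cs_vtx shape) ?KR_vtx //; lia.
have [r e] : exists r, w = (o + n + r).+1 by exists (w - (o + n).+1)%N; lia.
rewrite {}e {ge_w lt_wn} in le_w *; rewrite psi_at_right; case: r le_w => [|r] le_w.
  have [b h] := cs_right shape; rewrite addn0 (right_tail0 h).
  by rewrite (go_vtx strW (go_W_up h)).2 phi_at.
have [|d h] := cs_right_tail shape (w := o + n + r.+1); first by lia.
have g := go_W_down h; rewrite (right_tailS h) !comp_lfunE (mod_src modX).
by rewrite (go_vtx strW g).1 eqxx.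
Qed.

(** So the coordinate at a position of [Y] can be computed from the letter on either
    side, and [assembled] commutes with the letters of [W]. *)
Lemma KR_KL i x : (i <= n)%N -> ract_v X (wvtx Y i) x = x -> KR phi i x = - KL phi i x.
Proof. by move=> le_i x_at; apply/eqP; rewrite -addr_eq0 K0. Qed.

Lemma KL_out c i x : onth W.2 (o + i).-1 = Some (c, false) ->
  KL phi i x = phi i c (ract_a X c x).
Proof. by rewrite /KL => ->; rewrite comp_lfunE. Qed.

Lemma KL_in c i x : onth W.2 (o + i).-1 = Some (c, true) -> KL phi i x = - phi i.-1 c x.
Proof. by rewrite /KL => ->; rewrite opp_lfunE. Qed.

Lemma KR_out c i x : onth W.2 (o + i) = Some (c, true) ->
  KR phi i x = phi i c (ract_a X c x).
Proof. by rewrite /KR => ->; rewrite comp_lfunE. Qed.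

Lemma KR_in c i x : onth W.2 (o + i) = Some (c, false) -> KR phi i x = - phi i.+1 c x.
Proof. by rewrite /KR => ->; rewrite opp_lfunE. Qed.

Lemma psi_at_go c s t x : go W c s t -> psi_at t (ract_a X c x) = psi_at s x.
Proof.
move=> g; have [le_s le_t] := go_le strW g; have [vs vt] := go_vtx strW g.
rewrite -[RHS]psi_at_vtx //; set y := ract_v X (wvtx W s) x.
have y_at : ract_v X (wvtx W s) y = y by rewrite /y (mod_e modX) eqxx.
have <- : ract_a X c y = ract_a X c x by rewrite /y (mod_src modX) vs eqxx.
have cy_at : ract_v X (wvtx W t) (ract_a X c y) = ract_a X c y.
  by rewrite (mod_tgt modX) vt eqxx.
case/goP: g => [e h|e h]; subst.
  have [lt_s|ge_s] := ltnP s o.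
    have [lt_s1|ge_s1] := ltnP s o.-1.
      have -> : s = (o.-1 - (o.-1 - s.+1).+1)%N by lia.
      have -> : (o.-1 - (o.-1 - s.+1).+1).+1 = (o.-1 - (o.-1 - s.+1))%N by lia.
      rewrite !psi_at_left; [|lia|lia].
      rewrite (left_tailS (c := c) (b := true)) ?comp_lfunE // -[RHS]h.
      by congr onth; lia.
    have [a h'] := cs_left shape; have es : s = o.-1 by lia.
    by rewrite es h' in h.
  have [lt_sn|ge_sn] := ltnP s (o + n).
    have es : s = (o + (s - o))%N by lia.
    have le_i : (s - o < n)%N by lia.
    move: (s - o)%N es le_i => i es lt_i; subst s.
    rewrite -addnS !psi_at_mid // ?(ltnW lt_i) // (KR_out _ h).
    rewrite KR_KL //; last by rewrite -(cs_vtx shape) // addnS.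
    by rewrite (KL_in (c := c)) ?opprK ?addnS.
  have [eq_s|ne_s] := eqVneq s (o + n)%N.
    subst s; rewrite psi_at_mid // (KR_out _ h).
    by have := psi_at_right 0; rewrite addn0 => ->; rewrite (right_tail0 h).
  have lt_sN : (s < N)%N by [].
  have [|d h'] := cs_right_tail shape (w := s); last by rewrite h' in h.
  by move/eqP: ne_s => ne_s; lia.
have [lt_t|ge_t] := ltnP t o.
  have [lt_t1|ge_t1] := ltnP t o.-1.
    by have [d h'] := cs_left_tail shape lt_t1; rewrite h' in h.
  have et : t = o.-1 by lia.
  have -> : t.+1 = (o + 0)%N by lia.
  rewrite psi_at_mid // KR_KL //; last first.
    by rewrite -(cs_vtx shape) // addn0 -{1}(prednK o0) -et.
  rewrite (KL_out (c := c)) ?addn0 -?et //.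
  have -> : t = (o.-1 - 0)%N by lia.
  by rewrite psi_at_left // (left_tail0 (c := c) (b := false)) ?opp_lfunE // -et.
have [lt_tn|ge_tn] := ltnP t (o + n).
  have et : t = (o + (t - o))%N by lia.
  have le_i : (t - o < n)%N by lia.
  move: (t - o)%N et le_i => i et lt_i; subst t.
  rewrite -addnS !psi_at_mid // ?(ltnW lt_i) // (KR_in _ h).
  rewrite KR_KL //; last by rewrite -(cs_vtx shape) // addnS.
  by rewrite (KL_out (c := c)) ?addnS.
have [eq_t|ne_t] := eqVneq t (o + n)%N.
  by have [b h'] := cs_right shape; rewrite eq_t h' in h.
have -> : t = (o + n + (t - (o + n).+1)).+1 by lia.
have -> : (o + n + (t - (o + n).+1)).+2 = (o + n + (t - (o + n).+1).+1).+1 by lia.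
rewrite !psi_at_right (right_tailS (c := c) (b := false)) ?comp_lfunE // -[RHS]h.
by congr onth; lia.
Qed.

(** Inside [W], gentleness yields a letter [c] leaving [w] with [c a] in the ideal, and
    the coordinate at [w] is the one at the other end of [c], applied to the image
    under [c]. At the ends of [W] the module vanishes. *)
Lemma psi_at_stop a w x : (w <= N)%N -> (forall s, ~~ go W a s w) ->
  psi_at w (ract_a X a x) = 0.
Proof.
move=> le_w nogo; rewrite -psi_at_vtx // (mod_tgt modX).
case: eqP => [ta|_]; last by rewrite linear0.
have [w_end|w_mid] : (w = 0%N \/ w = N) \/ (0 < w < N)%N by lia.
  have -> : ract_a X a x = ract_v X (wvtx W w) (ract_a X a x).
    by rewrite (mod_tgt modX) ta eqxx.
  by rewrite X_ends // linear0.
case/andP: w_mid => w0 lt_w.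
have zero c t : go W c w t -> zrel c a -> psi_at w (ract_a X a x) = 0.
  by move=> g zca; rewrite -(psi_at_go _ g) (mod_z modX) // linear0.
have [cR [bR hR]] := strW_next lt_w.
have [|cL [bL hL]] := @strW_next w.-1; first by lia.
case: bR hR => hR; case: bL hL => hL.
- have gR := go_W_up hR; have gL := go_W_up1 w0 hL.
  have [z|nz] := boolP (zrel cR a); first exact: zero gR z.
  have e : a = cL.
    apply: (gentle_left_nz gB (a := cR)); rewrite /nonzero_step /composable.
      by rewrite -ta -(go_vtx strW gR).1 eqxx.
    by rewrite -(go_vtx strW gL).2 -(go_vtx strW gR).1 eqxx (go_nz strW gL gR).
  by case/negP: (nogo w.-1); rewrite e.
- have gR := go_W_up hR; have gL := go_W_down1 w0 hL.
  have [z|nzR] := boolP (zrel cR a); first exact: zero gR z.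
  have [z|nzL] := boolP (zrel cL a); first exact: zero gL z.
  have e : cR = cL.
    apply: (gentle_right_nz gB (a := a)); rewrite /nonzero_step /composable.
      by rewrite -ta -(go_vtx strW gR).1 eqxx.
    by rewrite -ta -(go_vtx strW gL).1 eqxx.
  by rewrite e in gR; have := go_fun strW gL gR; lia.
- have gR := go_W_down hR; have gL := go_W_up1 w0 hL.
  have [||| e|e] := @gentle_in2 _ gB cR cL a.
  + by rewrite -(go_vtx strW gR).2.
  + by rewrite -(go_vtx strW gL).2.
  + by apply/eqP => e; rewrite e in gR; have := go_inj strW gL gR; lia.
  + by case/negP: (nogo w.+1); rewrite e.
  by case/negP: (nogo w.-1); rewrite e.
have gR := go_W_down hR; have gL := go_W_down1 w0 hL.
have [z|nz] := boolP (zrel cL a); first exact: zero gL z.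
have e : a = cR.
  apply: (gentle_left_nz gB (a := cL)); rewrite /nonzero_step /composable.
    by rewrite -ta -(go_vtx strW gL).1 eqxx.
  by rewrite -(go_vtx strW gR).2 -(go_vtx strW gL).1 eqxx (go_nz strW gR gL).
by case/negP: (nogo w.+1); rewrite e.
Qed.

Definition assembled : 'Hom(X, MW) :=
  linfun (fun x : X => [ffun w : 'I_N.+1 => psi_at w x : k^o] : {ffun 'I_N.+1 -> k^o}).

Lemma assembledE x w : (assembled x : {ffun 'I_N.+1 -> k^o}) w = psi_at w x.
Proof.
rewrite linfunE ?ffunE // => c u v; apply/ffunP => t.
by rewrite !ffunE linearP.
Qed.

Lemma assembled_hom : assembled \in HomA X MW.
Proof.
apply/homP; split=> [y|a] x; apply/ffunP => w; rewrite assembledE.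
  rewrite string_vE assembledE -psi_at_vtx ?leq_ord // (mod_e modX).
  by case: ifP => _; rewrite ?linear0 // psi_at_vtx ?leq_ord.
rewrite [RHS]basis_mapE; under eq_bigr => s _ do rewrite assembledE.
have [[s gs]|nogo] := excluded_middle_informative (exists s, go W a s w).
  have [le_s _] := go_le strW gs.
  rewrite (psi_at_go _ gs) (big_pred1 (Ordinal (le_s : (s < N.+1)%N))) // => s'.
  rewrite -[_ || _]/(go W a s' w) /= -val_eqE /=.
  by apply/idP/eqP => [gs'|-> //]; apply: (go_inj strW gs' gs).
rewrite psi_at_stop ?leq_ord // => [|s].
  by rewrite big_pred0 // => s; apply/negP => gs; apply: nogo; exists (s : nat).
by apply/negP => gs; apply: nogo; exists s.
Qed.

Lemma phi_of_assembled i c x : (i <= n)%N -> relator Y i c -> ract_v X (tgt c) x = x ->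
  phi_of assembled i c x = phi i c x.
Proof.
move=> le_i rel x_at; have w0 : (0 < o + i)%N by rewrite addn_gt0 o0.
have cE w : (w <= N)%N -> coord w (assembled x) = psi_at w x.
  by move=> le_w; rewrite coordE assembledE inordK.
move: rel; rewrite (relator_letter gB strY shape) // /phi_of.
case: eqP => [h _|nh /= /eqP h].
  have g := go_W_up h; have [_ le_w] := go_le strW g; have [_ vt] := go_vtx strW g.
  rewrite comp_lfunE cE //; have [lt_i|ge_i] := ltnP i n.
    rewrite -addnS psi_at_mid // KR_KL //.
      by rewrite (KL_in (c := c)) ?opprK ?addnS.
    by rewrite -(cs_vtx shape) // addnS vt.
  have e : i = n by lia.
  subst i; have := psi_at_right 0; rewrite addn0 => ->.
  by rewrite (right_tail0 h).
have g := go_W_down1 w0 h; have [_ le_w] := go_le strW g; have [_ vt] := go_vtx strW g.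
rewrite opp_lfunE comp_lfunE cE //; case: i le_i h le_w vt {w0 nh g} => [|i] le_i h le_w vt.
  rewrite addn0 -[o.-1]subn0 psi_at_left // (left_tail0 (c := c) (b := false)).
    by rewrite opp_lfunE opprK.
  by rewrite addn0 in h.
rewrite addnS /= in h vt *; rewrite psi_at_mid ?(ltnW le_i) // (KR_in (c := c)) ?opprK //.
Qed.

End Assemble.

(** [phi_of] and [assembled] are inverse to each other. *)
Lemma dim_HomA_completed :
  \dim (HomA X (tau (string_module k Y))) = \dim (HomA X MW).
Proof.
have modY := string_module_module k strY.
have -> : \dim (HomA X (tau (string_module k Y))) = \dim (lker (dual_map (precomp X S))).
  have := dim_HomA_tau gB modX modY okS; have := AR_formula gB modX okS.
  by rewrite (dim_HomA_kernel gB modX okS) => <- /eqP; rewrite eqn_add2r => /eqP.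
have lin : linear (fun psi => theta_of (phi_of psi)).
  move=> c u v; apply/lfunP => w; rewrite add_lfunE scale_lfunE !theta_ofE.
  rewrite scaler_sumr -big_split; apply: eq_bigr => ic _ /=; rewrite /phi_of.
  case: ifP => _; rewrite ?opp_lfunE !comp_lfunE add_lfunE scale_lfunE linearP //=.
  by rewrite opprD scalerN.
apply/eqP; rewrite eqn_leq; apply/andP; split; last first.
  by apply: (dim_le_inj lin) => psi; [apply: theta_phi_of_ann | apply: phi_of_inj].
have <- : (linfun (fun psi => theta_of (phi_of psi)) @: HomA X MW)%VS
    = lker (dual_map (precomp X S)).
  apply/vspaceP => theta; apply/memv_imgP/idP => [[psi hpsi ->]|ann].
    by rewrite (linfunE lin) theta_phi_of_ann.
  have [phi def_theta phi_at] := theta_ofP theta; rewrite {}def_theta in ann *.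
  have K0 i x : (i <= n)%N -> ract_v X (wvtx Y i) x = x -> KR phi i x + KL phi i x = 0.
    by move=> le_i; move/theta_annP: ann => /(_ (Ordinal (le_i : (i < n.+1)%N)) x).
  exists (assembled phi); first exact: assembled_hom.
  rewrite (linfunE lin); apply/lfunP => u; rewrite !theta_ofE; apply: eq_bigr => ic _.
  rewrite phi_of_assembled ?leq_ord //; first exact: (valP ic).
  by rewrite -(hom_v _ _ (subvsP u)) (fo_v free1) /= eqxx.
have := limg_ker_dim (linfun (fun psi => theta_of (phi_of psi))) (HomA X MW).
by move=> <-; apply: leq_addl.
Qed.

End CohookTranslate.

(** This is where the completed string replaces the translate. *)
Lemma dim_HomA_cohook (k : fieldType) (B : bquiver) (Y W : word B) (o : nat) (X : rep k B) :
  gentle B -> is_string Y -> cohook_shape Y W o -> is_module X ->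
  (forall w, w = 0%N \/ w = wlen W -> forall x : X, ract_v X (wvtx W w) x = 0) ->
  \dim (HomA X (tau (string_module k Y))) = \dim (HomA X (string_module k W)).
Proof.
move=> gB strY shape modX X_ends.
have free0 := freemod_free_on k gB (@gen_vtx B Y).
have free1 := freemod_free_on k gB (@rel_vtx B Y).
have [p0 [p1 [okS _ p1_rel]]] := string_presentation_exists gB strY free0 free1.
exact: (dim_HomA_completed gB strY shape modX X_ends free0 free1 okS p1_rel).
Qed.

(** * Homomorphisms between string modules *)

Section CoefficientFunctions.
Variables (k : fieldType) (B : bquiver) (C C' : word B).
Hypotheses (strC : is_string C) (strC' : is_string C').
Local Notation n := (wlen C).
Local Notation m := (wlen C').
Local Notation M := (string_module k C).
Local Notation M' := (string_module k C').

(** An arrow sends basis vectors to basis vectors or to zero, injectively apart from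
    zero. So commuting with it means that the matrix coefficients agree along
    simultaneous steps of the two strings, and vanish where only one of them can make
    the step. *)
Record hom_coef (c : nat -> nat -> k) : Prop := HomCoef {
  hc_step : forall a i i' j j', go C a i i' -> go C' a j j' -> c i j = c i' j';
  hc_in : forall a i i' j, go C a i' i -> (j <= m)%N -> c i j != 0 ->
    exists j', go C' a j' j;
  hc_out : forall a i j j', go C' a j j' -> (i <= n)%N -> c i j != 0 ->
    exists i', go C a i i';
  hc_vtx : forall i j, (i <= n)%N -> (j <= m)%N -> c i j != 0 -> wvtx C i = wvtx C' j }.

Definition coef_of (f : 'Hom(M, M')) (i j : nat) : k :=
  (f (delta k (inord i : 'I_n.+1)) : {ffun 'I_m.+1 -> k^o}) (inord j).

Lemma go_sum (D : word B) (F : nat -> k) a i j : is_string D -> go D a i j ->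
  \sum_(x < (wlen D).+1 | go D a i x) F x = F j.
Proof.
move=> strD g; have [_ le_j] := go_le strD g.
rewrite (big_pred1 (Ordinal (le_j : (j < (wlen D).+1)%N))) // => x.
by rewrite /= -val_eqE /=; apply/idP/eqP => [g'|-> //]; apply: (go_fun strD g' g).
Qed.

Lemma og_sum (D : word B) (F : nat -> k) a i j : is_string D -> go D a i j ->
  \sum_(x < (wlen D).+1 | go D a x j) F x = F i.
Proof.
move=> strD g; have [le_i _] := go_le strD g.
rewrite (big_pred1 (Ordinal (le_i : (i < (wlen D).+1)%N))) // => x.
by rewrite /= -val_eqE /=; apply/idP/eqP => [g'|-> //]; apply: (go_inj strD g' g).
Qed.

Lemma coef_eq f a i j : f \in HomA M M' -> (i <= n)%N -> (j <= m)%N ->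
  \sum_(x < n.+1 | go C a i x) coef_of f x j = \sum_(y < m.+1 | go C' a y j) coef_of f i y.
Proof.
move=> hf le_i le_j; have := @hom_a k B M M' f a (delta k (inord i : 'I_n.+1)) hf.
move/(congr1 (fun h : M' => (h : {ffun 'I_m.+1 -> k^o}) (inord j))).
rewrite string_a linear_sum /= sum_ffunE basis_mapE inordK // => e.
transitivity (\sum_(x < n.+1 | go C a i x) (f (delta k x) : {ffun 'I_m.+1 -> k^o}) (inord j)).
  by apply: eq_bigr => x _; rewrite /coef_of inord_val.
rewrite e; apply: eq_big => [y|y _]; last by rewrite /coef_of inord_val.
by rewrite -[_ || _]/(go C' a y (inord j : 'I_m.+1)) inordK.
Qed.

Lemma coef_of_hom f : f \in HomA M M' -> hom_coef (coef_of f).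
Proof.
move=> hf; split=> [a i i' j j' g g'|a i i' j g le_j nz|a i j j' g le_i nz|i j le_i le_j nz].
- have [le_i _] := go_le strC g; have [_ le_j'] := go_le strC' g'.
  have := coef_eq a hf le_i le_j'.
  by rewrite (go_sum (fun x => coef_of f x j') strC g) (og_sum (coef_of f i) strC' g').
- have [le_i' _] := go_le strC g; have := coef_eq a hf le_i' le_j.
  rewrite (go_sum (fun x => coef_of f x j) strC g) => e; apply: NNPP => none.
  case/eqP: nz; rewrite e big_pred0 // => y; apply/negP => gy; apply: none.
  by exists y.
- have [_ le_j'] := go_le strC' g; have := coef_eq a hf le_i le_j'.
  rewrite [RHS](og_sum (coef_of f i) strC' g) => e; apply: NNPP => none.
  case/eqP: nz; rewrite -e big_pred0 // => y; apply/negP => gy; apply: none.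
  by exists y.
have := @hom_v k B M M' f (wvtx C i) (delta k (inord i : 'I_n.+1)) hf.
rewrite string_v inordK // eqxx => e; move: nz; rewrite /coef_of e string_vE inordK //.
by case: (wvtx C' j =P wvtx C i) => [->|_] //; rewrite eqxx.
Qed.

Definition hom_of (c : nat -> nat -> k) : 'Hom(M, M') :=
  linfun (fun f : {ffun 'I_n.+1 -> k^o} =>
            [ffun j : 'I_m.+1 => \sum_(i < n.+1) f i * c i j : k^o] : {ffun 'I_m.+1 -> k^o}).

Lemma hom_of_delta c i j : (hom_of c (delta k i) : {ffun 'I_m.+1 -> k^o}) j = c i j.
Proof.
rewrite linfunE; first by rewrite ffunE sum_deltal.
move=> d u v; apply/ffunP => j'; rewrite !ffunE scaler_sumr -big_split.
apply: eq_bigr => x _; rewrite !ffunE mulrDl; congr (_ + _).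
by rewrite /GRing.scale /= mulrA.
Qed.

Lemma hom_of_hom c : hom_coef c -> hom_of c \in HomA M M'.
Proof.
move=> hc; apply/mem_HomA; split=> [x|a]; apply: ffun_lin_ext => i; apply/ffunP => j;
  rewrite !comp_lfunE.
  rewrite string_v string_vE hom_of_delta.
  have [zero|nz] := eqVneq (c i j) 0.
    by case: ifP => _; rewrite ?linear0 ?ffunE ?hom_of_delta ?zero ?if_same.
  rewrite -(hc_vtx hc (leq_ord i) (leq_ord j) nz).
  by case: ifP => _; rewrite ?hom_of_delta // linear0 ffunE.
rewrite string_a linear_sum sum_ffunE /= basis_mapE.
under eq_bigr => i' _ do rewrite hom_of_delta.
under [RHS]eq_bigr => j' _ do rewrite hom_of_delta.
rewrite (eq_bigl (fun y : 'I_m.+1 => go C' a y j)) //.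
have [[i' gi]|noi] := excluded_middle_informative (exists i', go C a i i');
  have [[j' gj]|noj] := excluded_middle_informative (exists j', go C' a j' j).
- rewrite (go_sum (fun x => c x j) strC gi) (og_sum (c i) strC' gj).
  by rewrite (hc_step hc gi gj).
- rewrite (go_sum (fun x => c x j) strC gi) big_pred0 => [|y].
    by apply/eqP/negPn/negP => nz; case: noj; apply: (hc_in hc gi (leq_ord j) nz).
  by apply/negP => gy; case: noj; exists y.
- rewrite (og_sum (c i) strC' gj) big_pred0 => [|y].
    apply/esym/eqP/negPn/negP => nz; case: noi.
    exact: (hc_out hc gj (leq_ord i) nz).
  by apply/negP => gy; case: noi; exists y.
rewrite !big_pred0 // => y; apply/negP => gy; [case: noj | case: noi]; by exists y.
Qed.

Lemma coef_of_inj f : (forall (i : 'I_n.+1) (j : 'I_m.+1), coef_of f i j = 0) -> f = 0.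
Proof.
move=> f0; apply: ffun_lin_ext => i; rewrite zero_lfunE; apply/ffunP => j.
by have := f0 i j; rewrite /coef_of !inord_val ffunE.
Qed.

(** If the nodes [(i, j)] carrying the homomorphisms are grouped into classes on
    which coefficients are constant, these classes index a basis. *)
Lemma dim_HomA_classes (K : finType) (inK : K -> nat -> nat -> bool) (rep : K -> 'I_n.+1 * 'I_m.+1) :
  (forall q, inK q (rep q).1 (rep q).2) ->
  (forall q q' i j, inK q i j -> inK q' i j -> q = q') ->
  (forall c, hom_coef c -> forall q i j, inK q i j -> c i j = c (rep q).1 (rep q).2) ->
  (forall c, hom_coef c -> forall i j, (i <= n)%N -> (j <= m)%N -> c i j != 0 ->
     exists q, inK q i j) ->
  (forall u : K -> k, hom_coef (fun i j => \sum_(q | inK q i j) u q)) ->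
  \dim (HomA M M') = #|K|.
Proof.
move=> in_rep uniq_in const_in cover_in hom_in.
rewrite -(dim_ffun k K) -dimvf; apply/eqP; rewrite eqn_leq; apply/andP; split.
  pose F (f : 'Hom(M, M')) : {ffun K -> k^o} := [ffun q => coef_of f (rep q).1 (rep q).2].
  apply: (@dim_le_inj _ _ _ _ _ F) => [d u v|f _|f hf /ffunP f0]; rewrite ?memvf //.
    by apply/ffunP => q; rewrite !ffunE /coef_of add_lfunE scale_lfunE !ffunE.
  have hc := coef_of_hom hf; apply: coef_of_inj => i j; apply/eqP/negPn/negP => nz.
  have [q in_q] := cover_in _ hc _ _ (leq_ord i) (leq_ord j) nz.
  case/eqP: nz; rewrite (const_in _ hc _ _ _ in_q).
  by have := f0 q; rewrite !ffunE.
pose cof (u : {ffun K -> k^o}) i j : k := \sum_(q | inK q i j) u q.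
apply: (@dim_le_inj _ _ _ _ _ (fun u => hom_of (cof u))) => [d u v|u _|u _ u0].
- apply: ffun_lin_ext => i; apply/ffunP => j; rewrite add_lfunE scale_lfunE !ffunE.
  rewrite !hom_of_delta /cof scaler_sumr -big_split.
  by apply: eq_bigr => q _; rewrite !ffunE.
- exact/hom_of_hom/hom_in.
apply/ffunP => q.
have := congr1 (fun h : 'Hom(M, M') =>
  (h (delta k (rep q).1) : {ffun 'I_m.+1 -> k^o}) (rep q).2) u0.
rewrite zero_lfunE hom_of_delta !ffunE /cof (big_pred1 q) // => q' /=.
by apply/idP/eqP => [in'|->]; [apply: uniq_in in' (in_rep q) | apply: in_rep].
Qed.

End CoefficientFunctions.

(** ** Matching two walks *)

Section Diagonals.
Variables (B : bquiver) (C : word B) (gD : arr B -> nat -> nat -> bool).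
Hypothesis strC : is_string C.
Hypotheses
  (gd_fun : forall a i j j', gD a i j -> gD a i j' -> j = j')
  (gd_inj : forall a i i' j, gD a i j -> gD a i' j -> i = i')
  (gd_arr : forall a b i j, gD a i j -> gD b i j -> a = b)
  (gd_anti : forall a b i j, gD a i j -> ~~ gD b j i)
  (gd_adj : forall a i j, gD a i j -> j = i.+1 \/ i = j.+1).

(** A node [(i, j)] stands for the matrix coefficient from [z_i] to [z_j]; nodes joined
    by an edge carry equal coefficients. *)
Definition edge (i j i' j' : nat) : Prop :=
  exists x, go C x i i' /\ gD x j j' \/ go C x i' i /\ gD x j' j.

Definition matched (a b L : nat) : Prop :=
  forall t, (t < L)%N -> edge (a + t) (b + t) (a + t).+1 (b + t).+1.

Definition quot_ends (a1 a2 : nat) : Prop :=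
  (forall x, (0 < a1)%N -> ~~ go C x a1.-1 a1) /\ (forall x, ~~ go C x a2.+1 a2).

Definition sub_ends (b1 b2 : nat) : Prop :=
  (forall x, (0 < b1)%N -> ~~ gD x b1 b1.-1) /\ (forall x, ~~ gD x b2 b2.+1).

Definition on_diag (a b L i j : nat) : bool := (a <= i <= a + L)%N && (i + b == j + a)%N.

Lemma edge_sym i j i' j' : edge i j i' j' -> edge i' j' i j.
Proof. by case=> x [[g g']|[g g']]; exists x; [right | left]. Qed.

Lemma edge_inj i j i' i'' j' : edge i j i' j' -> edge i j i'' j' -> i' = i''.
Proof.
case=> x [[g gd]|[g gd]] [y [[g' gd']|[g' gd']]].
- by rewrite -(gd_arr gd gd') in g'; apply: (go_fun strC g g').
- by have := gd_anti y gd; rewrite gd'.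
- by have := gd_anti y gd; rewrite gd'.
by rewrite -(gd_arr gd gd') in g'; apply: (go_inj strC g g').
Qed.

Lemma edge_fun i j i' j' j'' : edge i j i' j' -> edge i j i' j'' -> j' = j''.
Proof.
case=> x [[g gd]|[g gd]] [y [[g' gd']|[g' gd']]].
- by rewrite -(go_arr strC g g') in gd'; apply: gd_fun gd gd'.
- by have := go_anti strC y g; rewrite g'.
- by have := go_anti strC y g; rewrite g'.
by rewrite -(go_arr strC g g') in gd'; apply: gd_inj gd gd'.
Qed.

Lemma edge_adj i j i' j' : edge i j i' j' ->
  (i' = i.+1 \/ i = i'.+1) /\ (j' = j.+1 \/ j = j'.+1).
Proof.
case=> x [[g gd]|[g gd]]; have := go_adj g; have := gd_adj gd; tauto.
Qed.

Lemma edge_le i j i' j' : edge i j i' j' -> (i <= wlen C)%N /\ (i' <= wlen C)%N.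
Proof. by case=> x [[g _]|[g _]]; have [] := go_le strC g. Qed.

Lemma matched_next a b L i j : matched a b L -> on_diag a b L i j -> (i < a + L)%N ->
  edge i j i.+1 j.+1.
Proof.
move=> mt /andP[/andP[ai _] /eqP e] lt_i; have /mt : (i - a < L)%N by lia.
have -> : (a + (i - a) = i)%N by lia.
by have -> : (b + (i - a) = j)%N by lia.
Qed.

Lemma matched_prev a b L i j : matched a b L -> on_diag a b L i j -> (a < i)%N ->
  exists j0, j = j0.+1 /\ edge i.-1 j0 i j0.+1.
Proof.
move=> mt /andP[/andP[_ iL] /eqP e] lt_a; exists j.-1; split; first by lia.
have /mt : (i.-1 - a < L)%N by lia.
have -> : (a + (i.-1 - a) = i.-1)%N by lia.
have -> : (b + (i.-1 - a) = j.-1)%N by lia.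
by rewrite prednK //; lia.
Qed.

(** Inside a matched stretch the arrows of one walk are matched by the other; at its
    ends there are none in the relevant direction, because it is a quotient of the
    first walk and a submodule of the second. *)
Lemma diag_in a b L i j x i' : matched a b L -> quot_ends a (a + L) ->
  on_diag a b L i j -> go C x i' i -> exists j', gD x j' j /\ on_diag a b L i' j'.
Proof.
move=> mt [q1 q2] on_ij g; have /andP[/andP[le_a le_L] /eqP e] := on_ij.
have [ei|ei] := go_adj g.
  have [lt_a|ge_a] := ltnP a i; last first.
    have ea : a = i'.+1 by lia.
    by have := q1 x; rewrite ea /= => /(_ isT); rewrite -ei g.
  have [j0 [ej [y [[gy dy]|[gy dy]]]]] := matched_prev mt on_ij lt_a.
    have ei' : i.-1 = i' by lia.
    rewrite ei' in gy; exists j0; split; first by rewrite (go_arr strC g gy) ej.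
    by rewrite /on_diag; lia.
  have ei' : i.-1 = i' by lia.
  by rewrite ei' in gy; have := go_anti strC y g; rewrite gy.
subst i'; have [lt_L|ge_L] := ltnP i (a + L); last first.
  have ei : i = (a + L)%N by lia.
  by rewrite ei in g; have := q2 x; rewrite g.
have [y [[gy dy]|[gy dy]]] := matched_next mt on_ij lt_L.
  by have := go_anti strC y g; rewrite gy.
exists j.+1; split; first by rewrite (go_arr strC g gy).
by rewrite /on_diag; lia.
Qed.

Lemma diag_out a b L i j x j' : matched a b L -> sub_ends b (b + L) ->
  on_diag a b L i j -> gD x j j' -> exists i', go C x i i' /\ on_diag a b L i' j'.
Proof.
move=> mt [q1 q2] on_ij g; have /andP[/andP[le_a le_L] /eqP e] := on_ij.
have [ej|ej] := gd_adj g.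
  subst j'; have [lt_L|ge_L] := ltnP i (a + L); last first.
    have ej : j = (b + L)%N by lia.
    by rewrite ej in g; have := q2 x; rewrite g.
  have [y [[gy dy]|[gy dy]]] := matched_next mt on_ij lt_L.
    exists i.+1; split; first by rewrite (gd_arr g dy).
    by rewrite /on_diag; lia.
  by have := gd_anti y g; rewrite dy.
have [lt_a|ge_a] := ltnP a i; last first.
  have eb : b = j'.+1 by lia.
  by have := q1 x; rewrite eb /= => /(_ isT); rewrite -ej g.
have [j0 [ej0 [y [[gy dy]|[gy dy]]]]] := matched_prev mt on_ij lt_a.
  have ej' : j0 = j' by lia.
  by rewrite ej' -ej in dy; have := gd_anti y g; rewrite dy.
have ej' : j0 = j' by lia.
rewrite ej' -ej in dy; exists i.-1; split; first by rewrite (gd_arr g dy).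
by rewrite /on_diag; lia.
Qed.

Lemma right_extension i j : exists r,
  matched i j r /\ ~ edge (i + r) (j + r) (i + r).+1 (j + r).+1.
Proof.
have [d] := ubnP (wlen C - i); elim: d => // d IH in i j *; move=> lt_d.
have [e|ne] := excluded_middle_informative (edge i j i.+1 j.+1); last first.
  by exists 0%N; rewrite !addn0.
have [_ le_i] := edge_le e.
have [|r [mt stop]] := IH i.+1 j.+1; first by lia.
exists r.+1; split; last by rewrite !addnS -!addSn.
case=> [|t] lt_t; first by rewrite !addn0.
by rewrite !addnS -!addSn; apply: mt.
Qed.

Lemma left_extension i j : exists l, [/\ (l <= i)%N, (l <= j)%N, matched (i - l) (j - l) l
  & (l < i)%N -> (l < j)%N -> ~ edge (i - l).-1 (j - l).-1 (i - l) (j - l)].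
Proof.
elim: i j => [|i IH] j; first by exists 0%N; split.
case: j => [|j]; first by exists 0%N; split.
have [e|ne] := excluded_middle_informative (edge i j i.+1 j.+1); last first.
  by exists 0%N; split; rewrite ?subn0.
have [l [le_i le_j mt stop]] := IH j; exists l.+1; split; rewrite ?subSS //.
move=> t; rewrite ltnS leq_eqVlt => /orP[/eqP->|]; last exact: mt.
by rewrite !subnK.
Qed.

(** Extend the match through [(i, j)] as far as possible on both sides. The result is
    closed under edges, with one exception: a single node may have an edge along the
    opposite diagonal. *)
Lemma maximal_diag i j : exists a b L, [/\ on_diag a b L i j, matched a b L,
    forall i' j', edge i j i' j' -> (i' + j = j' + i)%N -> (0 < L)%N
  & (0 < L)%N \/ (forall i' j', ~ edge i j i' j') ->
    forall i1 j1 i2 j2, on_diag a b L i1 j1 -> edge i1 j1 i2 j2 -> on_diag a b L i2 j2].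
Proof.
have [r [mtr stopr]] := right_extension i j.
have [l [le_i le_j mtl stopl]] := left_extension i j.
exists (i - l)%N, (j - l)%N, (l + r)%N; have mt : matched (i - l) (j - l) (l + r).
  move=> t lt_t; have [lt_l|ge_l] := ltnP t l; first exact: mtl.
  have /mtr : (t - l < r)%N by lia.
  have -> : (i + (t - l) = i - l + t)%N by lia.
  by have -> : (j + (t - l) = j - l + t)%N by lia.
split=> //; first by rewrite /on_diag; lia.
  move=> i' j' e eq_d; rewrite lt0n; apply/eqP => lr0.
  have [[ei|ei] _] := edge_adj e.
    case: stopr; rewrite (_ : r = 0%N) ?addn0; last by lia.
    by rewrite -ei (_ : j.+1 = j') //; lia.
  have l0 : l = 0%N by lia.
  move: stopl; rewrite l0 !subn0; case; [lia|lia|].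
  by apply: edge_sym; rewrite ei /= (_ : j.-1 = j'); [rewrite -ei | lia].
move=> lazy i1 j1 i2 j2 on1 e; have /andP[/andP[le1 le2] /eqP eq1] := on1.
have L0 : (0 < l + r)%N.
  case: lazy => // none; rewrite lt0n; apply/eqP => lr0.
  have i1E : i1 = i by lia.
  have j1E : j1 = j by lia.
  by rewrite i1E j1E in e; case: (none _ _ e).
have [[ei|ei] adj_j] := edge_adj e.
  subst i2; have [lt_i1|ge_i1] := ltnP i1 (i - l + (l + r)).
    have e' := matched_next mt on1 lt_i1.
    by rewrite (edge_fun e e') /on_diag; lia.
  have i1E : i1 = (i + r)%N by lia.
  have j1E : j1 = (j + r)%N by lia.
  case: adj_j => [ej|ej]; first by subst; case: stopr.
  have [|j0 [ej0 e']] := matched_prev mt on1; first by lia.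
  have ej2 : j2 = j0 by lia.
  rewrite -ej0 -ej2 in e'; have := edge_inj e (edge_sym e'); lia.
have [lt_i1|ge_i1] := ltnP (i - l) i1.
  have [j0 [ej0 e']] := matched_prev mt on1 lt_i1.
  have ei2 : i2 = i1.-1 by lia.
  rewrite -ej0 -ei2 in e'; rewrite (edge_fun e (edge_sym e')) /on_diag; lia.
have i1E : i1 = (i - l)%N by lia.
have j1E : j1 = (j - l)%N by lia.
case: adj_j => [ej|ej].
  have e' : edge i1 j1 i1.+1 j2 by rewrite ej; apply: (matched_next mt on1); lia.
  by have := edge_inj e e'; lia.
exfalso; apply: stopl; [by lia | by lia |].
have <- : i2 = (i - l).-1 by lia.
have <- : j2 = (j - l).-1 by lia.
by rewrite -i1E -j1E; apply: edge_sym.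
Qed.

End Diagonals.

(** ** Graph maps *)

Definition lastl (T : Type) (s : seq T) (i : nat) : option T :=
  if i is i'.+1 then onth s i' else None.

(** Quotient and submodule factorizations, given by the two cutting positions. *)
Definition quot_at (Q : quiver) (C : word Q) (a1 a2 : nat) : bool :=
  (if lastl C.2 a1 is Some l then ~~ l.2 else true)
  && (if onth C.2 a2 is Some l then l.2 else true).

Definition sub_at (Q : quiver) (C : word Q) (b1 b2 : nat) : bool :=
  (if lastl C.2 b1 is Some l then l.2 else true)
  && (if onth C.2 b2 is Some l then ~~ l.2 else true).

Definition agree (Q : quiver) (C C' : word Q) (a1 a2 b1 b2 : nat) : bool :=
  (subword C' b1 b2 == subword C a1 a2) || (subword C' b1 b2 == winv (subword C a1 a2)).

Definition graph_map (Q : quiver) (C C' : word Q) (a1 a2 b1 b2 : nat) : bool :=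
  [&& (a1 <= a2)%N, (b1 <= b2)%N, quot_at C a1 a2, sub_at C' b1 b2 & agree C C' a1 a2 b1 b2].

Lemma onth_take_drop (T : Type) (s : seq T) a L t :
  onth (take L (drop a s)) t = if (t < L)%N then onth s (a + t) else None.
Proof.
rewrite !onthE map_take map_drop; case: ltnP => h; first by rewrite nth_take // nth_drop.
by rewrite nth_default // size_take_min geq_min h.
Qed.

Lemma size_take_drop (T : Type) (s : seq T) a1 a2 : (a1 <= a2 <= size s)%N ->
  size (take (a2 - a1) (drop a1 s)) = (a2 - a1)%N.
Proof. by case/andP=> _ le_a2; rewrite size_takel // size_drop leq_sub2r. Qed.

Lemma onth_rev_map (T T' : Type) (f : T -> T') (s : seq T) t : (t < size s)%N ->
  onth (rev (map f s)) t = omap f (onth s (size s - t.+1)).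
Proof.
by move=> lt_t; rewrite [LHS]onthE map_rev nth_rev !size_map // -onthE onth_map.
Qed.

(** In the middle there would be a letter equal to its inverse, or followed by it. *)
Lemma no_palindrome (B : bquiver) (s : seq (letter B)) :
  sorted (@string_step B) s -> s = rev (map (@linv B) s) -> s = [::].
Proof.
move=> sorted_s pal; case: s sorted_s pal => // l0 s0; set s := l0 :: s0 => sorted_s pal.
have pt t : (t < size s)%N -> nth l0 s t = linv (nth l0 s (size s - t.+1)).
  by move=> lt_t; rewrite {1}pal nth_rev size_map // (nth_map l0) //; lia.
have [odd_s|even_s] := boolP (odd (size s)).
  have e : (size s - (size s)./2.+1 = (size s)./2)%N.
    by have := odd_double_half (size s); rewrite odd_s -addnn; lia.
  have lt_h : ((size s)./2 < size s)%N by rewrite /s /=; lia.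
  have := congr1 snd (pt _ lt_h); rewrite e /linv /=.
  by case: (nth _ _ _).2.
have eh : (size s = (size s)./2 + (size s)./2)%N.
  by have := odd_double_half (size s); rewrite (negPf even_s) -addnn; lia.
have lt_h : ((size s)./2.-1.+1 < size s)%N.
  have : (0 < size s)%N by [].
  by lia.
have /(sortedP l0)/(_ _ lt_h)/and3P[_ /eqP] := sorted_s.
case; rewrite (pt _ lt_h); congr (linv (nth l0 s _)).
have : (0 < size s)%N by [].
by lia.
Qed.

Section Walks.
Variables (B : bquiver) (C' : word B).
Hypothesis strC' : is_string C'.
Local Notation m := (wlen C').

(** For [s = false] this is the walk along the inverse string. The common substring of
    a graph map may be traversed in opposite directions, and is then a diagonal for
    the reversed walk. *)
Definition walk (s : bool) (x : arr B) (i j : nat) : bool :=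
  if s then go C' x i j else [&& (i <= m)%N, (j <= m)%N & go C' x (m - i) (m - j)].
Definition pos (s : bool) (j : nat) : nat := if s then j else (m - j)%N.

Lemma walk_fun s a i j j' : walk s a i j -> walk s a i j' -> j = j'.
Proof.
case: s => [|/and3P[_ le_j g] /and3P[_ le_j' g']]; first exact: (go_fun strC').
by have := go_fun strC' g g'; lia.
Qed.

Lemma walk_inj s a i i' j : walk s a i j -> walk s a i' j -> i = i'.
Proof.
case: s => [|/and3P[le_i _ g] /and3P[le_i' _ g']]; first exact: (go_inj strC').
by have := go_inj strC' g g'; lia.
Qed.

Lemma walk_arr s a b i j : walk s a i j -> walk s b i j -> a = b.
Proof.
case: s => [|/and3P[_ _ g] /and3P[_ _ g']]; first exact: (go_arr strC').
exact: (go_arr strC' g g').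
Qed.

Lemma walk_anti s a b i j : walk s a i j -> ~~ walk s b j i.
Proof.
case: s => [|/and3P[_ _ g]]; first exact: (go_anti strC').
by rewrite /= !negb_and (go_anti strC' _ g) !orbT.
Qed.

Lemma walk_adj s a i j : walk s a i j -> j = i.+1 \/ i = j.+1.
Proof.
case: s => [|/and3P[le_i le_j g]]; first exact: go_adj.
by have := go_adj g; lia.
Qed.

Lemma walk_pos s x i j : (i <= m)%N -> (j <= m)%N -> walk s x (pos s i) (pos s j) = go C' x i j.
Proof. by case: s => //= le_i le_j; rewrite !leq_subr !subKn. Qed.

Lemma walk_go s x i j : walk s x i j ->
  [/\ (i <= m)%N, (j <= m)%N & go C' x (pos s i) (pos s j)].
Proof.
case: s => [g|/and3P[-> -> ->] //].
by have [le_i le_j] := go_le strC' g.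
Qed.

Lemma pos_le s j : (j <= m)%N -> (pos s j <= m)%N.
Proof. by case: s => //= _; rewrite leq_subr. Qed.

Lemma posK s j : (j <= m)%N -> pos s (pos s j) = j.
Proof. by case: s => //= le_j; rewrite subKn. Qed.

End Walks.

Section GraphMaps.
Variables (B : bquiver) (C C' : word B).
Hypotheses (strC : is_string C) (strC' : is_string C').
Local Notation n := (wlen C).
Local Notation m := (wlen C').
Local Notation walk := (walk C').
Local Notation pos := (pos C').
Local Notation edge_ s := (edge C (walk s)).
Local Notation matched_ s := (matched C (walk s)).

Lemma edge_vtx s i j i' j' : edge_ s i j i' j' ->
  wvtx C i = wvtx C' (pos s j) /\ wvtx C i' = wvtx C' (pos s j').
Proof.
case=> x [[g /(walk_go strC')[_ _ g']]|[g /(walk_go strC')[_ _ g']]];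
  have [-> ->] := go_vtx strC g; by have [-> ->] := go_vtx strC' g'.
Qed.

Lemma edge_pos s i j i' j' : edge_ s i j i' j' -> (j <= m)%N /\ (j' <= m)%N.
Proof. by case=> x [[_ /(walk_go strC')[-> ->]]|[_ /(walk_go strC')[-> ->]]]. Qed.

Lemma edge_flip s s' i j i' j' : edge_ s i j i' j' ->
  edge_ s' i (pos s' (pos s j)) i' (pos s' (pos s j')).
Proof.
case=> x [[g /(walk_go strC')[le_j le_j' g']]|[g /(walk_go strC')[le_j le_j' g']]]; exists x; [left|right];
  by split=> //; rewrite walk_pos ?pos_le.
Qed.

Lemma edge_up i j : edge_ true i j i.+1 j.+1 <->
  exists l, onth C.2 i = Some l /\ onth C'.2 j = Some l.
Proof.
split=> [[x [[/goP g /goP g']|[/goP g /goP g']]]|[[x []] [h h']]].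
- case: g => [_ h|]; last lia; case: g' => [_ h'|]; last lia.
  by exists (x, true).
- case: g => [|_ h]; first lia; case: g' => [|_ h']; first lia.
  by exists (x, false).
- by exists x; left; split; apply/goP; apply: GoUp.
by exists x; right; split; apply/goP; apply: GoDown.
Qed.

Lemma edge_down i j : edge_ false i j i.+1 j.+1 <->
  (j < m)%N /\ exists l, onth C.2 i = Some l /\ onth C'.2 (m - j.+1) = Some (linv l).
Proof.
split=> [[x [[g /and3P[_ lt_j g']]|[g /and3P[lt_j _ g']]]]|[lt_j [[x []] [h h']]]].
- split=> //; exists (x, true); case/goP: g => [_ h|]; last lia.
  by case/goP: g' => [|_ h']; first lia.
- split=> //; exists (x, false); case/goP: g => [|_ h]; first lia.
  by case/goP: g' => [_ h'|]; last lia.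
- exists x; left; split; first by apply/goP; apply: GoUp.
  by rewrite /= lt_j ltnW //=; apply/goP; apply: GoDown => //; lia.
exists x; right; split; first by apply/goP; apply: GoDown.
by rewrite /= lt_j ltnW //=; apply/goP; apply: GoUp => //; lia.
Qed.

Lemma wtgt_subword (a1 a2 : nat) : (a1 <= a2)%N -> wtgt (subword C a1 a2) = wvtx C a2.
Proof.
move=> le_a; rewrite /wtgt /wlen /wvtx /= take_size -[in RHS](subnKC le_a) takeD.
by rewrite map_cat last_cat.
Qed.

Lemma agree_plus a1 a2 b1 b2 : (a1 <= a2 <= n)%N -> (b1 <= b2 <= m)%N ->
  (subword C' b1 b2 == subword C a1 a2) <->
  [/\ (a2 - a1 = b2 - b1)%N, wvtx C a1 = wvtx C' b1 & matched_ true a1 b1 (a2 - a1)].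
Proof.
move=> le_a le_b; split=> [/eqP[ev es]|[eL ev mt]].
  have eL : (a2 - a1 = b2 - b1)%N.
    by have := congr1 size es; rewrite !size_take_drop.
  split=> // t lt_t; apply/edge_up; have := congr1 (fun u => onth u t) es.
  rewrite !onth_take_drop -eL lt_t.
  have : onth C.2 (a1 + t) by rewrite onthTE; rewrite /wlen in le_a; lia.
  by case: onth => // l _ ->; exists l.
apply/eqP; rewrite /subword ev -eL; congr (_, _); apply: eq_from_onth => t.
rewrite !onth_take_drop; case: ltnP => // lt_t.
by have /edge_up[l [-> ->]] := mt t lt_t.
Qed.

Lemma agree_minus a1 a2 b1 b2 : (a1 <= a2 <= n)%N -> (b1 <= b2 <= m)%N ->
  (subword C' b1 b2 == winv (subword C a1 a2)) <->
  [/\ (a2 - a1 = b2 - b1)%N, wvtx C a1 = wvtx C' b2 & matched_ false a1 (m - b2) (a2 - a1)].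
Proof.
move=> le_a le_b.
have size_C := size_take_drop le_a.
have vtx_match L : (a2 - a1 = b2 - b1)%N -> (L = a2 - a1)%N ->
    matched_ false a1 (m - b2) L ->
    (wvtx C a1 = wvtx C' b2) <-> (wvtx C' b1 = wvtx C a2).
  case: L => [|L] eab eL mt.
    have -> : a2 = a1 by lia.
    have -> : b2 = b1 by lia.
    by split.
  have [v1 _] := edge_vtx (mt 0%N isT).
  have [_ v2] := edge_vtx (mt L (ltnSn L)).
  move: v1 v2; rewrite /pos !addn0.
  have -> : (m - (m - b2) = b2)%N by lia.
  have -> : (a1 + L).+1 = a2 by lia.
  have -> : (m - (m - b2 + L).+1 = b1)%N by lia.
  by move=> -> ->.
split=> [/eqP[ev es]|[eL ev mt]].
  have eL : (a2 - a1 = b2 - b1)%N.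
    by have := congr1 size es; rewrite size_rev size_map size_C size_take_drop.
  have mt : matched_ false a1 (m - b2) (a2 - a1).
    move=> t lt_t; apply/edge_down; split; first by lia.
    have := congr1 (fun u => onth u (a2 - a1 - t.+1)%N) es.
    rewrite onth_take_drop -eL (_ : (_ - _ - _ < _)%N); last by lia.
    rewrite onth_rev_map size_C; last by lia.
    rewrite onth_take_drop (_ : (_ - _ < _)%N); last by lia.
    have -> : (b1 + (a2 - a1 - t.+1) = m - (m - b2 + t).+1)%N by lia.
    have -> : (a2 - a1 - (a2 - a1 - t.+1).+1 = t)%N by lia.
    have : onth C.2 (a1 + t) by rewrite onthTE; rewrite /wlen in le_a; lia.
    by case: onth => // l _ /= ->; exists l.
  split=> //; apply/(vtx_match _ eL erefl mt).
  by rewrite ev wtgt_subword //; case/andP: le_a.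
have /(vtx_match _ eL erefl mt) ev' := ev.
apply/eqP; rewrite /winv wtgt_subword; last by case/andP: le_a.
rewrite {1}/subword ev' -eL; congr (_, _); apply: eq_from_onth => t.
rewrite onth_take_drop; case: ltnP => lt_t; last first.
  by rewrite onth_default // size_rev size_map size_C.
rewrite onth_rev_map size_C // onth_take_drop (_ : (_ - _ < _)%N); last by lia.
have [|_ [l [hl hl']]] := (iffLR (edge_down _ _)) (mt (a2 - a1 - t.+1)%N _); first by lia.
rewrite hl /= -hl'; congr onth; lia.
Qed.

End GraphMaps.

(** ** Graph maps form a basis *)

Section GraphMapBasis.
Variables (B : bquiver) (C C' : word B).
Hypotheses (strC : is_string C) (strC' : is_string C').
Local Notation n := (wlen C).
Local Notation m := (wlen C').
Local Notation walk := (walk C').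
Local Notation pos := (pos C').
Local Notation edge_ s := (edge C (walk s)).
Local Notation matched_ s := (matched C (walk s)).

Lemma go_up (Q : quiver) (D : word Q) x i : go D x i i.+1 = (onth D.2 i == Some (x, true)).
Proof.
rewrite /go eqxx /=; case: (i =P i.+2) => [|_]; first lia.
by rewrite /= orbF.
Qed.

Lemma go_down (Q : quiver) (D : word Q) x i : go D x i.+1 i = (onth D.2 i == Some (x, false)).
Proof. by rewrite /go eqxx /=; case: (i =P i.+2) => [|_]; first lia. Qed.

Lemma quot_atP a1 a2 : quot_at C a1 a2 <-> quot_ends C a1 a2.
Proof.
split=> [/andP[q1 q2]|[q1 q2]].
  split=> [x|x]; last by rewrite go_down; case: onth q2 => // l q2; apply/negP => /eqP[el]; subst l.
  case: a1 q1 => //= a1 q1 _; rewrite go_up; case: onth q1 => // l q1.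
  by apply/negP => /eqP[el]; subst l.
apply/andP; split.
  case: a1 q1 => //= a1 q1; case el: onth => [[x []]|] //=.
  by have := q1 x isT; rewrite go_up el eqxx.
by case el: onth => [[x []]|] //=; have := q2 x; rewrite go_down el eqxx.
Qed.

Lemma sub_atP b1 b2 : sub_at C' b1 b2 <-> sub_ends (walk true) b1 b2.
Proof.
split=> [/andP[q1 q2]|[q1 q2]].
  split=> [x|x]; last first.
    by rewrite /= go_up; case: onth q2 => // l q2; apply/negP => /eqP[el]; subst l.
  case: b1 q1 => //= b1 q1 _; rewrite go_down; case: onth q1 => // l q1.
  by apply/negP => /eqP[el]; subst l.
apply/andP; split.
  case: b1 q1 => //= b1 q1; case el: onth => [[x []]|] //=.
  by have := q1 x isT; rewrite /= go_down el eqxx.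
by case el: onth => [[x []]|] //=; have := q2 x; rewrite /= go_up el eqxx.
Qed.

(** Reversing the walk exchanges the two ends. *)
Lemma sub_ends_flip b1 b2 : (b1 <= b2 <= m)%N ->
  sub_ends (walk false) (m - b2) (m - b1) <-> sub_ends (walk true) b1 b2.
Proof.
move=> /andP[le_b le_m]; split=> -[q1 q2]; split=> x.
- move=> b1_gt0; have := q2 x; rewrite /= leq_subr (_ : _ < _)%N; last by lia.
  have -> : (m - (m - b1) = b1)%N by lia.
  by have -> : (m - (m - b1).+1 = b1.-1)%N by lia.
- apply/negP => g; have [_ lt_b2] := go_le strC' g.
  have := q1 x; rewrite /= leq_subr (_ : (m - b2).-1 <= m)%N; last by lia.
  have -> : (m - (m - b2) = b2)%N by lia.
  have -> : (m - (m - b2).-1 = b2.+1)%N by lia.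
  by move: g => /= -> /(_ _)/negP; case; lia.
- move=> lt_b2; have := q2 x; rewrite /= leq_subr (_ : (m - b2).-1 <= m)%N; last by lia.
  have -> : (m - (m - b2) = b2)%N by lia.
  by have -> : (m - (m - b2).-1 = b2.+1)%N by lia.
apply/negP => /and3P[_ lt_b1]; have -> : (m - (m - b1) = b1)%N by lia.
have -> : (m - (m - b1).+1 = b1.-1)%N by lia.
by move=> g; have := q1 x; rewrite /= g => /(_ _)/negP; case; lia.
Qed.

Definition in_seg (s : bool) (a b L i j : nat) : bool :=
  (j <= m)%N && on_diag a b L i (pos s j).

(** A graph map as a stretch of a diagonal: [s] tells whether the two strings traverse
    the common substring in the same direction. *)
Record segment (s : bool) (a b L : nat) : Prop := Segment {
  seg_le : (a + L <= n)%N;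
  seg_le' : (b + L <= m)%N;
  seg_match : matched_ s a b L;
  seg_quot : quot_ends C a (a + L);
  seg_sub : sub_ends (walk s) b (b + L);
  seg_vtx : wvtx C a = wvtx C' (pos s b) }.

Lemma in_seg_first s a b L : (b <= m)%N -> in_seg s a b L a (pos s b).
Proof. by move=> le_b; rewrite /in_seg /on_diag pos_le // posK //; lia. Qed.

Lemma in_seg_last s a b L : (b + L <= m)%N -> in_seg s a b L (a + L) (pos s (b + L)).
Proof. by move=> le_b; rewrite /in_seg /on_diag pos_le // posK //; lia. Qed.

(** A matched stretch is connected. *)
Lemma matched_ind s a b L (P : nat -> nat -> Prop) :
  matched_ s a b L ->
  (forall x i i' j j', go C x i i' -> go C' x j j' -> P i j <-> P i' j') ->
  forall i j i' j', in_seg s a b L i j -> in_seg s a b L i' j' -> P i j -> P i' j'.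
Proof.
move=> mt step; suff base i j : in_seg s a b L i j -> P i j <-> P a (pos s b).
  by move=> i j i' j' /base e /base e'; rewrite e e'.
have key t : (t <= L)%N -> P (a + t)%N (pos s (b + t)) <-> P a (pos s b).
  elim: t => [|t IH] lt_t; first by rewrite !addn0.
  rewrite -IH; last by lia.
  rewrite !addnS; have [x [[g /(walk_go strC')[_ _ g']]|[g /(walk_go strC')[_ _ g']]]] := mt t lt_t.
    by apply: iff_sym; apply: step g g'.
  by apply: step g g'.
case/andP=> le_j /andP[/andP[le_a le_L] /eqP e].
rewrite -(key (i - a)%N); last by lia.
have -> : (a + (i - a) = i)%N by lia.
have -> : (b + (i - a) = pos s j)%N by lia.
by rewrite posK.
Qed.

Section OneSegment.
Variables (s : bool) (a b L : nat).
Hypothesis seg : segment s a b L.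

Lemma seg_in x i' i j : in_seg s a b L i j -> go C x i' i ->
  exists j', go C' x j' j /\ in_seg s a b L i' j'.
Proof.
move=> /andP[le_j on_ij] g.
have [j' [/(walk_go strC')[le_j' _ g'] on_ij']] :=
  diag_in strC (seg_match seg) (seg_quot seg) on_ij g.
exists (pos s j'); rewrite posK // in g'; split=> //.
by rewrite /in_seg pos_le // posK.
Qed.

Lemma seg_out x i j j' : in_seg s a b L i j -> go C' x j j' ->
  exists i', go C x i i' /\ in_seg s a b L i' j'.
Proof.
move=> /andP[le_j on_ij] g; have [_ le_j'] := go_le strC' g.
rewrite -(walk_pos s x le_j le_j') in g.
have [i' [g' on_ij']] := @diag_out _ _ _ strC (@walk_arr _ _ strC' s)
  (@walk_anti _ _ strC' s) (@walk_adj _ _ strC' s) _ _ _ _ _ _ _ (seg_match seg) (seg_sub seg) on_ij g.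
by exists i'; rewrite /in_seg le_j'.
Qed.

Lemma seg_step x i i' j j' : go C x i i' -> go C' x j j' ->
  in_seg s a b L i j = in_seg s a b L i' j'.
Proof.
move=> g g'; apply/idP/idP => [/seg_out/(_ g')[i'' [gi]]|/seg_in/(_ g)[j'' [gj]]].
  by rewrite (go_fun strC g gi).
by rewrite (go_inj strC' g' gj).
Qed.

Lemma in_seg_vtx i j : in_seg s a b L i j -> wvtx C i = wvtx C' j.
Proof.
move=> in_ij; apply: (matched_ind (P := fun i j => wvtx C i = wvtx C' j) (seg_match seg))
  in_ij (seg_vtx seg) => [x i0 i' j0 j' g g'|].
  by have [-> ->] := go_vtx strC g; have [-> ->] := go_vtx strC' g'.
by apply: in_seg_first; have := seg_le' seg; lia.
Qed.

End OneSegment.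

(** Both segments are the connected component of the common node. *)
Lemma in_seg_sub s a b L s' a' b' L' i j i1 j1 :
  segment s a b L -> segment s' a' b' L' ->
  in_seg s a b L i j -> in_seg s' a' b' L' i j ->
  in_seg s a b L i1 j1 -> in_seg s' a' b' L' i1 j1.
Proof.
move=> seg seg' in1 in2 in1'.
apply: (matched_ind (P := fun i j => in_seg s' a' b' L' i j) (seg_match seg)) in1 in1' in2.
by move=> x i0 i' j0 j' g g'; rewrite (seg_step seg' g g').
Qed.

(** The direction is lost only for a single node, which is a lazy substring. *)
Lemma segment_uniq s a b L s' a' b' L' i j :
  segment s a b L -> segment s' a' b' L' ->
  in_seg s a b L i j -> in_seg s' a' b' L' i j ->
  [/\ a = a', L = L' & b' = pos s' (pos s b) /\ (s = s' \/ L = 0%N)].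
Proof.
move=> seg seg' in1 in2; have le1 := seg_le' seg; have le2 := seg_le' seg'.
have le_b : (b <= m)%N by lia.
have le_b' : (b' <= m)%N by lia.
have := in_seg_sub seg seg' in1 in2 (in_seg_first s a L le_b).
have := in_seg_sub seg seg' in1 in2 (in_seg_last s a le1).
have := in_seg_sub seg' seg in2 in1 (in_seg_first s' a' L' le_b').
have := in_seg_sub seg' seg in2 in1 (in_seg_last s' a' le2).
rewrite /in_seg /on_diag; case: s s' {in1 in2 seg seg'} => -[] /=; split; try split; try lia;
  by [left | right; lia].
Qed.

(** [lo] and [hi] recover the cutting positions of the second string from a segment;
    [base] is where the segment of given cutting positions starts. *)
Definition lo (s : bool) (b L : nat) : nat := if s then b else (m - (b + L))%N.
Definition hi (s : bool) (b L : nat) : nat := if s then (b + L)%N else (m - b)%N.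
Definition base (s : bool) (b1 b2 : nat) : nat := if s then b1 else (m - b2)%N.
Definition same_dir (a1 a2 b1 b2 : nat) : bool := subword C' b1 b2 == subword C a1 a2.

Lemma graph_map_segment a1 a2 b1 b2 : (a2 <= n)%N -> (b2 <= m)%N ->
  graph_map C C' a1 a2 b1 b2 ->
  segment (same_dir a1 a2 b1 b2) a1 (base (same_dir a1 a2 b1 b2) b1 b2) (a2 - a1) /\
  (a1 <= a2)%N /\ (a2 - a1 = b2 - b1)%N /\ (b1 <= b2)%N.
Proof.
move=> le_a2 le_b2 /and5P[le_a le_b /quot_atP quot /sub_atP sub agr].
have le_a12 : (a1 <= a2 <= n)%N by rewrite le_a.
have le_b12 : (b1 <= b2 <= m)%N by rewrite le_b.
have quot' : quot_ends C a1 (a1 + (a2 - a1)) by rewrite subnKC.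
case/orP: agr => agr; rewrite /same_dir.
  rewrite agr; have [eL ev mt] := (iffLR (agree_plus strC strC' le_a12 le_b12)) agr.
  split; last by [].
  split=> //=; rewrite ?subnKC //; first by lia.
  by rewrite eL subnKC.
case: (boolP (_ == _)) => [agr'|_].
  have [eL ev mt] := (iffLR (agree_plus strC strC' le_a12 le_b12)) agr'.
  split; last by [].
  split=> //=; rewrite ?subnKC //; first by lia.
  by rewrite eL subnKC.
have [eL ev mt] := (iffLR (agree_minus strC strC' le_a12 le_b12)) agr.
split; last by [].
split=> //=; rewrite ?subnKC //; first by lia.
  have -> : (m - b2 + (a2 - a1) = m - b1)%N by lia.
  exact/sub_ends_flip.
by rewrite subKn.
Qed.

Lemma segment_graph_map s a b L : segment s a b L ->
  graph_map C C' a (a + L) (lo s b L) (hi s b L).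
Proof.
case=> le_a le_b mt /quot_atP quot sub ev.
apply/and5P; split=> //; first by lia.
- by case: s {mt sub ev} => /=; lia.
- apply/sub_atP; case: s {mt ev} sub => //= sub; apply/sub_ends_flip; first by lia.
  have -> : (m - (m - b) = b)%N by lia.
  by have -> : (m - (m - (b + L)) = b + L)%N by lia.
apply/orP; have eL : (a + L - a = L)%N by lia.
case: s mt {sub} ev => /= mt ev; [left | right].
  by apply/(agree_plus strC strC'); rewrite ?eL; try lia; split=> //; lia.
apply/(agree_minus strC strC'); rewrite ?eL; try lia.
have -> : (m - (m - b) = b)%N by lia.
by split=> //; lia.
Qed.

(** A substring read in both directions is lazy, so that the direction attached to a
    graph map only matters when there is no choice. *)
Lemma in_seg_dir s a b L i j : segment s a b L ->
  let d := same_dir a (a + L) (lo s b L) (hi s b L) in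
  in_seg d a (base d (lo s b L) (hi s b L)) (a + L - a) i j = in_seg s a b L i j.
Proof.
case=> le_a le_b mt quot sub ev /=.
have eL : (a + L - a = L)%N by lia.
rewrite eL; have le_a12 : (a <= a + L <= n)%N by lia.
case: s mt ev {sub} => /= mt ev.
  suff -> : same_dir a (a + L) b (b + L) by [].
  apply/(agree_plus strC strC' le_a12); first by lia.
  by split=> //; [lia | rewrite eL].
have le_b12 : (m - (b + L) <= m - b <= m)%N by lia.
case: (boolP (same_dir _ _ _ _)) => /= [/eqP dir|_]; last first.
  by have -> : (m - (m - b) = b)%N by lia.
have /eqP inv : subword C' (m - (b + L)) (m - b) == winv (subword C a (a + L)).
  apply/(agree_minus strC strC' le_a12 le_b12).
  have -> : (m - (m - b) = b)%N by lia.
  by rewrite eL; split=> //; lia.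
have L0 : L = 0%N.
  have size_C := size_take_drop le_a12; rewrite -eL -size_C.
  suff -> : take (a + L - a) (drop a C.2) = [::] by [].
  apply: no_palindrome; last by have := congr1 snd inv; rewrite dir.
  by apply/take_sorted/drop_sorted; case/andP: strC.
by rewrite /in_seg /on_diag L0 /=; lia.
Qed.

(** The coefficient stays nonzero along a maximal matched stretch. At its ends a
    letter of the first string pointing inwards, or one of the second pointing
    outwards, would have to be matched by the other string, against maximality. *)
Lemma cover_segment (k : fieldType) (c : nat -> nat -> k) i j : hom_coef C C' c ->
  (i <= n)%N -> (j <= m)%N -> c i j != 0 ->
  exists s a b L, segment s a b L /\ in_seg s a b L i j.
Proof.
move=> hc le_i le_j nz.
(* If the node has an edge, it decides the direction of the diagonal. *)
have [s dir_s] : exists s, forall i' j', edge_ s i (pos s j) i' j' ->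
    (exists i' j', edge_ s i (pos s j) i' j' /\ (i' + pos s j = j' + i)%N).
  have [[i' [j' e]]|none] := excluded_middle_informative (exists i' j', edge_ true i j i' j').
    have [_ le_j'] := edge_pos strC' e.
    exists ((i' + j == j' + i)%N) => _ _ _; case: eqP => [eq_d|ne_d].
      by exists i', j'.
    exists i', (m - j')%N; split; first exact: (edge_flip strC' false e).
    by rewrite /=; have := edge_adj (@walk_adj _ _ strC' true) e; lia.
  by exists true => i' j' e; case: none; exists i', j'.
have le_pj := pos_le s le_j.
have [a [b [L [on_ij mt L_gt0 closed]]]] := @maximal_diag _ _ _ strC
  (@walk_fun _ _ strC' s) (@walk_inj _ _ strC' s) (@walk_arr _ _ strC' s)
  (@walk_anti _ _ strC' s) (@walk_adj _ _ strC' s) i (pos s j).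
have {closed} closed : forall i1 j1 i2 j2, on_diag a b L i1 j1 -> edge_ s i1 j1 i2 j2 ->
    on_diag a b L i2 j2.
  apply: closed; have [e|none] := excluded_middle_informative
    (exists i' j', edge_ s i (pos s j) i' j'); [left|right].
    case: e => i' [j' e]; have [i1 [j1 [e1 eq_d]]] := dir_s _ _ e.
    exact: L_gt0 e1 eq_d.
  by move=> i' j' e; apply: none; exists i', j'.
have [le_a le_b] : (a + L <= n)%N /\ (b + L <= m)%N.
  move: on_ij; rewrite /on_diag; case: (L) mt => [|L'] mt; first by lia.
  have e := mt _ (ltnSn L'); have [_ le1] := edge_le strC e; have [_ le2] := edge_pos strC' e.
  by lia.
exists s, a, b, L; have in_ij : in_seg s a b L i j by rewrite /in_seg le_j.
have cst i' j' : in_seg s a b L i' j' -> c i' j' != 0.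
  move=> in_ij'; apply: (matched_ind (P := fun i j => c i j != 0) mt) in_ij in_ij' nz.
  by move=> x i0 i1 j0 j1 g g'; rewrite (hc_step hc g g').
have le_b0 : (b <= m)%N by lia.
have nz1 := cst _ _ (in_seg_first s a L le_b0).
have nz2 := cst _ _ (in_seg_last s a le_b).
have on1 : on_diag a b L a b by rewrite /on_diag; lia.
have on2 : on_diag a b L (a + L) (b + L) by rewrite /on_diag; lia.
have up j0 i' x : (j0 <= m)%N -> forall i0, go C x i' i0 -> c i0 (pos s j0) != 0 ->
    exists j', edge_ s i0 j0 i' j'.
  move=> le_j0 i0 g /(hc_in hc g (pos_le s le_j0))[j' g'].
  have [le_j' _] := go_le strC' g'; exists (pos s j'), x; right; split=> //.
  by rewrite -(posK s le_j0) walk_pos ?pos_le.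
have down i0 j0 j' x : (i0 <= n)%N -> walk s x j0 j' -> c i0 (pos s j0) != 0 ->
    exists i', edge_ s i0 j0 i' j'.
  move=> le_i0 g; have [_ _ g'] := walk_go strC' g => /(hc_out hc g' le_i0)[i' gi].
  by exists i', x; left.
split=> //; split=> //; last by apply: (hc_vtx hc); rewrite ?pos_le //; lia.
  split=> x; [move=> a_gt0|]; apply/negP => g.
    by have [j' e] := up _ _ _ le_b0 _ g nz1; have := closed _ _ _ _ on1 e; rewrite /on_diag; lia.
  by have [j' e] := up _ _ _ le_b _ g nz2; have := closed _ _ _ _ on2 e; rewrite /on_diag; lia.
split=> x; [move=> b_gt0|]; apply/negP => g.
  have [|i' e] := down a _ _ _ _ g nz1; first by lia.
  by have := closed _ _ _ _ on1 e; rewrite /on_diag; lia.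
have [|i' e] := down (a + L)%N _ _ _ _ g nz2; first by lia.
by have := closed _ _ _ _ on2 e; rewrite /on_diag; lia.
Qed.

Definition quad (q : ('I_n.+1 * 'I_n.+1) * ('I_m.+1 * 'I_m.+1)) : bool :=
  graph_map C C' q.1.1 q.1.2 q.2.1 q.2.2.

(** Crawley-Boevey's basis of the homomorphisms between string modules: the segments
    are the connected components of the nodes that may carry a nonzero coefficient. *)
Theorem dim_HomA_graph_maps (k : fieldType) :
  \dim (HomA (string_module k C) (string_module k C')) = #|quad|.
Proof.
pose K : finType := {q | quad q}; rewrite -[RHS]card_sig -/K.
pose a1 (q : K) : nat := (val q).1.1; pose a2 (q : K) : nat := (val q).1.2.
pose b1 (q : K) : nat := (val q).2.1; pose b2 (q : K) : nat := (val q).2.2.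
pose d q := same_dir (a1 q) (a2 q) (b1 q) (b2 q).
pose b q := base (d q) (b1 q) (b2 q).
pose inK q i j := in_seg (d q) (a1 q) (b q) (a2 q - a1 q) i j.
have segK q : segment (d q) (a1 q) (b q) (a2 q - a1 q) /\
    (a1 q <= a2 q)%N /\ (a2 q - a1 q = b2 q - b1 q)%N /\ (b1 q <= b2 q)%N.
  by apply: graph_map_segment; rewrite ?leq_ord //; apply: (valP q).
pose rep (q : K) : 'I_n.+1 * 'I_m.+1 := ((val q).1.1, if d q then (val q).2.1 else (val q).2.2).
have le_b2 q : (b2 q <= m)%N by rewrite leq_ord.
have in_rep q : inK q (rep q).1 (rep q).2.
  have [_ [_ [_ le_b]]] := segK q; have le_m := le_b2 q.
  rewrite /inK; suff -> : (rep q).2 = pos (d q) (b q) :> nat.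
    by apply: in_seg_first; rewrite /b; case: (d q) => /=; lia.
  by rewrite /rep /b; case: (d q) => //=; rewrite -/(b2 q); lia.
apply: (@dim_HomA_classes k B C C' strC strC' K inK rep) => //.
- move=> q q' i j in1 in2; have [seg [le_a [eL le_b]]] := segK q.
  have [seg' [le_a' [eL' le_b']]] := segK q'.
  have [ea eL2 [eb dir]] := segment_uniq seg seg' in1 in2.
  have := le_b2 q; have := le_b2 q' => le2' le2.
  have [e1 e2] : b1 q = b1 q' /\ b2 q = b2 q'.
    by move: eb dir; rewrite /b; case: (d q); case: (d q') => /= eb [] // dir; lia.
  have ea2 : a2 q = a2 q' by lia.
  apply: val_inj; move: ea ea2 e1 e2; rewrite /a1 /a2 /b1 /b2.
  case: (val q) (val q') => [[x1 x2] [y1 y2]] [[x1' x2'] [y1' y2']] /=.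
  by move=> /val_inj-> /val_inj-> /val_inj-> /val_inj->.
- move=> c hc q i j in_q; have [seg _] := segK q.
  pose v := c (rep q).1 (rep q).2.
  apply: (matched_ind (P := fun i j => c i j = v) (seg_match seg)) (in_rep q) in_q erefl.
  by move=> x i0 i' j0 j' g g'; rewrite (hc_step hc g g').
- move=> c hc i j le_i le_j nz; have [s [a [b' [L [seg in_s]]]]] := cover_segment hc le_i le_j nz.
  have le_a := seg_le seg; have le_b := seg_le' seg.
  have lt1 : (a < n.+1)%N by lia.
  have lt2 : (a + L < n.+1)%N by lia.
  have lt3 : (lo s b' L < m.+1)%N by rewrite /lo; case: (s); lia.
  have lt4 : (hi s b' L < m.+1)%N by rewrite /hi; case: (s); lia.
  pose q0 := ((Ordinal lt1, Ordinal lt2), (Ordinal lt3, Ordinal lt4)).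
  have gq : quad q0 by apply: (segment_graph_map seg).
  by exists (Sub q0 gq); rewrite /inK /b /d /a1 /a2 /b1 /b2 SubK /= in_seg_dir.
move=> u; split=> [x i i' j j' g g'|x i i' j g le_j nz|x i j j' g le_i nz|i j le_i le_j nz].
- by apply: eq_bigl => q; have [seg _] := segK q; rewrite /inK (seg_step seg g g').
- have [q in_q] : exists q, inK q i j.
    by apply: NNPP => none; case/eqP: nz; apply: big_pred0 => q; apply/negP => h; apply: none; exists q.
  by have [seg _] := segK q; have [j' [g' _]] := seg_in seg in_q g; exists j'.
- have [q in_q] : exists q, inK q i j.
    by apply: NNPP => none; case/eqP: nz; apply: big_pred0 => q; apply/negP => h; apply: none; exists q.
  by have [seg _] := segK q; have [i' [g' _]] := seg_out seg in_q g; exists i'.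
have [q in_q] : exists q, inK q i j.
  by apply: NNPP => none; case/eqP: nz; apply: big_pred0 => q; apply/negP => h; apply: none; exists q.
by have [seg _] := segK q; apply: in_seg_vtx seg _ _ in_q.
Qed.

End GraphMapBasis.

Arguments quad {B} C C' q.

(** * Kisses *)

Definition pairs (n : nat) : seq (nat * nat) :=
  [seq (i, j) | i <- iota 0 n.+1, j <- iota i (n.+1 - i)].

Lemma mem_pairs n p : (p \in pairs n) = (p.1 <= p.2 <= n)%N.
Proof.
apply/allpairsPdep/idP => [[i [j [hi hj ->]]]|/andP[le1 le2]] /=.
  move: hi hj; rewrite !mem_iota => /andP[_ hi] /andP[hj hj'].
  by rewrite hj /=; lia.
case: p le1 le2 => i j /= le1 le2.
exists i, j; split=> //; first by rewrite -[_ :: _]/(iota 0 n.+1) mem_iota; lia.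
by rewrite mem_iota le1 /=; lia.
Qed.

Lemma uniq_pairs n : uniq (pairs n).
Proof.
apply: allpairs_uniq_dep => [|i _|[i j] [i' j'] _ _ [-> ->]] //; exact: iota_uniq.
Qed.

Definition fact (Q : quiver) (C : word Q) (p : nat * nat) : word Q * word Q * word Q :=
  (subword C p.2 (wlen C), subword C p.1 p.2, subword C 0 p.1).

Lemma factorizationsE (Q : quiver) (C : word Q) :
  factorizations C = map (fact C) (pairs (wlen C)).
Proof.
by rewrite /factorizations /pairs map_allpairs.
Qed.

Lemma kissE (Q : quiver) (C C' : word Q) :
  kiss C C' = size [seq q <- [seq (p, p') | p <- pairs (wlen C), p' <- pairs (wlen C')]
                       | is_kiss (fact C q.1, fact C' q.2)].
Proof.
rewrite /kiss !factorizationsE size_filter.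
set s := (X in _ = count _ X).
have -> : [seq (t, t') | t <- map (fact C) (pairs (wlen C)), t' <- map (fact C') (pairs (wlen C'))]
    = map (fun q : (nat * nat) * (nat * nat) => (fact C q.1, fact C' q.2)) s.
  by rewrite allpairs_mapl allpairs_mapr [RHS]map_allpairs.
by rewrite count_map.
Qed.

Lemma ohead_rev_take (T : Type) (s : seq T) i : (i <= size s)%N ->
  ohead (rev (take i s)) = lastl s i.
Proof.
case: i => [|i] lt_i; first by rewrite take0.
have : onth s i by rewrite onthTE.
case e: (onth s i) => [x|] // _.
by rewrite (take_nth x) // rev_rcons /= e (onth_nth _ x _ _ e).
Qed.

Lemma ohead_drop (T : Type) (s : seq T) i : ohead (drop i s) = onth s i.
Proof. by elim: s i => [|x s IH] [|i] //=. Qed.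

Lemma is_kissE (Q : quiver) (C C' : word Q) i j i' j' :
  (i <= j <= wlen C)%N -> (i' <= j' <= wlen C')%N ->
  is_kiss (fact C (i, j), fact C' (i', j')) =
  [&& quot_at C i j, sub_at C' i' j', agree C C' i j i' j',
      (0 < i)%N, (j < wlen C)%N, (0 < i')%N & (j' < wlen C')%N].
Proof.
case/andP=> le_ij le_j /andP[le_ij' le_j'].
have le_i := leq_trans le_ij le_j; have le_i' := leq_trans le_ij' le_j'.
rewrite /is_kiss /quotient_fact /submodule_fact /fact /subword /=.
rewrite !drop0 !subn0 !ohead_rev_take // (@take_oversize _ (wlen C - j)) ?size_drop //.
rewrite (@take_oversize _ (wlen C' - j')) ?size_drop //.
by rewrite !ohead_drop /wlen /= !size_drop !size_takel ?subn_gt0.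
Qed.

Section KissesAsGraphMaps.
Variables (B : bquiver) (X C W : word B) (o : nat).
Hypothesis strX : is_string X.
Hypothesis strW : is_string W.
Hypothesis sh : cohook_shape X C o.
Hypothesis ends : forall i, (i <= wlen X)%N ->
  wvtx X i != wvtx W 0 /\ wvtx X i != wvtx W (wlen W).

Lemma cohook_subword a1 a2 : (a1 <= a2 <= wlen X)%N ->
  subword C (o + a1) (o + a2) = subword X a1 a2.
Proof.
case/andP=> le_a le_n; rewrite /subword (cs_vtx sh) ?(leq_trans le_a) //.
rewrite subnDl; congr (_, _); apply: eq_from_onth => t.
rewrite !onth_take_drop; case: ltnP => // lt_t.
by rewrite -addnA (cs_mid sh) //; lia.
Qed.

Lemma cohook_quot_at a1 a2 : (a1 <= a2 <= wlen X)%N ->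
  quot_at C (o + a1) (o + a2) = quot_at X a1 a2.
Proof.
case/andP=> le_a le_n; rewrite /quot_at; congr (_ && _).
  case: a1 le_a => [|a1] le_a; last by rewrite addnS /= (cs_mid sh) //; lia.
  have o_gt0 := cs_left_lt sh; have [a e] := cs_left sh.
  by rewrite addn0 -(prednK o_gt0) /= e.
have [lt_n|ge_n] := ltnP a2 (wlen X); first by rewrite (cs_mid sh).
have -> : a2 = wlen X by lia.
by have [b ->] := cs_right sh; rewrite onth_default.
Qed.

(** A quotient factorization of the cohook completion cuts inside the given string:
    further left the letters are direct, further right they are inverse. *)
Lemma cohook_quot_inside i j : (0 < i)%N -> (i <= j)%N -> (j < wlen C)%N -> quot_at C i j ->
  (o <= i)%N /\ (j <= o + wlen X)%N.
Proof.
move=> i_gt0 le_ij lt_j /andP[q1 q2]; split; rewrite leqNgt; apply/negP => lt.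
  have [|d e] := cs_left_tail sh (w := i.-1); first by lia.
  by move: q1; rewrite -(prednK i_gt0) /= e.
have lt2 : (o + wlen X < j < wlen C)%N by rewrite lt.
by have [d e] := cs_right_tail sh lt2; move: q2; rewrite e.
Qed.

(** The common substring consists of vertices of [X], which are different from the end
    vertices of [W]. *)
Lemma graph_map_inside a1 a2 b1 b2 : (a2 <= wlen X)%N -> (b2 <= wlen W)%N ->
  graph_map X W a1 a2 b1 b2 -> (0 < b1)%N /\ (b2 < wlen W)%N.
Proof.
move=> le_a2 le_b2 gm.
have [seg [le_a [eL le_b]]] := graph_map_segment strX strW le_a2 le_b2 gm.
set s := same_dir _ _ _ _ _ _ in seg.
have [i1 in1] : exists i, in_seg W s a1 (base W s b1 b2) (a2 - a1) i b1.
  by exists (if s then a1 else a2); rewrite /in_seg /on_diag; case: (s) => /=; lia.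
have [i2 in2] : exists i, in_seg W s a1 (base W s b1 b2) (a2 - a1) i b2.
  by exists (if s then a2 else a1); rewrite /in_seg /on_diag; case: (s) => /=; lia.
have v1 := in_seg_vtx strX strW seg in1; have v2 := in_seg_vtx strX strW seg in2.
have le1 : (i1 <= wlen X)%N by move: in1; rewrite /in_seg /on_diag; lia.
have le2 : (i2 <= wlen X)%N by move: in2; rewrite /in_seg /on_diag; lia.
have [/eqP n1 _] := ends le1; have [_ /eqP n2] := ends le2.
split; first by rewrite lt0n; apply/eqP => e; rewrite e in v1.
by rewrite ltn_neqAle le_b2 andbT; apply/eqP => e; rewrite e in v2.
Qed.

(** Kisses differ from graph maps in that the four outer factors have positive length
    and that the first string is completed. The two differences compensate: a cut of
    [X] at one of its ends becomes a cut at the letter leaving [X] there, and [W] is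
    never cut at its ends. *)
Lemma kiss_graph_maps : kiss C W = #|quad X W|.
Proof.
rewrite kissE cardE.
pose f (q : ('I_(wlen X).+1 * 'I_(wlen X).+1) * ('I_(wlen W).+1 * 'I_(wlen W).+1)) :
  (nat * nat) * (nat * nat) := ((o + q.1.1, o + q.1.2)%N, (q.2.1 : nat, q.2.2 : nat)).
rewrite -(size_map f); apply/perm_size/uniq_perm.
- by apply/filter_uniq/allpairs_uniq; rewrite ?uniq_pairs // => -[p1 p2] [p1' p2'] _ _ [-> ->].
- rewrite map_inj_uniq ?enum_uniq // => -[[a1 a2] [b1 b2]] [[a1' a2'] [b1' b2']].
  rewrite /f /= => -[/addnI/val_inj-> /addnI/val_inj->].
  by move=> /val_inj-> /val_inj->.
have lt_o := cs_right_lt sh.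
case=> [[i j] [i' j']]; rewrite mem_filter; apply/andP/mapP => [[]|].
  move=> kq /allpairsP[[p p'] /= [pp pp' [ep ep']]]; subst p p'.
  rewrite !mem_pairs /= in pp pp'; move: kq; rewrite is_kissE //.
  case/and5P=> q sb ag i_gt0 /and3P[lt_j i'_gt0 lt_j'].
  have [le_ij le_j] := andP pp; have [le_ij' le_j'] := andP pp'.
  have [le_o ge_o] := cohook_quot_inside i_gt0 le_ij lt_j q.
  have lt1 : (i - o < (wlen X).+1)%N by lia.
  have lt2 : (j - o < (wlen X).+1)%N by lia.
  have lt3 : (i' < (wlen W).+1)%N by lia.
  have lt4 : (j' < (wlen W).+1)%N by lia.
  have ei : (o + (i - o) = i)%N by lia.
  have ej : (o + (j - o) = j)%N by lia.
  have le_a : (i - o <= j - o <= wlen X)%N by lia.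
  exists ((Ordinal lt1, Ordinal lt2), (Ordinal lt3, Ordinal lt4)); last first.
    by rewrite /f /= ei ej.
  rewrite mem_enum; apply/and5P; split=> //=; first by lia.
    by rewrite -cohook_quot_at // ei ej.
  by move: ag; rewrite /agree -{1 2}ei -{1 2}ej !cohook_subword.
case=> [[[a1 a2] [b1 b2]]]; rewrite mem_enum => gm [-> -> -> ->].
have le_a2 := leq_ord a2; have le_b2 := leq_ord b2.
have [b1_gt0 lt_b2] := graph_map_inside le_a2 le_b2 gm.
have {gm} [le_a le_b q sb ag] : [/\ (a1 <= a2)%N, (b1 <= b2)%N, quot_at X a1 a2,
    sub_at W b1 b2 & agree X W a1 a2 b1 b2] by apply/and5P.
have le1 : (a1 <= a2 <= wlen X)%N by rewrite le_a.
have le2 : (o + a1 <= o + a2 <= wlen C)%N by lia.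
have le3 : (b1 <= b2 <= wlen W)%N by rewrite le_b.
have o_gt0 := cs_left_lt sh.
split; last first.
  by apply/allpairsP; exists ((o + a1, o + a2)%N, (b1 : nat, b2 : nat)); split;
    rewrite ?mem_pairs.
rewrite -[X in is_kiss X]/(fact C (o + a1, o + a2)%N, fact W (b1 : nat, b2 : nat)).
rewrite is_kissE // cohook_quot_at // q sb b1_gt0 lt_b2 /agree cohook_subword //.
by rewrite -/(agree X W a1 a2 b1 b2) ag !andTb andbT addn_gt0 o_gt0; lia.
Qed.

End KissesAsGraphMaps.

(** * Existence and shape of the cohook completion *)

Lemma onth_mem (T : eqType) (s : seq T) i x : onth s i = Some x -> x \in s.
Proof. by move=> e; have := mem_nth x (onth_size e); rewrite (onth_nth x _ _ _ e). Qed.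

Section Completion.
Variable B : bquiver.
Hypothesis gB : gentle B.

(** In the fringed quiver this distinguishes the old vertices from the fringe
    vertices. *)
Definition full (v : vtx B) : bool := (indeg v == 2%N) && (outdeg v == 2%N).

Lemma string_step_linv (l m : letter B) : string_step (linv m) (linv l) = string_step l m.
Proof.
case: l m => a [] [c []]; rewrite /string_step /lsrc /ltgt /linv /= eq_sym;
  by congr (_ && (_ && _)); rewrite eq_sym.
Qed.

(** Of two arrows leaving the end of [l], gentleness forbids at most one as the next
    letter: one that is zero after [l], or the inverse of [l]. *)
Lemma next_direct (l : letter B) : full (ltgt l) ->
  exists b, src b = ltgt l /\ string_step l (b, true).
Proof.
case/andP=> _ /cards2P[b1 [b2 [ne eqb]]].
have src1 : src b1 = ltgt l by apply/eqP; have := set21 b1 b2; rewrite -eqb inE.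
have src2 : src b2 = ltgt l by apply/eqP; have := set22 b1 b2; rewrite -eqb inE.
case: l {eqb} src1 src2 => c [] /= src1 src2; last first.
  have [e|ne1] := eqVneq b1 c.
    exists b2; split=> //; rewrite /string_step /lsrc /= src2 eqxx /=.
    by rewrite andbT -e xpair_eqE negb_and eq_sym ne.
  exists b1; split=> //; rewrite /string_step /lsrc /= src1 eqxx /=.
  by rewrite andbT xpair_eqE negb_and ne1.
have [z1|nz1] := boolP (zrel b1 c); last first.
  exists b1; split=> //; rewrite /string_step /lsrc /= src1 eqxx /= nz1 andbT.
  by rewrite xpair_eqE negb_and orbT.
exists b2; split=> //; rewrite /string_step /lsrc /= src2 eqxx /=.
rewrite xpair_eqE andbF /=; apply/negP => z2.
by have /eqP := gentle_right_z gB z1 z2; rewrite (negPf ne).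
Qed.

Lemma prev_direct (l : letter B) : full (lsrc l) ->
  exists b, tgt b = lsrc l /\ string_step (b, true) l.
Proof.
case/andP=> /cards2P[b1 [b2 [ne eqb]]] _.
have tgt1 : tgt b1 = lsrc l by apply/eqP; have := set21 b1 b2; rewrite -eqb inE.
have tgt2 : tgt b2 = lsrc l by apply/eqP; have := set22 b1 b2; rewrite -eqb inE.
case: l {eqb} tgt1 tgt2 => c [] /= tgt1 tgt2; last first.
  have [e|ne1] := eqVneq b1 c.
    exists b2; split=> //; rewrite /string_step /ltgt /= tgt2 eqxx /=.
    by rewrite andbT -e xpair_eqE negb_and ne.
  exists b1; split=> //; rewrite /string_step /ltgt /= tgt1 eqxx /=.
  by rewrite andbT xpair_eqE negb_and eq_sym ne1.
have [z1|nz1] := boolP (zrel c b1); last first.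
  exists b1; split=> //; rewrite /string_step /ltgt /= tgt1 eqxx /= nz1 andbT.
  by rewrite xpair_eqE negb_and orbT.
exists b2; split=> //; rewrite /string_step /ltgt /= tgt2 eqxx /=.
rewrite xpair_eqE andbF /=; apply/negP => z2.
by have /eqP := gentle_left_z gB z1 z2; rewrite (negPf ne).
Qed.

Lemma size_nonzero_sorted (p : seq (arr B)) :
  sorted (@nonzero_step B) p -> (size p <= #|arr B|)%N.
Proof.
case: p => // a p sp; apply: (@size_nonzero_path B (src a) (a :: p) gB).
by rewrite /is_nonzero_path /= eqxx.
Qed.

(** The length of direct and inverse strings is bounded because the ideal is
    admissible, so that the longest ones exist. *)
Lemma size_direct (D : word B) : is_string D -> is_direct D -> (wlen D <= #|arr B|)%N.
Proof.
case/andP=> _ sD dD; rewrite /wlen -(size_map fst); apply: size_nonzero_sorted.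
rewrite sorted_map; apply: sub_in_sorted dD sD => -[a s] [b t] /= ; rewrite !unfold_in /=.
by move=> -> -> /and3P[h1 _ h2]; apply/andP.
Qed.

Lemma size_inverse (D : word B) : is_string D -> is_inverse D -> (wlen D <= #|arr B|)%N.
Proof.
case/andP=> _ sD dD; rewrite /wlen -(size_map fst) -size_rev; apply: size_nonzero_sorted.
rewrite rev_sorted sorted_map; apply: sub_in_sorted dD sD => -[a s] [b t] /=.
rewrite !unfold_in /= => /negPf-> /negPf-> /and3P[h1 _ h2]; apply/andP; split=> //.
by rewrite /composable eq_sym.
Qed.

Lemma longest_exists (P : word B -> Prop) (C : word B) N : P C ->
  (forall C', P C' -> (wlen C' <= N)%N) -> exists C', longest P C'.
Proof.
have [d] := ubnP (N - wlen C)%N; elim: d => // d IH in C *; move=> lt_d PC bound.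
have [[C' [PC' lt]]|none] :=
    excluded_middle_informative (exists C', P C' /\ (wlen C < wlen C')%N).
  by apply: (IH C') => //; have := bound _ PC'; lia.
exists C; split=> // C' PC'; rewrite leqNgt; apply/negP => lt.
by apply: none; exists C'.
Qed.

Lemma wtgtE (C : word B) : wtgt C = last C.1 (map (@ltgt B) C.2).
Proof. by rewrite /wtgt /wvtx take_size. Qed.

Lemma cohook_exists (X : word B) : is_string X -> full (wsrc X) -> full (wtgt X) ->
  exists C, is_cohook X C.
Proof.
move=> strX fs ft.
have [a [b [src_a src_b str]]] : exists a b : arr B, [/\ src a = wsrc X, src b = wtgt X
    & is_string (wcat (wletter (b, true)) (wcat X (wletter (a, false))))].
  case: X strX fs ft => x [|l s] strX; rewrite wtgtE /wsrc /= => fs ft.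
    case/andP: fs => _ /cards2P[b1 [b2 [ne eqb]]].
    have src1 : src b1 = x by apply/eqP; have := set21 b1 b2; rewrite -eqb inE.
    have src2 : src b2 = x by apply/eqP; have := set22 b1 b2; rewrite -eqb inE.
    exists b1, b2; split=> //; rewrite /is_string /= eqxx andbT /=.
    by rewrite /string_step /lsrc /ltgt /= src1 src2 eqxx xpair_eqE negb_and eq_sym ne.
  have src_l : lsrc l = x by case/andP: strX => /eqP.
  have tgt_l : ltgt (linv l) = x by rewrite -src_l; case: (l) => c [].
  have [|a [src_a step_a]] := @next_direct (linv l); first by rewrite tgt_l.
  rewrite -[(a, true)]/(linv (a, false)) string_step_linv in step_a.
  rewrite last_map in ft *; have [b [src_b step_b]] := next_direct ft.
  exists a, b; split=> //; first by rewrite src_a.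
  rewrite /is_string /= eqxx /= step_a cat_path /= step_b !andbT.
  by case/andP: strX.
pose PD := (fun D' : word B => [/\ is_string D', is_direct D', wtgt D' = tgt a &
  is_string (wcat (wletter (a, false)) D')]).
pose PI := (fun I' : word B => [/\ is_string I', is_inverse I', wsrc I' = tgt b &
  is_string (wcat I' (wletter (b, true)))]).
have [D longD] : exists D, longest PD D.
  apply: (@longest_exists PD (tgt a, [::]) #|arr B|) => [|D' [s d _ _]].
    by split=> //; rewrite /is_string /= eqxx.
  exact: size_direct.
have [I longI] : exists I, longest PI I.
  apply: (@longest_exists PI (tgt b, [::]) #|arr B|) => [|D' [s d _ _]].
    by split=> //; rewrite /is_string /= eqxx.
  exact: size_inverse.
by eexists; exists a, b, D, I; split.
Qed.

Lemma string_cons (c : arr B) (l : letter B) (s : seq (letter B)) :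
  string_step (c, true) l -> is_string (lsrc l, l :: s) -> is_string (src c, (c, true) :: l :: s).
Proof. by move=> st /andP[_ h]; rewrite /is_string /= eqxx st. Qed.

(** By maximality the tails cannot be prolonged, and they could be if one of their ends
    had two arrows into it and two out of it. *)
Lemma is_cohook_shape (X C : word B) : is_string X -> is_cohook X C ->
  exists2 o, cohook_shape X C o & ~~ full (wvtx C 0) /\ ~~ full (wvtx C (wlen C)).
Proof.
move=> strX [a [b [D [I]]]].
rewrite /wcat /wletter /= => -[[src_a src_b str] [[strD dirD tgtD strDa] maxD]
  [[strI invI srcI strbI] maxI] ->].
(* [X] starts behind the tail [D] and the inverse letter [a]. *)
set C0 : word B := (_, _); exists (size D.2).+1.
  have eC : C0.2 = D.2 ++ (a, false) :: X.2 ++ (b, true) :: I.2.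
    by rewrite /= -!catA.
  have size_C : wlen C0 = (size D.2 + (size X.2 + (size I.2).+1).+1)%N.
    by rewrite /wlen eC size_cat /= size_cat.
  have onthC i : onth C0.2 (size D.2 + i) = onth ((a, false) :: X.2 ++ (b, true) :: I.2) i.
    by rewrite eC onth_cat ltnNge leq_addr addKn.
  have left : onth C0.2 (size D.2) = Some (a, false) by rewrite -[size D.2]addn0 onthC.
  have mid i : (i < wlen X)%N -> onth C0.2 ((size D.2).+1 + i) = onth X.2 i.
    by move=> lt_i; rewrite addSnnS onthC /= onth_cat lt_i.
  have right : onth C0.2 ((size D.2).+1 + wlen X) = Some (b, true).
    by rewrite addSnnS onthC /= onth_cat ltnn subnn.
  split=> //.
  - apply/andP; split.
      rewrite eC /=; case/andP: strDa; rewrite /=; by case: (D.2).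
    case/andP: strDa => _ /=; case/andP: str => _ /=; case/andP: strbI => _ /=.
    rewrite -!catA /= => s1 s2 s3; rewrite sorted_cat_cons -cats1 s3 /=.
    by move: s2; rewrite !cat_path /= s1 !andbT.
  - by rewrite size_C /wlen; lia.
  - case=> [|i] lt_i; last first.
      have : onth X.2 i by rewrite onthTE.
      case e: (onth X.2 i) => [l|] // _.
      by rewrite addnS (wvtxS e) (@wvtxS _ _ _ l) // mid.
    by rewrite addn0 (wvtxS left) /wvtx take0; apply: src_a.
  - by exists b.
  - by exists a.
  - move=> w /andP[lt_w lt_w']; have [d ew] : exists d, w = ((size D.2).+1 + wlen X + d.+1)%N.
      by exists (w - ((size D.2).+1 + wlen X).+1)%N; lia.
    have lt_d : (d < size I.2)%N by move: lt_w'; rewrite ew size_C /wlen; lia.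
    have -> : onth C0.2 w = onth I.2 d.
      rewrite ew -addnA addSnnS onthC /= onth_cat ltnNge -[size X.2]/(wlen X) addnS.
      by rewrite leqW ?leq_addr //= -addnS addKn.
    have : onth I.2 d by rewrite onthTE.
    case e: (onth I.2 d) => [[x t]|] // _.
    have /= := allP invI _ (onth_mem e); by case: (t) e => // e _; exists x.
  move=> w lt_w; have -> : onth C0.2 w = onth D.2 w by rewrite eC onth_cat lt_w.
  have : onth D.2 w by rewrite onthTE.
  case e: (onth D.2 w) => [[x t]|] // _.
  have /= := allP dirD _ (onth_mem e); by case: (t) e => // e _; exists x.
split; apply/negP => fullv.
  have {fullv} : full D.1 by move: fullv; rewrite /wvtx take0.
  case: D strD dirD tgtD strDa maxD {C0} => x s strD dirD tgtD strDa maxD /= fullx.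
  have [l [s' es]] : exists l s', s ++ [:: (a, false)] = l :: s'.
    by case: (s) => [|l s']; [exists (a, false), [::] | exists l, (s' ++ [:: (a, false)])].
  have ex : lsrc l = x by case/andP: strDa; rewrite /= es /= => /eqP.
  have [|c [tgt_c step_c]] := @prev_direct l; first by rewrite ex.
  suff /maxD : [/\ is_string (src c, (c, true) :: s), is_direct (src c, (c, true) :: s),
      wtgt (src c, (c, true) :: s) = tgt a &
      is_string (src c, ((c, true) :: s) ++ [:: (a, false)])] by rewrite /wlen /= ltnn.
  split=> //.
  - rewrite /is_string /= eqxx /=; case: (s) es strD => //= l' s2 [-> _].
    by rewrite step_c => /andP[_].
  - by rewrite -tgtD !wtgtE /= /ltgt /= tgt_c ex.
  by rewrite cat_cons es; apply: string_cons; rewrite // ex -es.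
have {fullv} : full (last (src b) (map (@ltgt B) ((b, true) :: I.2))).
  by move: fullv; rewrite -/(wtgt _) wtgtE /= !map_cat !last_cat.
case: I strI invI srcI strbI maxI {C0} => x s strI invI srcI strbI maxI.
rewrite [map _ _]/= /= last_map => fullx.
have [|c [src_c step_c]] := @prev_direct (linv (last (b, true) s)).
  by move: fullx; case: (last _ _) => d [].
rewrite -[(c, true)]/(linv (c, false)) string_step_linv in step_c.
suff /maxI : [/\ is_string (x, rcons s (c, false)), is_inverse (x, rcons s (c, false)),
    x = tgt b & is_string (src b, (b, true) :: rcons s (c, false))].
  by rewrite /wlen /= size_rcons ltnn.
have path_b : path (@string_step B) (b, true) (rcons s (c, false)).
  by rewrite rcons_path step_c andbT; case/andP: strbI.
split=> //.
- apply/andP; split; last exact: path_sorted path_b.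
  case: (s) strI path_b => [|l s'] /=; last by case/andP.
  by rewrite /string_step /= => _ /andP[/andP[/eqP-> _] _]; apply/eqP; exact/esym.
- by rewrite /is_inverse all_rcons.
by rewrite /is_string /= eqxx.
Qed.

Theorem cohook_spec (X : word B) : is_string X -> full (wsrc X) -> full (wtgt X) ->
  exists2 o, cohook_shape X (cohook X) o &
    ~~ full (wvtx (cohook X) 0) /\ ~~ full (wvtx (cohook X) (wlen (cohook X))).
Proof.
move=> strX fs ft; apply: is_cohook_shape => //.
by apply: epsilon_spec; apply: cohook_exists.
Qed.

End Completion.

(** * The fringed algebra *)

Section Fringe.
Variables (B : bquiver) (R : rel (arr (fringe_quiver B))).
Hypotheses (gB : gentle B) (fR : fringed R).
Let Bh := BQuiver R.
Implicit Types C X Y : word B.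
Local Notation hat C := (fringe_word C : word Bh).

Lemma count_tag (g : vtx B -> nat) v : #|[set f : {w : vtx B & 'I_(g w)} | tag f == v]| = g v.
Proof.
rewrite -sum1dep_card; transitivity (\sum_(w | w == v) \sum_(i < g w) 1)%N.
  by rewrite (sig_big_dep _ (fun=> xpredT) (fun _ _ => 1%N)); apply: eq_bigl => p; rewrite andbT.
by rewrite big_pred1_eq sum1_card card_ord.
Qed.

Lemma full_old (v : vtx B) : full (inl v : vtx Bh).
Proof.
have in_le := gentle_in gB v; have out_le := gentle_out gB v.
apply/andP; split; apply/eqP; rewrite /indeg /outdeg -sum1dep_card !big_sumType /=.
  rewrite (sum1dep_card (fun a : arr B => tgt a == v)).
  rewrite (sum1dep_card (fun f : fringe_in B => tag f == v)) count_tag big_pred0 // -/(indeg v).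
  by lia.
rewrite (sum1dep_card (fun a : arr B => src a == v)).
rewrite (sum1dep_card (fun f : fringe_out B => tag f == v)) count_tag big_pred0 // -/(outdeg v).
by lia.
Qed.

Definition fringe_letter (l : letter B) : letter Bh := (inl l.1, l.2).

Lemma fringe_letter_inj : injective fringe_letter.
Proof. by move=> [a s] [b t] [-> ->]. Qed.

Lemma fringe_word_inj : injective (fun C => hat C).
Proof.
move=> [x s] [y t] e; have [ex es] : x = y /\ map fringe_letter s = map fringe_letter t.
  by case: e.
by rewrite ex (inj_map fringe_letter_inj es).
Qed.

Lemma wlen_hat C : wlen (hat C) = wlen C.
Proof. exact: size_map. Qed.

Lemma ltgt_hat l : ltgt (fringe_letter l) = inl (ltgt l).
Proof. by case: l => a []. Qed.

Lemma lsrc_hat l : lsrc (fringe_letter l) = inl (lsrc l).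
Proof. by case: l => a []. Qed.

Lemma wvtx_hat C i : wvtx (hat C) i = inl (wvtx C i).
Proof.
rewrite /wvtx -[RHS]last_map -map_take -!map_comp; congr (last _ _).
by apply: eq_map => l /=; apply: ltgt_hat.
Qed.

Lemma onth_hat C i : onth (hat C).2 i = omap fringe_letter (onth C.2 i).
Proof. exact: onth_map. Qed.

Lemma string_step_hat l m : string_step (fringe_letter l) (fringe_letter m) = string_step l m.
Proof.
by case: l m => a [] [b []]; rewrite /string_step /= ?(fringed_old fR).
Qed.

Lemma is_string_hat C : is_string (hat C) = is_string C.
Proof.
rewrite /is_string /= sorted_map; congr (_ && _).
  by case: (C.2) => //= l s; rewrite -[lsrc _]/(lsrc (fringe_letter l)) lsrc_hat.
by apply: eq_sorted => l m /=; apply: string_step_hat.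
Qed.

Lemma go_hat C a i j : go (hat C) (inl a : arr Bh) i j = go C a i j.
Proof.
rewrite /go !onth_hat; congr (_ && _ || _ && _).
  by case: (onth _ i) => [[b s]|].
by case: (onth _ j) => [[b s]|].
Qed.

(** Strings of the original quiver never meet the new arrows. *)
Lemma go_fringe C f i j : go (hat C) (inr f : arr Bh) i j = false.
Proof.
rewrite /go !onth_hat.
by case: (onth _ i) => [[b s]|]; case: (onth _ j) => [[c t]|]; rewrite ?andbF.
Qed.

Lemma relator_hat Y i c : is_string Y -> relator (hat Y) i (inl c : arr Bh) = relator Y i c.
Proof.
move=> strY; have strYh : is_string (hat Y) by rewrite is_string_hat.
apply/(relatorP strYh)/(relatorP strY); rewrite wvtx_hat => -[/= e h].
  split=> [|b i' g]; first by case: e.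
  by rewrite -(fringed_old fR); apply: (h (inl b) i'); rewrite go_hat.
split=> [|[b|f] i']; first by rewrite /= e.
  by rewrite go_hat /= => /h; rewrite (fringed_old fR).
by rewrite go_fringe.
Qed.

Lemma graph_map_hat C C' a1 a2 b1 b2 :
  graph_map (hat C) (hat C') a1 a2 b1 b2 = graph_map C C' a1 a2 b1 b2.
Proof.
have sub D i j : subword (hat D) i j = fringe_word (subword D i j).
  by rewrite /subword wvtx_hat -map_drop -map_take.
have inv D : winv (hat D) = fringe_word (winv D).
  rewrite /winv /wtgt wlen_hat wvtx_hat /fringe_word /= map_rev -!map_comp.
  by congr (_, rev _); apply: eq_map => -[a s].
have lst D i : lastl (hat D).2 i = omap fringe_letter (lastl D.2 i).
  by case: i => // i; apply: onth_hat.
rewrite /graph_map /quot_at /sub_at /agree !lst !onth_hat !sub inv !(inj_eq fringe_word_inj).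
by case: (lastl _ _); case: (onth _ _); case: (lastl _ _); case: (onth _ _).
Qed.

Variable k : fieldType.

Lemma dim_HomA_hat X Y : is_string X -> is_string Y ->
  \dim (HomA (string_module k (hat X)) (string_module k (hat Y)))
    = \dim (HomA (string_module k X) (string_module k Y)).
Proof.
move=> strX strY; rewrite !dim_HomA_graph_maps ?is_string_hat // /quad !wlen_hat.
by apply: eq_card => q; apply: graph_map_hat.
Qed.

Lemma card_hat X (v : vtx B) :
  #|[set j : 'I_(wlen (hat X)).+1 | wvtx (hat X) j == inl v]|
    = #|[set j : 'I_(wlen X).+1 | wvtx X j == v]|.
Proof.
rewrite !wlen_hat; apply: eq_card => j; rewrite !inE wvtx_hat.
by rewrite (inj_eq (@inl_inj _ _)).
Qed.

(** The Auslander-Reiten translates over the two algebras differ, but a new arrow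
    leaving [Y] in the fringed quiver ends at a fringe vertex, where [X] vanishes. So
    the combinatorial expressions for the dimensions agree. *)
Lemma dim_HomA_tau_hat X Y : is_string X -> is_string Y ->
  \dim (HomA (string_module k (hat X)) (tau (string_module k (hat Y))))
    = \dim (HomA (string_module k X) (tau (string_module k Y))).
Proof.
move=> strX strY; have strXh : is_string (hat X) by rewrite is_string_hat.
have strYh : is_string (hat Y) by rewrite is_string_hat.
have e := dim_HomA_tau_string k gB strX strY.
have eh := dim_HomA_tau_string k (fringed_gentle fR) strXh strYh.
rewrite dim_HomA_hat // in eh.
have nodes : (\sum_(i < (wlen (hat Y)).+1) #|[set j : 'I_(wlen (hat X)).+1 | wvtx (hat X) j == wvtx (hat Y) i]|
    = \sum_(i < (wlen Y).+1) #|[set j : 'I_(wlen X).+1 | wvtx X j == wvtx Y i]|)%N.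
  transitivity (\sum_(i < (wlen (hat Y)).+1) #|[set j : 'I_(wlen X).+1 | wvtx X j == wvtx Y i]|)%N.
    by apply: eq_bigr => i _; rewrite wvtx_hat card_hat.
  by rewrite wlen_hat.
have rels : (\sum_(i < (wlen (hat Y)).+1)
      \sum_(c | relator (hat Y) i c) #|[set j : 'I_(wlen (hat X)).+1 | wvtx (hat X) j == tgt c]|
    = \sum_(i < (wlen Y).+1) \sum_(c | relator Y i c) #|[set j : 'I_(wlen X).+1 | wvtx X j == tgt c]|)%N.
  transitivity (\sum_(i < (wlen (hat Y)).+1)
      \sum_(c | relator Y i c) #|[set j : 'I_(wlen X).+1 | wvtx X j == tgt c]|)%N; last by rewrite wlen_hat.
  apply: eq_bigr => i _; rewrite !big_sumType /=.
  rewrite [X in (_ + (X + _))%N]big_pred0 => [|f]; last first.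
    by apply/negP => /(relatorP strYh)[]; rewrite wvtx_hat.
  rewrite [X in (_ + (_ + X))%N]big1 => [|f _]; last first.
    by apply/eqP; rewrite cards_eq0; apply/eqP/setP => j; rewrite !inE wvtx_hat.
  rewrite !addn0; apply: eq_big => [c|c _]; first exact: relator_hat.
  exact: card_hat.
move: e eh; rewrite nodes rels => <-.
exact: addIn.
Qed.

End Fringe.

Theorem theorem4p4 (k : fieldType) (B : bquiver) (R : rel (arr (fringe_quiver B)))
    (X Y : word B)
    (B_connected : connected B) (B_gentle : gentle B) (R_fringed : fringed R)
    (X_string : is_string X) (Y_string : is_string Y) :
  let Bhat := BQuiver R in
  let Xhat : word Bhat := fringe_word X in
  let Yhat : word Bhat := fringe_word Y in
  kiss (cohook Xhat) (cohook Yhat)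
    = \dim (HomA (string_module k Xhat) (tau (string_module k Yhat)))
  /\ \dim (HomA (string_module k Xhat) (tau (string_module k Yhat)))
    = \dim (HomA (string_module k X) (tau (string_module k Y))).
Proof.
move=> Bhat Xhat Yhat; split; last exact: dim_HomA_tau_hat.
have gBh : gentle Bhat := fringed_gentle R_fringed.
have full_hat (Z : word B) i : full (wvtx (fringe_word Z : word Bhat) i).
  by rewrite wvtx_hat; apply: full_old.
have full_src (Z : word B) : full (wsrc (fringe_word Z : word Bhat)) by apply: full_old.
have strXh : is_string Xhat by rewrite is_string_hat.
have strYh : is_string Yhat by rewrite is_string_hat.
have [oX shX _] := cohook_spec gBh strXh (full_src X) (full_hat X _).
have [oY shY [end0 end1]] := cohook_spec gBh strYh (full_src Y) (full_hat Y _).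
have ends i : wvtx Xhat i != wvtx (cohook Yhat) 0 /\
    wvtx Xhat i != wvtx (cohook Yhat) (wlen (cohook Yhat)).
  by split; [apply: contraNneq end0 | apply: contraNneq end1] => <-; apply: full_hat.
have strW := cs_string shY.
rewrite (kiss_graph_maps strXh strW shX (fun i _ => ends i)) -(dim_HomA_graph_maps strXh strW k).
apply/esym/(dim_HomA_cohook gBh strYh shY (string_module_module k strXh)) => w w_end x.
apply/ffunP => j; rewrite [LHS]string_vE ffunE; case: eqP => // e.
by have [] := ends j; case: w_end e => -> ->; rewrite eqxx.
Qed.
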